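(* Let $\mathbb{X}=(X_k)_{k\in\mathbb{N}}$ be a (possibly non-symmetric and non-homogeneous) Rademacher sequence with parameters $p_k=1-q_k\in(0,1)$, let $F\in\operatorname{dom}(\hat D)=\operatorname{dom}(D)$ be centered and let $Z\sim N(0,1)$. Then one has the Malliavin-Stein bounds $$d_{\mathcal W}(F,Z)\leq\sqrt{\frac2\pi}\,\mathbb{E}\Bigl|1-\sum_{k=1}^\infty\hat D_k(-L^{-1}F)\,\hat D_kF\,Y_k^2\Bigr|+\sum_{k=1}^\infty\frac{1-2p_kq_k}{\sqrt{p_kq_k}}\,\mathbb{E}\Bigl[\bigl|\hat D_k(-L^{-1}F)\bigr|\bigl(\hat D_kF\bigr)^2\Bigr],$$ $$d_{\mathcal K}(F,Z)\leq\mathbb{E}\Bigl|1-\sum_{k=1}^\infty\hat D_k(-L^{-1}F)\,\hat D_kF\,Y_k^2\Bigr|+2\sum_{k=1}^\infty|p_k-q_k|\,\mathbb{E}\Bigl[\bigl|\hat D_kL^{-1}F\bigr|\bigl|\hat D_kF\bigr|\Bigr]+4\,\mathbb{E}\Bigl|\sum_{k=1}^\infty\sqrt{p_kq_k}\,\bigl(|\hat D_kL^{-1}F|\,\hat D_kF\bigr)Y_k\Bigr|,$$ as well as the Clark-Ocone bounds $$d_{\mathcal W}(F,Z)\leq\sqrt{\frac2\pi}\,\mathbb{E}\Bigl|1-\sum_{k=1}^\infty\bigl(\mathbb{E}[\hat D_kF\mid\mathcal{F}_{k-1}]\,\hat D_kF\bigr)Y_k^2\Bigr|+\sum_{k=1}^\infty\frac{1-2p_kq_k}{\sqrt{p_kq_k}}\,\mathbb{E}\Bigl[\bigl|\mathbb{E}[\hat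 D_kF\mid\mathcal{F}_{k-1}]\bigr|\bigl(\hat D_kF\bigr)^2\Bigr],$$ $$d_{\mathcal K}(F,Z)\leq\mathbb{E}\Bigl|1-\sum_{k=1}^\infty\bigl(\mathbb{E}[\hat D_kF\mid\mathcal{F}_{k-1}]\,\hat D_kF\bigr)Y_k^2\Bigr|+2\sum_{k=1}^\infty|p_k-q_k|\,\mathbb{E}\Bigl[\bigl|\mathbb{E}[\hat D_kF\mid\mathcal{F}_{k-1}]\bigr|\bigl|\hat D_kF\bigr|\Bigr]+4\,\mathbb{E}\Bigl|\sum_{k=1}^\infty\sqrt{p_kq_k}\,\Bigl(\bigl|\mathbb{E}[\hat D_kF\mid\mathcal{F}_{k-1}]\bigr|\,\hat D_kF\Bigr)Y_k\Bigr|.$$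
   Context: A Rademacher sequence with parameters $p_k=1-q_k\in(0,1)$ is a sequence $\mathbb{X}=(X_k)_{k\in\mathbb{N}}$ of independent $\{-1,1\}$-valued random variables on a probability space $(\Omega,\mathcal{A},\mathbb{P})$ with $\mathbb{P}(X_k=1)=p_k$, $\mathbb{P}(X_k=-1)=q_k$. Put $Y_k=\frac{X_k+q_k-p_k}{2\sqrt{p_kq_k}}$ (the normalization of $X_k$). Let $\mathcal{F}=\sigma(\mathbb{X})$, $\mathcal{F}_M=\sigma(X_j:j\in M)$, $\mathcal{F}_n=\sigma(X_1,\dotsc,X_n)$, $\mathcal{F}_0$ trivial, $\mathcal{G}_k=\sigma(X_j:j\neq k)$, $L^r_{\mathbb{X}}=L^r(\Omega,\mathcal{F},\mathbb{P})$; $\kappa$ is counting measure on $\mathbb{N}$, $\mathbb{P}_{\mathcal F}$ the restriction of $\mathbb{P}$ to $\mathcal{F}$. For $F=f(\mathbb{X})\in L^1_{\mathbb{X}}$ the Rademacher discrete gradient is $$\hat D_kF=\sqrt{p_kq_k}\Bigl(f(X_1,\dotsc,X_{k-1},1,X_{k+1},\dotsc)-f(X_1,\dotsc,X_{k-1},-1,X_{k+1},\dotsc)\Bigr).$$ Put $D_kF:=F-\mathbb{E}[F\mid\mathcal{G}_k]$ (one has $D_kF=Y_k\hat D_kF$). On the space of all $F\in L^2_{\mathbb{X}}$ that are $\mathcal{F}_n$-measurable for some $n$, put $DF:=(D_kF)_{k}\in L^2(\kappa\otimes\mathbb{P}_{\mathcal F})$; this is closable, its closure is denoted $D$ with domain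 $\operatorname{dom}(D)$, which coincides with the domain $\operatorname{dom}(\hat D)$ of the standard Rademacher gradient $\hat D=(\hat D_k)_k$. With $\delta$ the Hilbert space adjoint of $D$, $\operatorname{dom}(L)=\{F\in\operatorname{dom}(D):DF\in\operatorname{dom}(\delta)\}$, $LF:=-\delta DF$. For centered $G\in L^2_{\mathbb{X}}$, $L^{-1}G$ is the unique centered element of $\operatorname{dom}(L)$ with $L(L^{-1}G)=G$; explicitly $L^{-1}G=-\sum_{\emptyset\neq M\subseteq\mathbb{N}\text{ finite}}|M|^{-1}G_M$ in $L^2(\mathbb{P})$, where $G_M=\sum_{K\subseteq M}(-1)^{|M|-|K|}\mathbb{E}[G\mid\mathcal{F}_K]$. Distances: $d_{\mathcal W}(Y,W)=\sup_h|\mathbb{E}[h(Y)]-\mathbb{E}[h(W)]|$ over all $1$-Lipschitz $h:\mathbb{R}\to\mathbb{R}$; $d_{\mathcal K}(Y,W)=\sup_{z\in\mathbb{R}}|\mathbb{P}(Y\le z)-\mathbb{P}(W\le z)|$. The right-hand sides may be $+\infty$. *)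

(* Defs.v *)
From HB Require Import structures.
From mathcomp Require Import all_boot all_order all_algebra finmap.
From mathcomp Require Import all_classical all_reals all_analysis.

Set Implicit Arguments.
Unset Strict Implicit.
Unset Printing Implicit Defensive.
Import Order.TTheory GRing.Theory Num.Theory.
Import numFieldNormedType.Exports.

Local Open Scope classical_set_scope.
Local Open Scope ring_scope.

(** Sequences are indexed from 0: the index [k] below stands for [k+1] in the
    usual numbering of a sequence (X_k)_{k >= 1}, so that the sigma-algebra
    generated by the first [k] variables is generated by the [X j], [j < k].
    Elements of L^r spaces are represented by real-valued functions; objects
    defined only up to null sets (conditional expectations, L^-1) are versions
    picked by [xget]. *)

Definition sigma_gen (R : realType) (T : Type) (X : nat -> T -> R)
    (M : set nat) : set (set T) :=
  <<s \bigcup_(j in M) preimage_set_system setT (X j) measurable >>.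

Definition measurable_wrt (R : realType) (T : Type) (G : set (set T))
    (F : T -> R) : Prop :=
  preimage_set_system setT F measurable `<=` G.

Definition mutually_independent (R : realType) (d : measure_display)
    (T : measurableType d) (P : probability T R) (X : nat -> T -> R) : Prop :=
  forall (J : {fset nat}) (B : nat -> set R),
    (forall j, measurable (B j)) ->
    P (\bigcap_(j in [set` J]) X j @^-1` B j) =
    (\prod_(j <- J) P (X j @^-1` B j))%E.

Record rademacher_seq (R : realType) (d : measure_display)
    (T : measurableType d) (P : probability T R)
    (X : nat -> {RV P >-> R}) (p q : nat -> R) : Prop := {
  rad_param : forall k, 0 < p k < 1 ;
  rad_compl : forall k, p k = 1 - q k ;
  rad_val : forall k w, X k w = 1 \/ X k w = -1 ;
  rad_pos : forall k, P (X k @^-1` [set 1]) = (p k)%:E ;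
  rad_neg : forall k, P (X k @^-1` [set -1]) = (q k)%:E ;
  rad_indep : mutually_independent P (fun k => X k)
}.

Definition normalized (R : realType) (T : Type) (X : nat -> T -> R)
    (p q : nat -> R) (k : nat) (w : T) : R :=
  (X k w + q k - p k) / (2 * Num.sqrt (p k * q k)).

Definition is_condexp (R : realType) (d : measure_display)
    (T : measurableType d) (P : probability T R) (G : set (set T))
    (F H : T -> R) : Prop :=
  [/\ measurable_wrt G H,
      P.-integrable setT (EFin \o H) &
      forall A, G A ->
        (\int[P]_(w in A) (H w)%:E = \int[P]_(w in A) (F w)%:E)%E].

Definition condexp (R : realType) (d : measure_display)
    (T : measurableType d) (P : probability T R) (G : set (set T))
    (F : T -> R) : T -> R :=
  xget (fun=> 0) (is_condexp P G F).

(** [f] is required to be measurable for the product sigma-algebra on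
    [nat -> R] (generated by the coordinates): two measurable representatives
    of the same random variable give almost surely the same gradient, which
    fails for arbitrary [f], as the range of [X] may be a proper subset of the
    set of sign sequences. *)
Definition represents (R : realType) (T : Type) (X : nat -> T -> R)
    (F : T -> R) (f : (nat -> R) -> R) : Prop :=
  measurable_wrt (sigma_gen (fun k (x : nat -> R) => x k) setT) f /\
  forall w, F w = f (X ^~ w).

Definition upd (R : realType) (x : nat -> R) (k : nat) (a : R) : nat -> R :=
  fun j => if j == k then a else x j.

Definition Dhat (R : realType) (T : Type) (X : nat -> T -> R)
    (p q : nat -> R) (k : nat) (F : T -> R) (w : T) : R :=
  let f := xget (fun=> 0) (represents X F) in
  Num.sqrt (p k * q k) * (f (upd (X ^~ w) k 1) - f (upd (X ^~ w) k (-1))).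

Definition Dgrad (R : realType) (d : measure_display)
    (T : measurableType d) (P : probability T R) (X : nat -> T -> R)
    (k : nat) (F : T -> R) (w : T) : R :=
  F w - condexp P (sigma_gen X [set j | j != k]) F w.

Definition L2X (R : realType) (d : measure_display)
    (T : measurableType d) (P : probability T R) (X : nat -> T -> R)
    (F : T -> R) : Prop :=
  measurable_wrt (sigma_gen X setT) F /\ F \in Lfun P 2%:E.

(** The space L^2(kappa (x) P_F), kappa the counting measure: since nat is
    discrete, joint measurability is measurability of the sections, and the
    integral of U^2 is the sum over [k] of E[U_k^2]. *)
Definition L2kX (R : realType) (d : measure_display)
    (T : measurableType d) (P : probability T R) (X : nat -> T -> R)
    (U : nat -> T -> R) : Prop :=
  (forall k, measurable_wrt (sigma_gen X setT) (U k)) /\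
  (\sum_(k <oo) 'E_P[(fun w => (U k w) ^+ 2)%R] < +oo)%E.

Definition cylindrical (R : realType) (T : Type) (X : nat -> T -> R)
    (F : T -> R) : Prop :=
  exists n : nat, measurable_wrt (sigma_gen X [set j | (j < n)%N]) F.

(** [is_D P X F U]: (F, U) lies in the closure of the graph of D on
    cylindrical functionals, i.e. F is in dom(D) and D F = U. *)
Definition is_D (R : realType) (d : measure_display)
    (T : measurableType d) (P : probability T R) (X : nat -> T -> R)
    (F : T -> R) (U : nat -> T -> R) : Prop :=
  [/\ L2X P X F, L2kX P X U &
      exists Fn : nat -> T -> R,
        [/\ forall n, L2X P X (Fn n) /\ cylindrical X (Fn n),
            'E_P[(fun w => (Fn n w - F w) ^+ 2)%R]%E @[n --> \oo] --> 0%E &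
            (\sum_(k <oo) 'E_P[(fun w => (Dgrad P X k (Fn n) w - U k w) ^+ 2)%R])%E
              @[n --> \oo] --> 0%E]].

Definition dom_D (R : realType) (d : measure_display)
    (T : measurableType d) (P : probability T R) (X : nat -> T -> R)
    (F : T -> R) : Prop :=
  exists U, is_D P X F U.

(** U is in dom(delta) and delta U = G, where delta is the adjoint of D. *)
Definition is_delta (R : realType) (d : measure_display)
    (T : measurableType d) (P : probability T R) (X : nat -> T -> R)
    (U : nat -> T -> R) (G : T -> R) : Prop :=
  [/\ L2kX P X U, L2X P X G &
      forall F V, is_D P X F V ->
        ('E_P[(F \* G)%R] = \sum_(k <oo) 'E_P[(V k \* U k)%R])%E].

(** F is in dom(L) and L F = - delta (D F) = G. *)
Definition is_L (R : realType) (d : measure_display)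
    (T : measurableType d) (P : probability T R) (X : nat -> T -> R)
    (F G : T -> R) : Prop :=
  exists U, is_D P X F U /\ is_delta P X U (\- G).

Definition Linv (R : realType) (d : measure_display)
    (T : measurableType d) (P : probability T R) (X : nat -> T -> R)
    (G : T -> R) : T -> R :=
  xget (fun=> 0) [set H | ('E_P[H] = 0)%E /\ is_L P X H G].

Definition dW (R : realType) (d d' : measure_display)
    (T : measurableType d) (T' : measurableType d')
    (P : probability T R) (P' : probability T' R)
    (Y : T -> R) (W : T' -> R) : \bar R :=
  ereal_sup [set `|'E_P[h \o Y] - 'E_P'[h \o W]|%E
            | h in [set h : R -> R | 1.-lipschitz h]].

Definition dK (R : realType) (d d' : measure_display)
    (T : measurableType d) (T' : measurableType d')
    (P : probability T R) (P' : probability T' R)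
    (Y : T -> R) (W : T' -> R) : \bar R :=
  ereal_sup [set `|P [set w | (Y w <= z)%R] - P' [set w | (W w <= z)%R]|%E
            | z in [set: R]].

(** Value of a series of real random variables; the series to which it is
    applied converge absolutely almost surely and in L^1. *)
Definition rsum (R : realType) (T : Type) (u : nat -> T -> R) (w : T) : R :=
  limn (series (u ^~ w)).

(* Main.v *)
(** Encode the signs as bits. The law [mu] of (1_{X_k = 1})_k on {0,1}^N satisfies
      int f dmu = p_k int f(x with x_k := 1) dmu + q_k int f(x with x_k := 0) dmu
    for every k, and this resampling identity is the only probabilistic input: on
    {0,1}^N the gradient and the conditional expectations are explicit pointwise
    operators, and Doob-Dynkin carries everything back to Omega.

    Let v_k be independent of X_k, with E[F phi] = sum_k E[v_k D^_k phi] for all phi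
    in dom(D). Both v_k = - D^_k L^-1 F (adjunction) and v_k = E[D^_k F | F_(k-1)]
    (martingale differences) have this property. Apply it to phi = g(F), with g a
    Lipschitz solution of a Stein equation. Resampling coordinate k turns
    E[g'(F) v_k D^_k F Y_k^2] into the average of v_k D^_k F g' with weight q_k at F+
    and p_k at F-, the values of F for X_k = 1 and X_k = -1, so it remains to bound
      g(F+) - g(F-) - (F+ - F-) (q_k g'(F+) + p_k g'(F-)).
    For the Wasserstein distance g' is 2-Lipschitz, which gives
    (p_k^2 + q_k^2) (F+ - F-)^2; for the Kolmogorov distance t g(t) + 1_{t > z} is
    nondecreasing, which gives F+ - F- times the difference of its values at F+ and
    F-, and 1 = 4 p_k q_k + (p_k - q_k)^2 splits the resulting sum in two.

    L^-1 F is the limit of a minimizing sequence of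
    v |-> E|D v|^2 / 2 + E[F v] on centered cylindrical functions; the Efron-Stein
    inequality bounds this functional below and makes the sequence Cauchy. *)

Require Import Defs.
From HB Require Import structures.
From mathcomp Require Import all_boot all_order all_algebra finmap.
From mathcomp Require Import all_classical all_reals all_analysis.
From mathcomp Require Import measurable_realfun.
From mathcomp Require Import ring lra.

Set Implicit Arguments.
Unset Strict Implicit.
Unset Printing Implicit Defensive.
Import Order.TTheory GRing.Theory Num.Theory.
Import numFieldNormedType.Exports.
Local Open Scope classical_set_scope.
Local Open Scope ring_scope.

(** Both choices of v enter the bounds only through three properties: [v k] ignores coordinate k,
    the energies of the [v k] have bounded partial sums, and the integration by parts holds against
    every element of [domD]. The last property has to be used for g(F) with g merely Lipschitz, and
    this closure property is delicate: the gradient of g(G) - g(F) is not controlled by that of G -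
    F. Hence the first coordinates are handled by L^2 closeness and the others by the small tail of
    the energies ([domD_lip]).

    As both p_k and q_k are positive, integrability survives fixing any coordinate at any value.
    Conditional expectations given the first n bits are therefore functions defined at every point,
    obtained without null sets and without a product measure.

    The gradients in the theorem use representatives picked separately for F, L^-1 F and its
    negative, and conditional expectations are picked versions too. They match the explicit
    operators only almost surely, so the bounds are proved under the law of the bits and carried
    over by an inequality between expectations that asks for measurability of one side only. *)

Section calculus.
Context {R : realType}.
Implicit Types (f g df : R -> R) (x a b c : R).

Definition has_deriv f x a := is_derive x (1 : R) f a.

Lemma is_derive_addf f g x a b : has_deriv f x a -> has_deriv g x b ->
  has_deriv (fun y => f y + g y) x (a + b).
Proof. by move=> fa gb; exact: is_deriveD. Qed.

Lemma is_derive_oppf f x a : has_deriv f x a ->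
  has_deriv (fun y => - f y) x (- a).
Proof. by move=> fa; exact: is_deriveN. Qed.

Lemma is_derive_subf f g x a b : has_deriv f x a -> has_deriv g x b ->
  has_deriv (fun y => f y - g y) x (a - b).
Proof. by move=> fa gb; exact: is_deriveB. Qed.

Lemma is_derive_mulf f g x a b : has_deriv f x a -> has_deriv g x b ->
  has_deriv (fun y => f y * g y) x (a * g x + f x * b).
Proof.
move=> fa gb; apply: is_derive_eq (is_deriveM fa gb) _.
by rewrite addrC mulrC.
Qed.

Lemma is_derive_cstf (c x : R) : has_deriv (fun _ : R => c) x 0.
Proof. exact: is_derive_cst. Qed.

Lemma is_derive_idf (x : R) : has_deriv (fun y : R => y) x 1.
Proof. exact: is_derive_id. Qed.

Lemma is_derive_invf f x a : f x != 0 -> has_deriv f x a ->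
  has_deriv (fun y => (f y)^-1) x (- a / f x ^+ 2).
Proof.
move=> f0 fa; apply: is_derive_eq (is_deriveV f0 fa) _.
by rewrite /GRing.scale/= !mulNr mulrC.
Qed.

Lemma is_derive_expf f x a : has_deriv f x a ->
  has_deriv (fun y => expR (f y)) x (expR (f x) * a).
Proof. by move=> fa; exact: (is_derive1_comp (is_derive_expR (f x)) fa). Qed.

Lemma is_derive_cont f x a : has_deriv f x a -> {for x, continuous f}.
Proof.
by case=> fa _; apply: differentiable_continuous; exact/derivable1_diffP.
Qed.

Lemma mean_value f df a b : a < b ->
  (forall x, a < x < b -> has_deriv f x (df x)) ->
  (forall x, a <= x <= b -> {for x, continuous f}) ->
  exists2 c, a < c < b & f b - f a = df c * (b - a).
Proof.
move=> ab fd fc.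
have fd' x : x \in `]a, b[ -> is_derive x 1 f (df x) by rewrite in_itv/=; exact: fd.
have fc' : {within `[a, b], continuous f}.
  apply: continuous_in_subspaceT => x; rewrite inE/= in_itv/= => xab.
  exact: fc.
have [c cab fE] := MVT ab fd' fc'.
by exists c => //; rewrite in_itv/= in cab.
Qed.

Lemma is_derive_compf f g x a b : has_deriv f (g x) a -> has_deriv g x b ->
  has_deriv (fun y => f (g y)) x (a * b).
Proof. by move=> fa gb; exact: (is_derive1_comp fa gb). Qed.

Lemma derive_le0_noninc f df a b : a <= b ->
  (forall x, a <= x <= b -> has_deriv f x (df x)) ->
  (forall x, a <= x <= b -> df x <= 0) -> f b <= f a.
Proof.
rewrite le_eqVlt => /predU1P[-> //|ab] fd df0.
have [||c /andP[ac cb] fE] := @mean_value f df a b ab.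
- by move=> x /andP[ax xb]; apply: fd; rewrite !ltW.
- by move=> x xab; exact: is_derive_cont (fd _ xab).
rewrite -subr_le0 fE mulr_le0_ge0 ?subr_ge0 ?(ltW ab)// df0//.
by rewrite !ltW.
Qed.

Lemma derive_ge0_nondec f df a b : a <= b ->
  (forall x, a <= x <= b -> has_deriv f x (df x)) ->
  (forall x, a <= x <= b -> 0 <= df x) -> f a <= f b.
Proof.
move=> ab fd df0; rewrite -lerN2.
apply: (@derive_le0_noninc (fun x => - f x) (fun x => - df x)) => //.
  by move=> x /fd; exact: is_derive_oppf.
by move=> x /df0; rewrite oppr_le0.
Qed.

Lemma derive0_cst f : (forall x, has_deriv f x 0) -> forall x, f x = f 0.
Proof.
move=> fd x; have [x0|/ltW x0] := leP 0 x; apply/eqP; rewrite eq_le.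
  by rewrite (@derive_le0_noninc f (fun=> 0))//= (@derive_ge0_nondec f (fun=> 0)).
rewrite (@derive_ge0_nondec f (fun=> 0) x 0)//=.
by rewrite (@derive_le0_noninc f (fun=> 0) x 0).
Qed.

Lemma is_derive_eqf f x a b : has_deriv f x a -> a = b -> has_deriv f x b.
Proof. by move=> fa <-. Qed.

End calculus.

Ltac derive_tac := repeat first
  [ apply: is_derive_cstf | apply: is_derive_idf | eassumption
  | apply: is_derive_addf | apply: is_derive_oppf | apply: is_derive_mulf
  | apply: is_derive_expf | apply: is_derive_invf ].

Ltac derive_with lem := repeat first
  [ apply: lem | apply: is_derive_cstf | apply: is_derive_idf
  | apply: is_derive_addf | apply: is_derive_oppf | apply: is_derive_mulf
  | apply: is_derive_expf | apply: is_derive_invf ].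

(** * Stein's equation for the normal distribution *)

Section gaussian.
Context {R : realType}.
Local Notation mu := (@lebesgue_measure R).

Definition gphi (x : R) : R := normal_pdf 0 1 x.

Lemma gphiE x : gphi x = gphi 0 * expR (- (x * x) / 2).
Proof.
rewrite /gphi !normal_pdfE ?oner_eq0// /normal_fun.
rewrite !subr0 !expr1n expr0n/= oppr0 mul0r expR0 mulr1.
by rewrite expr2.
Qed.

Lemma gphi0_gt0 : 0 < gphi 0.
Proof.
rewrite /gphi normal_pdfE ?oner_eq0// /normal_fun.
by rewrite mulr_gt0 ?expR_gt0// normal_peak_gt0 ?oner_eq0.
Qed.

Lemma gphi0E : 2 * gphi 0 = Num.sqrt (2 / pi).
Proof.
have pi0 : 0 < pi :> R := pi_gt0 R.
rewrite /gphi normal_pdfE ?oner_eq0// /normal_fun subr0 expr0n/= oppr0 mul0r expR0.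
rewrite mulr1 /normal_peak expr1n mul1r.
move: (pi) pi0 => x x0.
have x2 : 0 <= x *+ 2 by rewrite mulrn_wge0// ltW.
have x3 : 0 <= 2 / x by rewrite divr_ge0// ltW.
apply/eqP; rewrite -(@eqrXn2 _ 2)// ?sqrtr_ge0 ?divr_ge0 ?sqrtr_ge0//.
rewrite exprMn exprVn !sqr_sqrtr//.
apply/eqP; rewrite -mulr_natl; field.
exact: lt0r_neq0.
Qed.

Lemma gphi_gt0 x : 0 < gphi x.
Proof. by rewrite gphiE mulr_gt0 ?gphi0_gt0// expR_gt0. Qed.

Lemma gphi_neq0 x : gphi x != 0.
Proof. exact: lt0r_neq0 (gphi_gt0 x). Qed.

Lemma gphi_le x : gphi x <= gphi 0.
Proof.
rewrite gphiE ler_piMr ?(ltW gphi0_gt0)// -[leRHS]expR0 ler_expR.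
by rewrite mulNr oppr_le0 divr_ge0 -?expr2 ?sqr_ge0.
Qed.

Lemma gphi_even x : gphi (- x) = gphi x.
Proof. by rewrite gphiE [RHS]gphiE mulrNN. Qed.

Lemma is_derive_gphi (x : R) : has_deriv gphi x (- x * gphi x).
Proof.
rewrite (_ : gphi = fun y => gphi 0 * expR (- (y * y) / 2)); last first.
  by apply/funext => y; rewrite gphiE.
eapply is_derive_eqf; first by derive_tac.
by rewrite /=; field.
Qed.

Lemma continuous_gphi : continuous gphi.
Proof. by move=> x; exact: is_derive_cont (is_derive_gphi x). Qed.

Lemma integrable_gphi : mu.-integrable setT (EFin \o gphi).
Proof. exact: integrable_normal_pdf. Qed.

Lemma lipschitz_continuous (h : R -> R) C :
  (forall x y, `|h x - h y| <= C * `|x - y|) -> continuous h.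
Proof.
move=> hl x; apply/cvgrPdist_le => /= e e0.
have C0 : 0 < `|C| + 1 by rewrite ltr_wpDl.
near=> y.
rewrite (le_trans (hl _ _))//.
have : `|x - y| <= e / (`|C| + 1).
  near: y; apply: cvgr_dist_le; [exact: cvg_id|exact: divr_gt0].
rewrite ler_pdivlMr// => H; apply: le_trans H.
rewrite mulrC ler_wpM2l// (le_trans (ler_norm _))// lerDl//.
Unshelve. all: by end_near. Qed.

Definition lip1 (h : R -> R) := forall x y, `|h x - h y| <= `|x - y|.

Lemma lip1_continuous h : lip1 h -> continuous h.
Proof. by move=> hl; apply: (@lipschitz_continuous h 1) => x y; rewrite mul1r. Qed.

Lemma integrable_lip1 h : lip1 h ->
  mu.-integrable setT (EFin \o (fun x => h x * gphi x)).
Proof.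
move=> hl.
have mh : measurable_fun setT h.
  by apply: continuous_measurable_fun; exact: lip1_continuous.
have mp : measurable_fun setT gphi.
  by apply: continuous_measurable_fun; exact: continuous_gphi.
(* The dominating function is a multiple of the normal density of variance 2: it keeps half of the
   exponent x^2/2, and the other half absorbs the linear growth of [h] because |x| <= 1 + x^2/4 <=
   exp(x^2/4). *)
pose s : R := Num.sqrt 2.
have s0 : s != 0 by rewrite lt0r_neq0// sqrtr_gt0.
pose C := (`|h 0| + 1) * gphi 0 / normal_peak s.
have : mu.-integrable setT (fun x => (C%:E * (normal_pdf 0 s x)%:E)%E).
  by apply: integrableZl => //; exact: integrable_normal_pdf.
apply: le_integrable => //.
  by apply/measurable_EFinP; exact: measurable_funM.
move=> x _ /=; rewrite lee_fin normrM (ger0_norm (ltW (gphi_gt0 x))).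
apply: le_trans (ler_norm _).
rewrite normal_pdfE//= /normal_fun subr0 /s sqr_sqrtr// -/s /C.
rewrite mulrA divfK; last by rewrite lt0r_neq0 ?normal_peak_gt0.
rewrite gphiE mulrCA -[leRHS]mulrA [leRHS]mulrCA ler_wpM2l ?(ltW gphi0_gt0)//.
have -> : expR (- (x * x) / 2) = expR (- (x ^+ 2 / 4)) * expR (- (x ^+ 2 / 4)) :> R.
  by rewrite -expRD; congr expR; field.
have -> : expR (- x ^+ 2 / (2 *+ 2)) = expR (- (x ^+ 2 / 4)) :> R.
  by congr expR; rewrite -mulr_natr; field.
rewrite mulrA ler_wpM2r ?expR_ge0// expRN ler_pdivrMr ?expR_gt0//.
have /= e1 := expR_ge1Dx (x ^+ 2 / 4).
have x2 : `|x| <= 1 + x ^+ 2 / 4.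
  rewrite -subr_ge0 -(real_normK (num_real x)).
  have -> : 1 + `|x| ^+ 2 / 4 - `|x| = (`|x| / 2 - 1) ^+ 2 by field.
  exact: sqr_ge0.
have := hl x 0; rewrite subr0 => hx.
have hx2 : `|h x| <= `|h 0| + `|x|.
  by rewrite -[X in `|X|](subrK (h 0)) (le_trans (ler_normD _ _))// addrC lerD2l.
rewrite (le_trans hx2)// mulrDl mul1r lerD//; last exact: le_trans x2 e1.
by rewrite ler_peMr// (le_trans _ e1)// lerDl divr_ge0// sqr_ge0.
Qed.


Definition gint (h : R -> R) := mu.-integrable setT (EFin \o (fun t => h t * gphi t)).

Lemma gint_cst c : gint (fun=> c).
Proof. by apply: integrable_lip1 => x y; rewrite subrr normr0. Qed.

Lemma gint_id : gint id.
Proof. exact: integrable_lip1. Qed.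

Lemma gintD h k : gint h -> gint k -> gint (fun t => h t + k t).
Proof.
move=> hi ki; have := integrableD measurableT hi ki.
by apply: eq_integrable => //= x _; rewrite mulrDl.
Qed.

Lemma gintZ c h : gint h -> gint (fun t => c * h t).
Proof.
move=> hi; have := integrableZl measurableT c hi.
by apply: eq_integrable => //= x _; rewrite -EFinM mulrA.
Qed.

Definition gtot (h : R -> R) : R := \int[mu]_t (h t * gphi t).
Definition gleft (h : R -> R) (w : R) : R := \int[mu]_(t in `]-oo, w]) (h t * gphi t).
Definition gright (h : R -> R) (w : R) : R := \int[mu]_(t in `]w, +oo[) (h t * gphi t).

Lemma gleft_right h w : gint h -> gleft h w + gright h w = gtot h.
Proof.
move=> hi; rewrite /gleft /gright /gtot.
have := @Rintegral_itvB R (fun t => h t * gphi t) -oo%O +oo%O w.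
by rewrite set_itvNyy => <- //; rewrite addrC subrK.
Qed.

Lemma gleft_deriv h w : continuous h -> gint h -> has_deriv (gleft h) w (h w * gphi w).
Proof.
move=> hc hi.
have w1 : w < w + 1 by rewrite ltrDl.
have hi1 : mu.-integrable `]-oo, w + 1] (EFin \o (fun t => h t * gphi t)).
  exact: integrableS hi.
have hc1 : {for w, continuous (fun t => h t * gphi t)}.
  by apply: cvgM; [exact: hc|exact: continuous_gphi].
have [|] := continuous_FTC1 w1 hi1 _ hc1; first exact: ltNyr.
rewrite derive1E => dF FE; exact: DeriveDef dF FE.
Qed.

Lemma gright_deriv h w : continuous h -> gint h -> has_deriv (gright h) w (- (h w * gphi w)).
Proof.
move=> hc hi.
rewrite (_ : gright h = fun w => gtot h - gleft h w); last first.
  by apply/funext => y; rewrite -(gleft_right y hi) addrC addKr.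
eapply is_derive_eqf.
  by apply: is_derive_subf; [exact: is_derive_cstf|exact: gleft_deriv].
by rewrite sub0r.
Qed.

Lemma gleftD h k w : gint h -> gint k -> gleft (fun t => h t + k t) w = gleft h w + gleft k w.
Proof.
move=> hi ki; rewrite /gleft -RintegralD//; [|exact: integrableS hi|exact: integrableS ki].
by apply: eq_Rintegral => x _; rewrite mulrDl.
Qed.

Lemma gleftZ c h w : gint h -> gleft (fun t => c * h t) w = c * gleft h w.
Proof.
move=> hi; rewrite /gleft -RintegralZl//; last exact: integrableS hi.
by apply: eq_Rintegral => x _; rewrite mulrA.
Qed.

Lemma grightD h k w : gint h -> gint k -> gright (fun t => h t + k t) w = gright h w + gright k w.
Proof.
move=> hi ki; rewrite /gright -RintegralD//; [|exact: integrableS hi|exact: integrableS ki].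
by apply: eq_Rintegral => x _; rewrite mulrDl.
Qed.

Lemma grightZ c h w : gint h -> gright (fun t => c * h t) w = c * gright h w.
Proof.
move=> hi; rewrite /gright -RintegralZl//; last exact: integrableS hi.
by apply: eq_Rintegral => x _; rewrite mulrA.
Qed.

Lemma le_gleft h k w : gint h -> gint k -> (forall t, t <= w -> h t <= k t) ->
  gleft h w <= gleft k w.
Proof.
move=> hi ki hk; apply: le_Rintegral => //; [exact: integrableS hi|exact: integrableS ki|].
move=> x; rewrite /= in_itv/= => xw.
by rewrite ler_wpM2r ?hk//; exact: ltW (gphi_gt0 _).
Qed.

Lemma le_gright h k w : gint h -> gint k -> (forall t, w < t -> h t <= k t) ->
  gright h w <= gright k w.
Proof.
move=> hi ki hk; apply: le_Rintegral => //; [exact: integrableS hi|exact: integrableS ki|].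
move=> x; rewrite /= in_itv/= andbT => xw.
by rewrite ler_wpM2r ?hk//; exact: ltW (gphi_gt0 _).
Qed.

Lemma gtot1 : gtot (fun=> 1) = 1.
Proof.
rewrite /gtot /Rintegral; under eq_integral do rewrite mul1r.
by rewrite integral_normal_pdf.
Qed.

Definition gPhi := gleft (fun=> 1).

Lemma gright1 w : gright (fun=> 1) w = 1 - gPhi w.
Proof. by have := gleft_right w (gint_cst 1); rewrite gtot1 -/gPhi => H; lra. Qed.

Lemma gPhi_deriv w : has_deriv gPhi w (gphi w).
Proof.
eapply is_derive_eqf; first by apply: gleft_deriv; [exact: cst_continuous|exact: gint_cst].
by rewrite mul1r.
Qed.

Lemma gPhi_ge0 w : 0 <= gPhi w.
Proof. by apply: Rintegral_ge0 => x _; rewrite mul1r ltW ?gphi_gt0. Qed.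

Lemma gPhi_le1 w : gPhi w <= 1.
Proof.
by rewrite -subr_ge0 -gright1; apply: Rintegral_ge0 => x _; rewrite mul1r ltW ?gphi_gt0.
Qed.

Lemma gphi_cvgy : gphi x @[x --> +oo%R] --> (0 : R).
Proof.
rewrite (_ : gphi = fun y => gphi 0 * expR (- (y ^+ 2 * 2^-1))); last first.
  by apply/funext => y; rewrite gphiE mulNr.
rewrite -[X in _ --> X](mulr0 (gphi 0)); apply: cvgM; first exact: cvg_cst.
apply: (cvg_comp (fun x => x ^+ 2 * 2^-1) (fun x => expR (- x))); last exact: cvgr_expR.
by apply: gt0_cvgMly => //; exact: cvgr_expr2.
Qed.

Lemma gright_id0 : \int[mu]_(t in `[0, +oo[) (t * gphi t) = gphi 0.
Proof.
rewrite (@Rintegral_ge0_continuous_FTC2y R _ (fun x => - gphi x) 0 0).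
- by rewrite sub0r opprK.
- by move=> x x0; rewrite mulr_ge0// ltW ?gphi_gt0.
- apply: continuous_subspaceT => x; apply: continuousM; first exact: cvg_id.
  exact: continuous_gphi.
- by rewrite -oppr0; apply: cvgN; exact: gphi_cvgy.
- move=> x _; have /is_derive_oppf [] := is_derive_gphi x; done.
- apply: cvg_at_right_filter; apply: cvgN; exact: continuous_gphi.
- move=> x _ /=; rewrite derive1E; have /is_derive_oppf [_ ->] := is_derive_gphi x.
  by rewrite mulNr opprK.
Qed.

Lemma gright_cbnd h w : gint h -> \int[mu]_(t in `[w, +oo[) (h t * gphi t) = gright h w.
Proof.
by move=> hi; rewrite /gright Rintegral_itv_obnd_cbnd//; exact: integrableS hi.
Qed.

Lemma gleft_reflect (h : R -> R) : (forall x, 0 <= h x) -> continuous h ->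
  gleft h 0 = \int[mu]_(t in `[0, +oo[) (h (- t) * gphi t).
Proof.
move=> h0 hc; rewrite /gleft /Rintegral -[X in `]-oo, X]]oppr0.
rewrite ge0_integration_by_substitutionNy.
- by congr fine; apply: eq_integral => x _ /=; rewrite gphi_even.
- apply: continuous_subspaceT => x; apply: continuousM; first exact: hc.
  exact: continuous_gphi.
- by move=> x _; rewrite mulr_ge0// ltW ?gphi_gt0.
Qed.

Lemma gPhi0 : gPhi 0 = 1 / 2.
Proof.
have : gPhi 0 = gright (fun=> 1) 0.
  rewrite -gright_cbnd; last exact: gint_cst.
  by apply: (@gleft_reflect (fun=> 1)) => // x; exact: cvg_cst.
by rewrite gright1 => H; lra.
Qed.

Lemma gleft_id0 : gleft id 0 = - gphi 0.
Proof.
have ni : gint (fun t : R => `|t|).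
  by apply: integrable_lip1 => x y; exact: ler_dist_dist.
rewrite -gright_id0.
(* The reflection lemma asks for a nonnegative integrand, and t = -|t| on the left half-line. *)
transitivity (- gleft (fun t => `|t|) 0).
  rewrite -mulN1r -gleftZ//; apply: eq_Rintegral => x; rewrite inE/= in_itv/= => x0.
  by rewrite ler0_norm// mulN1r opprK.
rewrite gleft_reflect//; last by move=> x; exact: norm_continuous.
congr (- _); apply: eq_Rintegral => x; rewrite inE/= in_itv/= andbT => x0.
by rewrite normrN ger0_norm.
Qed.

(** Since phi' = -x phi, both sides have the same derivative; the constant is fixed at 0. *)
Lemma gleft_id w : gleft id w = - gphi w.
Proof.
have H x : has_deriv (fun y => gleft id y + gphi y) x 0.
  eapply is_derive_eqf.
    apply: is_derive_addf; last exact: is_derive_gphi.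
    by apply: gleft_deriv; [move=> ?; exact: cvg_id|exact: gint_id].
  by rewrite mulNr subrr.
have /= := derive0_cst H w; rewrite gleft_id0 addNr => /eqP.
by rewrite addr_eq0 => /eqP.
Qed.

Lemma gright_id w : gright id w = gphi w.
Proof.
have H x : has_deriv (fun y => gright id y - gphi y) x 0.
  eapply is_derive_eqf.
    apply: is_derive_subf; last exact: is_derive_gphi.
    by apply: gright_deriv; [move=> ?; exact: cvg_id|exact: gint_id].
  by rewrite mulNr subrr.
have /= := derive0_cst H w.
rewrite -[X in _ = X - _]gright_cbnd; last exact: gint_id.
by rewrite gright_id0 subrr => /eqP; rewrite subr_eq0 => /eqP.
Qed.

Lemma gPhiN w : gPhi (- w) = 1 - gPhi w.
Proof.
have H x : has_deriv (fun y => gPhi (- y) + gPhi y) x 0.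
  eapply is_derive_eqf.
    apply: is_derive_addf; last exact: gPhi_deriv.
    apply: (is_derive_compf (f := gPhi) (g := fun y => - y)); first exact: gPhi_deriv.
    by apply: is_derive_oppf; exact: is_derive_idf.
  by rewrite gphi_even mulrN1 addNr.
have /= := derive0_cst H w; rewrite oppr0 gPhi0 => H1; lra.
Qed.

(** Stands in for a limit at infinity: [k] will be the value at some point of a nonincreasing
    function whose values at large y are at least -C/y. *)
Lemma le_of_asymptotic (M C k : R) : (forall y, M <= y -> - C / y <= k) -> 0 <= k.
Proof.
move=> H; rewrite leNgt; apply/negP => k0.
pose y := Num.max (Num.max M 1) ((`|C| + 1) / - k).
have y1 : 1 <= y by rewrite !le_max lexx orbT.
have yM : M <= y by rewrite !le_max lexx.
have y0 : 0 < y by exact: lt_le_trans y1.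
have := H _ yM; apply/negP; rewrite -ltNge.
rewrite ltr_pdivlMr// -[k]opprK mulNr ltrN2.
have : (`|C| + 1) / - k <= y by rewrite le_max lexx orbT.
rewrite ler_pdivrMr ?oppr_gt0// mulrC => /(lt_le_trans _); apply.
by rewrite (le_lt_trans (ler_norm C))// ltrDl.
Qed.

(* E[(Z - w)^+] and E[(Z - w)^-] for a standard normal [Z]. *)
Definition gpos w := gphi w - w * (1 - gPhi w).
Definition gneg w := gphi w + w * gPhi w.

Lemma gint_lip1 h : lip1 h -> gint h. Proof. exact: integrable_lip1. Qed.

(** For t <= w the Lipschitz condition gives |h t| <= w - t, and [gneg w] is the integral of w - t
    against the density over this half-line. *)
Lemma gleft_bound h w : lip1 h -> h w = 0 -> `|gleft h w| <= gneg w.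
Proof.
move=> hl hw.
have -> : gneg w = gleft (fun t => w * 1 + -1 * t) w.
  rewrite gleftD; [|exact: gint_cst|exact: gintZ gint_id].
  rewrite (gleftZ _ _ (gint_cst 1)) (gleftZ _ _ gint_id) gleft_id /gneg /gPhi; ring.
have i1 : gint (fun t => w * 1 + -1 * t).
  by apply: gintD; [exact: gint_cst|exact: gintZ gint_id].
rewrite ler_norml -[- gleft _ _]mulN1r -gleftZ//; apply/andP; split; apply: le_gleft.
- exact: gintZ.
- exact: gint_lip1.
- move=> t tw; have := hl t w; rewrite hw subr0 distrC (ger0_norm (_ : 0 <= w - t)) ?subr_ge0// ler_norml.
  by case/andP; lra.
- exact: gint_lip1.
- by [].
- move=> t tw; have := hl t w; rewrite hw subr0 distrC (ger0_norm (_ : 0 <= w - t)) ?subr_ge0// ler_norml.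
  by case/andP; lra.
Qed.

Lemma gright_bound h w : lip1 h -> h w = 0 -> `|gright h w| <= gpos w.
Proof.
move=> hl hw.
have -> : gpos w = gright (fun t => - w * 1 + 1 * t) w.
  rewrite grightD; [|exact: gint_cst|exact: gintZ gint_id].
  rewrite (grightZ _ _ (gint_cst 1)) (grightZ _ _ gint_id) gright_id gright1 /gpos; ring.
have i1 : gint (fun t => - w * 1 + 1 * t).
  by apply: gintD; [exact: gint_cst|exact: gintZ gint_id].
rewrite ler_norml -[- gright _ _]mulN1r -grightZ//; apply/andP; split; apply: le_gright.
- exact: gintZ.
- exact: gint_lip1.
- move=> t /ltW tw; have := hl t w; rewrite hw subr0 (ger0_norm (_ : 0 <= t - w)) ?subr_ge0// ler_norml.
  by case/andP; lra.
- exact: gint_lip1.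
- by [].
- move=> t /ltW tw; have := hl t w; rewrite hw subr0 (ger0_norm (_ : 0 <= t - w)) ?subr_ge0// ler_norml.
  by case/andP; lra.
Qed.

(** A bound on an absolute value is nonnegative, and [gright_bound] applies to the 1-Lipschitz
    function t - w, which vanishes at w. *)
Lemma mills_upper w : 0 <= gpos w.
Proof. by rewrite (le_trans (normr_ge0 _) (@gright_bound (fun t => t - w) w _ _))// ?subrr// => x y; rewrite opprB addrA subrK. Qed.

Lemma mills_upperN w : 0 <= gneg w.
Proof. by rewrite (le_trans (normr_ge0 _) (@gleft_bound (fun t => t - w) w _ _))// ?subrr// => x y; rewrite opprB addrA subrK. Qed.

(** Lower Mills inequality. The function 1 - Phi - x phi/(1 + x^2) has derivative -2 phi/(1 +
    x^2)^2, hence is nonincreasing, and its values at large y are at least -phi(0)/y. *)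
Lemma mills_lower w : 0 <= (1 + w * w) * (1 - gPhi w) - w * gphi w.
Proof.
have W (x : R) : 0 < 1 + x * x by rewrite ltr_pwDl// -expr2 sqr_ge0.
suff L : 0 <= 1 - gPhi w - w * gphi w / (1 + w * w).
  have := mulr_ge0 (ltW (W w)) L; rewrite mulrBr [X in _ - X]mulrC divfK//.
  exact: lt0r_neq0.
apply: (@le_of_asymptotic (Num.max w 1) (gphi 0)) => y; rewrite ge_max => /andP[wy y1].
have y0 : 0 < y by exact: lt_le_trans y1.
pose L x := 1 - gPhi x - x * gphi x / (1 + x * x).
apply: (@le_trans _ _ (L y)).
  rewrite /L mulNr -[leLHS]add0r lerD//; first by rewrite subr_ge0 gPhi_le1.
  rewrite lerN2 ler_pdivlMr// mulrAC ler_pdivrMr// mulrAC.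
  rewrite (@le_trans _ _ (y * y * gphi 0))//.
    by rewrite ler_wpM2l ?mulr_ge0 ?gphi_le// ltW.
  by rewrite mulrC ler_wpM2l ?lerDr// ltW// gphi0_gt0.
apply: (@derive_le0_noninc _ L (fun x => - (2 * gphi x / (1 + x * x) ^+ 2))) => //.
- move=> x _; eapply is_derive_eqf; first derive_tac.
  + exact: gPhi_deriv.
  + exact: is_derive_gphi.
  + exact: lt0r_neq0 (W x).
  + by rewrite /=; field; exact: lt0r_neq0 (W x).
- move=> x _; rewrite oppr_le0 divr_ge0 ?sqr_ge0// mulr_ge0// ltW ?gphi_gt0//.
Qed.

Lemma mills_lowerN w : 0 <= (1 + w * w) * gPhi w + w * gphi w.
Proof.
have := mills_lower (- w); rewrite gPhiN gphi_even mulrNN mulNr opprK.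
by rewrite (_ : 1 - (1 - gPhi w) = gPhi w)//; ring.
Qed.

(* This is what yields the constant sqrt(2/pi) = 2 [gphi 0] in [stein_der_bound]. *)
Lemma gphi_product_bound w : gpos w * gneg w <= gphi w * gphi 0.
Proof.
pose Psi x := gPhi x - 1 / 2.
have PsiD x : has_deriv Psi x (gphi x).
  eapply is_derive_eqf; first derive_with gPhi_deriv.
  by rewrite /=; ring.
have E x : gphi x * gphi 0 - gpos x * gneg x =
    x ^+ 2 * (1 / 4 - Psi x ^+ 2) - (gphi x ^+ 2 + 2 * x * gphi x * Psi x - gphi x * gphi 0).
  by rewrite /gpos /gneg /Psi; field.
(* The reflection w -> -w exchanges [gpos] and [gneg]. *)
wlog w0 : w / 0 <= w.
  move=> H; have [|/ltW w0] := leP 0 w; first exact: H.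
  have := H (- w); rewrite oppr_ge0 => /(_ w0).
  by rewrite /gpos /gneg gPhiN gphi_even mulrC; congr (_ * _ <= _); ring.
rewrite -subr_ge0 E.
move: w0; rewrite le_eqVlt => /predU1P[<-|w0].
  by rewrite (_ : _ - _ = 0)//; ring.
have PsiL x : 0 <= x -> Psi x <= x * gphi 0.
  move=> x0; rewrite -subr_ge0.
  apply: le_trans (@derive_ge0_nondec _ (fun x => x * gphi 0 - Psi x)
    (fun x => gphi 0 - gphi x) 0 x x0 _ _).
  - by rewrite /Psi gPhi0 mul0r subrr subr0.
  - move=> y _; eapply is_derive_eqf; first derive_with PsiD.
    by rewrite /=; ring.
  - by move=> y _; rewrite subr_ge0 gphi_le.
(* [b] decides the sign of the derivative phi b / x^3 of the function [K] below. It vanishes at 0,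
   and its derivative 2 (Psi - x phi(0)) is nonpositive by [PsiL]. *)
pose b x := 2 * x * Psi x - x * x * gphi 0 + 2 * gphi x - 2 * gphi 0.
have b0 x : 0 <= x -> b x <= 0.
  move=> x0.
  apply: le_trans (@derive_le0_noninc _ b (fun x => 2 * Psi x - 2 * x * gphi 0) 0 x x0 _ _) _.
  - move=> y _; eapply is_derive_eqf; first derive_with PsiD.
    + exact: is_derive_gphi.
    + by rewrite /=; ring.
  - by move=> y /andP[y0 _]; rewrite subr_le0 -mulrA ler_pM2l// PsiL.
  - by rewrite /b !(mulr0, mul0r) subr0 add0r subrr.
(* Division by x^2 turns the difference to be estimated into a nonincreasing function, whose values
   at large y are at least -(phi(0)^2 + phi(0))/y. *)
pose K x := (1 / 4 - Psi x * Psi x) -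
  (gphi x * gphi x + 2 * x * gphi x * Psi x - gphi x * gphi 0) / (x * x).
suff K0 : 0 <= K w.
  have -> : w ^+ 2 * (1 / 4 - Psi w ^+ 2) - (gphi w ^+ 2 + 2 * w * gphi w * Psi w - gphi w * gphi 0)
     = w ^+ 2 * K w by rewrite /K; field; exact: lt0r_neq0.
  by rewrite mulr_ge0 ?sqr_ge0.
have Psi2 x : `|Psi x| <= 1 / 2.
  by rewrite /Psi ler_norml; apply/andP; have := gPhi_ge0 x; have := gPhi_le1 x; lra.
apply: (@le_of_asymptotic (Num.max w 1) (gphi 0 ^+ 2 + gphi 0)) => y; rewrite ge_max => /andP[wy y1].
have y0 : 0 < y by exact: lt_le_trans y1.
apply: (@le_trans _ _ (K y)).
  rewrite /K mulNr -[leLHS]add0r lerD//.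
    have := Psi2 y; rewrite ler_norml => /andP[p1 p2].
    have -> : 1 / 4 - Psi y * Psi y = (1 / 2 - Psi y) * (1 / 2 + Psi y) by field.
    by rewrite mulr_ge0; lra.
  have -> : (gphi 0 ^+ 2 + gphi 0) / y = (gphi 0 ^+ 2 + gphi 0) * y / (y * y).
    by field; exact: lt0r_neq0.
  rewrite lerN2 ler_pM2r ?invr_gt0 ?mulr_gt0//.
  have g0 := gphi0_gt0; have gy := gphi_gt0 y; have gl := gphi_le y.
  have := Psi2 y; rewrite ler_norml => /andP[p1 p2].
  have h1 : gphi y * gphi y <= gphi 0 ^+ 2 * y.
    rewrite (@le_trans _ _ (gphi 0 ^+ 2))//; last by rewrite ler_peMr ?sqr_ge0.
    by rewrite expr2 ler_pM// ltW.
  have h2 : 2 * y * gphi y * Psi y <= gphi 0 * y.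
    have : y * gphi y * Psi y <= y * gphi y * (1 / 2).
      by rewrite ler_wpM2l// mulr_ge0// ltW.
    have : y * gphi y <= y * gphi 0 by rewrite ler_wpM2l// ltW.
    by lra.
  have h3 : 0 <= gphi y * gphi 0 by rewrite mulr_ge0// ltW.
  lra.
apply: (@derive_le0_noninc _ K (fun x => gphi x / x ^+ 3 * b x) w y wy).
- move=> x /andP[wx _]; have x0 : x != 0 by rewrite lt0r_neq0// (lt_le_trans w0).
  eapply is_derive_eqf; first derive_with PsiD; try exact: is_derive_gphi.
  + by rewrite mulf_neq0.
  + by rewrite /= /b; field.
- move=> x /andP[wx _]; have x0 : 0 < x by rewrite (lt_le_trans w0).
  rewrite mulr_ge0_le0//; last by rewrite b0// ltW.
  by rewrite divr_ge0 ?exprn_ge0// ltW// gphi_gt0.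
Qed.

End gaussian.

(** * Stein solutions for Lipschitz test functions *)

Section stein_wasserstein.
Context {R : realType}.
Variables (h : R -> R) (hl : lip1 h).

Let hi := gint_lip1 hl.
Let c := gtot h.

(** The integrating-factor solution of g' - w g = h - E h(Z). As [stein_der] is defined by this
    equation, Stein's equation becomes an identity, and the content moves to [stein_sol_deriv]. *)
Definition stein_sol w := (gleft h w - c * gPhi w) / gphi w.
Definition stein_der w := w * stein_sol w + (h w - c).

Lemma stein_sol_deriv w : has_deriv stein_sol w (stein_der w).
Proof.
eapply is_derive_eqf; first derive_tac.
- exact: gleft_deriv (lip1_continuous hl) hi.
- exact: gPhi_deriv.
- exact: gphi_neq0.
- exact: is_derive_gphi.
- by rewrite /stein_der /stein_sol /=; field; exact: gphi_neq0.
Qed.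

(* Only [h - h w], which vanishes at [w], matters at the point [w]. *)
Let a w := gleft (fun t => h t + - h w * 1) w.
Let b w := gright (fun t => h t + - h w * 1) w.

Let lipk w : lip1 (fun t => h t + - h w * 1).
Proof.
move=> x y; rewrite (_ : _ - _ = h x - h y); first exact: hl.
by ring.
Qed.

Let ab w : `|a w| <= gneg w. Proof. by apply: gleft_bound => //; rewrite mulr1 subrr. Qed.
Let bb w : `|b w| <= gpos w. Proof. by apply: gright_bound => //; rewrite mulr1 subrr. Qed.

Let aE w : gleft h w = a w + h w * gPhi w.
Proof.
by rewrite /a gleftD ?gleftZ -/gPhi; [ring|exact: gint_cst|done|exact: gint_cst].
Qed.

Let bE w : gright h w = b w + h w * (1 - gPhi w).
Proof.
rewrite /b grightD; [|done|exact: gint_cst].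
by rewrite (grightZ _ _ (gint_cst 1)) gright1; ring.
Qed.

Let cE w : c = a w + b w + h w.
Proof. by rewrite /c -(gleft_right w hi) aE bE; ring. Qed.

(** The derivative equals -(a gpos + b gneg)/phi. Since |a| <= gneg and |b| <= gpos, its modulus is
    at most 2 gpos gneg / phi, which [gphi_product_bound] bounds by 2 phi(0). *)
Lemma stein_der_bound w : `|stein_der w| <= Num.sqrt (2 / pi).
Proof.
rewrite -gphi0E.
have -> : stein_der w = - (a w * gpos w + b w * gneg w) / gphi w.
  by rewrite /stein_der /stein_sol aE (cE w) /gpos /gneg; field; exact: gphi_neq0.
have g0 := gphi_gt0 w.
rewrite normrM normrN (ger0_norm (_ : 0 <= (gphi w)^-1)) ?invr_ge0 ?(ltW g0)// ler_pdivrMr//.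
have h1 : `|a w| * gpos w <= gneg w * gpos w by rewrite ler_wpM2r ?mills_upper.
have h2 : `|b w| * gneg w <= gpos w * gneg w by rewrite ler_wpM2r ?mills_upperN.
have := gphi_product_bound w.
have := ler_normD (a w * gpos w) (b w * gneg w).
rewrite !normrM (ger0_norm (mills_upper w)) (ger0_norm (mills_upperN w)).
by lra.
Qed.

Lemma derive_bound_lip (f df : R -> R) C : (forall x, has_deriv f x (df x)) ->
  (forall x, `|df x| <= C) -> forall x y, `|f x - f y| <= C * `|x - y|.
Proof.
move=> fd dfC x y; wlog xy : x y / x <= y.
  by move=> H; have [|/ltW] := leP x y; [exact: H|rewrite distrC [X in _ * X]distrC; exact: H].
rewrite distrC [X in _ * X]distrC (ger0_norm (_ : 0 <= y - x)) ?subr_ge0// ler_norml.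
apply/andP; split.
  have := @derive_ge0_nondec _ (fun x => f x + C * x) (fun x => df x + C) x y xy.
  move=> H; suff : f x + C * x <= f y + C * y by lra.
  apply: H => [t _|t _].
    eapply is_derive_eqf; first derive_with fd.
    by rewrite /=; ring.
  by have := dfC t; rewrite ler_norml => /andP[]; lra.
have := @derive_le0_noninc _ (fun x => f x - C * x) (fun x => df x - C) x y xy.
move=> H; suff : f y - C * y <= f x - C * x by lra.
apply: H => [t _|t _].
  eapply is_derive_eqf; first derive_with fd.
  by rewrite /=; ring.
by have := dfC t; rewrite ler_norml => /andP[]; lra.
Qed.

(** With [h] only Lipschitz, g' need not be differentiable, but up to a constant it is the sum of w
    g(w) and h. The first summand is 1-Lipschitz: its derivative is (a m - b n)/phi with m and n
    nonnegative by the lower Mills inequalities, and gneg m + gpos n = phi exactly. *)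
Lemma stein_der_lip x y : `|stein_der x - stein_der y| <= 2 * `|x - y|.
Proof.
pose G w := w * stein_sol w.
have GL : forall x y, `|G x - G y| <= 1 * `|x - y|.
  apply: (@derive_bound_lip G (fun w => stein_sol w + w * stein_der w)) => w.
    eapply is_derive_eqf; first derive_with stein_sol_deriv.
    by rewrite /= mul1r.
  pose m := (1 + w * w) * (1 - gPhi w) - w * gphi w.
  pose n := (1 + w * w) * gPhi w + w * gphi w.
  have m0 : 0 <= m := mills_lower w.
  have n0 : 0 <= n := mills_lowerN w.
  have -> : stein_sol w + w * stein_der w = (a w * m - b w * n) / gphi w.
    by rewrite /stein_der /stein_sol aE (cE w) /m /n; field; exact: gphi_neq0.
  have g0 := gphi_gt0 w.
  rewrite normrM (ger0_norm (_ : 0 <= (gphi w)^-1)) ?invr_ge0 ?(ltW g0)// ler_pdivrMr// mul1r.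
  have h1 : `|a w| * m <= gneg w * m by rewrite ler_wpM2r.
  have h2 : `|b w| * n <= gpos w * n by rewrite ler_wpM2r.
  have := ler_normB (a w * m) (b w * n).
  rewrite !normrM (ger0_norm m0) (ger0_norm n0).
  have : gneg w * m + gpos w * n = gphi w by rewrite /gneg /gpos /m /n; ring.
  by lra.
rewrite (_ : _ - _ = (G x - G y) + (h x - h y)); last by rewrite /stein_der /G; ring.
by rewrite (le_trans (ler_normD _ _))// mulr2n mulrDl lerD// ?mul1r ?hl//.
Qed.

Lemma stein_sol_lip x y : `|stein_sol x - stein_sol y| <= Num.sqrt (2 / pi) * `|x - y|.
Proof. exact: derive_bound_lip stein_sol_deriv stein_der_bound _ _. Qed.

(** The remainder carries half the Lipschitz constant 2 of g'. In the absence of a second derivative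
    it is read off from the monotonicity of g(t) - g'(e) t plus or minus (t - e)^2 on each side of
    e. *)
Lemma stein_taylor e t : `|stein_sol t - stein_sol e - stein_der e * (t - e)| <= (t - e) ^+ 2.
Proof.
have L x y := stein_der_lip x y.
have D C x : has_deriv (fun t => stein_sol t - stein_der e * t - C * ((t - e) * (t - e))) x
     (stein_der x - stein_der e - C * (2 * (x - e))).
  eapply is_derive_eqf; first derive_with stein_sol_deriv.
  by rewrite /=; ring.
rewrite ler_norml; have [te|/ltW te] := leP e t; apply/andP; split.
- have := @derive_ge0_nondec _ _ _ e t te (fun x _ => D (-1) x).
  suff H : forall x, e <= x <= t -> 0 <= stein_der x - stein_der e - -1 * (2 * (x - e)).
    by move=> /(_ H); nra.
  move=> x /andP[ex _]; have := L x e; rewrite (ger0_norm (_ : 0 <= x - e)) ?subr_ge0//.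
  by rewrite ler_norml => /andP[]; lra.
- have := @derive_le0_noninc _ _ _ e t te (fun x _ => D 1 x).
  suff H : forall x, e <= x <= t -> stein_der x - stein_der e - 1 * (2 * (x - e)) <= 0.
    by move=> /(_ H); nra.
  move=> x /andP[ex _]; have := L x e; rewrite (ger0_norm (_ : 0 <= x - e)) ?subr_ge0//.
  by rewrite ler_norml => /andP[]; lra.
- have := @derive_le0_noninc _ _ _ t e te (fun x _ => D (-1) x).
  suff H : forall x, t <= x <= e -> stein_der x - stein_der e - -1 * (2 * (x - e)) <= 0.
    by move=> /(_ H); nra.
  move=> x /andP[_ ex]; have := L x e; rewrite (ler0_norm (_ : x - e <= 0)) ?subr_le0//.
  by rewrite ler_norml => /andP[]; lra.
- have := @derive_ge0_nondec _ _ _ t e te (fun x _ => D 1 x).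
  suff H : forall x, t <= x <= e -> 0 <= stein_der x - stein_der e - 1 * (2 * (x - e)).
    by move=> /(_ H); nra.
  move=> x /andP[_ ex]; have := L x e; rewrite (ler0_norm (_ : x - e <= 0)) ?subr_le0//.
  by rewrite ler_norml => /andP[]; lra.
Qed.

Lemma stein_remainder (p q x y : R) : 0 < p -> 0 < q -> p + q = 1 ->
  `|stein_sol x - stein_sol y - (x - y) * (q * stein_der x + p * stein_der y)|
    <= (1 - 2 * p * q) * (x - y) ^+ 2.
Proof.
(* [z] is at distance p |x - y| from y and q |x - y| from x. Expanding from both ends to [z]
   therefore produces the weights p at y and q at x, with the errors p^2 + q^2 = 1 - 2pq times (x -
   y)^2. *)
move=> p0 q0 pq; pose z := y + p * (x - y).
have h1 := stein_taylor y z; have h2 := stein_taylor x z.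
rewrite (_ : _ - _ = (stein_sol z - stein_sol y - stein_der y * (z - y)) -
  (stein_sol z - stein_sol x - stein_der x * (z - x))); last first.
  by rewrite /z (_ : q = 1 - p); [ring|rewrite -pq addrC addKr].
rewrite (le_trans (ler_normB _ _))// (le_trans (lerD h1 h2))// le_eqVlt; apply/orP; left.
by apply/eqP; rewrite /z (_ : q = 1 - p); [ring|rewrite -pq addrC addKr].
Qed.

End stein_wasserstein.

(** * Stein solutions for indicators of half-lines *)

Section stein_kolmogorov.
Context {R : realType}.
Variable z : R.

(** [mratr] is the Mills ratio of the normal law and [mratl] its mirror image; they solve g' - x g =
    -1 and g' - x g = 1 respectively. *)
Definition mratl (x : R) := gPhi x / gphi x.
Definition mratr (x : R) := (1 - gPhi x) / gphi x.

Lemma mratl_deriv x : has_deriv mratl x (1 + x * mratl x).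
Proof.
eapply is_derive_eqf; first derive_with (@gPhi_deriv R).
- exact: gphi_neq0.
- exact: is_derive_gphi.
- by rewrite /mratl /=; field; exact: gphi_neq0.
Qed.

Lemma mratr_deriv x : has_deriv mratr x (-1 + x * mratr x).
Proof.
eapply is_derive_eqf; first derive_with (@gPhi_deriv R).
- exact: gphi_neq0.
- exact: is_derive_gphi.
- by rewrite /mratr /=; field; exact: gphi_neq0.
Qed.

(** The derivative of x times the ratio is the expression of [mills_lowerN] divided by phi. *)
Lemma xmratl_nondec x y : x <= y -> x * mratl x <= y * mratl y.
Proof.
move=> xy; apply: (@derive_ge0_nondec _ (fun x => x * mratl x)
  (fun x => ((1 + x * x) * gPhi x + x * gphi x) / gphi x) x y xy) => t _.
  eapply is_derive_eqf; first derive_with mratl_deriv.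
  by rewrite /mratl; field; exact: gphi_neq0.
by rewrite divr_ge0 ?mills_lowerN// ltW ?gphi_gt0.
Qed.

Lemma xmratr_nondec x y : x <= y -> x * mratr x <= y * mratr y.
Proof.
move=> xy; apply: (@derive_ge0_nondec _ (fun x => x * mratr x)
  (fun x => ((1 + x * x) * (1 - gPhi x) - x * gphi x) / gphi x) x y xy) => t _.
  eapply is_derive_eqf; first derive_with mratr_deriv.
  by rewrite /mratr; field; exact: gphi_neq0.
by rewrite divr_ge0 ?mills_lower// ltW ?gphi_gt0.
Qed.

Lemma xmratl_ge x : -1 <= x * mratl x.
Proof.
have := mills_upperN x; rewrite /gneg /mratl mulrA ler_pdivlMr ?gphi_gt0//; lra.
Qed.

Lemma xmratr_le x : x * mratr x <= 1.
Proof.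
have := mills_upper x; rewrite /gpos /mratr mulrA ler_pdivrMr ?gphi_gt0//; lra.
Qed.

(* The solution of [g' x - x * g x = kind z x - gPhi z]; [kder] is its derivative off
   [z], and [kmon] is the nondecreasing function 1 + x g(x) - 1_{x <= z}. *)
Definition ksol (x : R) := if x <= z then mratl x * (1 - gPhi z) else mratr x * gPhi z.
Definition kind (x : R) : R := if x <= z then 1 else 0.
Definition kder (x : R) := x * ksol x + kind x - gPhi z.
Definition kmon (x : R) := x * ksol x + (1 - kind x).

Let ksolr x : z <= x -> ksol x = mratr x * gPhi z.
Proof.
rewrite le_eqVlt /ksol => /predU1P[<-|zx]; last by rewrite leNgt zx.
by rewrite lexx /mratl /mratr; ring.
Qed.

Let Phi0 := gPhi_ge0 z.
Let Phi1 := gPhi_le1 z.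

(** The two branches of [ksol] agree at [z], so the monotonicity of the pieces chains through
    [z]. *)
Lemma xksol_nondec x y : x <= y -> x * ksol x <= y * ksol y.
Proof.
have h1 x' y' : x' <= y' -> y' <= z -> x' * ksol x' <= y' * ksol y'.
  move=> xy yz; rewrite /ksol yz (le_trans xy yz) !(mulrA _ (mratl _)) ler_wpM2r ?subr_ge0//.
  exact: xmratl_nondec.
have h2 x' y' : x' <= y' -> z <= x' -> x' * ksol x' <= y' * ksol y'.
  move=> xy zx; rewrite !ksolr//; last exact: le_trans xy.
  by rewrite !(mulrA _ (mratr _)) ler_wpM2r// xmratr_nondec.
move=> xy; have [yz|/ltW zy] := leP y z; first exact: h1.
have [xz|/ltW zx] := leP x z; last exact: h2.
exact: le_trans (h1 _ _ xz (lexx z)) (h2 _ _ zy (lexx z)).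
Qed.

Lemma kind_noninc x y : x <= y -> kind y <= kind x.
Proof.
move=> xy; rewrite /kind; case: (leP y z) => [yz|_]; first by rewrite (le_trans xy yz).
by case: ifP.
Qed.

Lemma kind01 x : 0 <= kind x <= 1.
Proof. by rewrite /kind; case: ifP; rewrite ?lexx ?ler01. Qed.

(** Each bound is an upper Mills inequality on one side of [z]; monotonicity carries it to the other
    side. *)
Lemma xksol_bound x : - (1 - gPhi z) <= x * ksol x <= gPhi z.
Proof.
have h1 x' : x' <= z -> - (1 - gPhi z) <= x' * ksol x'.
  move=> xz; rewrite /ksol xz mulrA -mulN1r ler_wpM2r ?subr_ge0 ?xmratl_ge//.
have h2 x' : z <= x' -> x' * ksol x' <= gPhi z.
  by move=> zx; rewrite ksolr// mulrA ler_piMl ?xmratr_le.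
apply/andP; split; have [xz|/ltW zx] := leP x z.
- exact: h1.
- exact: le_trans (h1 _ (lexx z)) (xksol_nondec zx).
- exact: le_trans (xksol_nondec xz) (h2 _ (lexx z)).
- exact: h2.
Qed.

Lemma kder_bound x : `|kder x| <= 1.
Proof.
rewrite ler_norml /kder /kind; case: ifP => _; have /andP[] := xksol_bound x; lra.
Qed.

Lemma kmon_bound x : `|kmon x - gPhi z| <= 1.
Proof.
rewrite ler_norml /kmon /kind; case: ifP => _; have /andP[] := xksol_bound x; lra.
Qed.

Lemma kmon_nondec x y : x <= y -> kmon x <= kmon y.
Proof. by move=> xy; rewrite /kmon lerD ?xksol_nondec// lerB// kind_noninc. Qed.

(** A mean value inequality across the kink of [ksol] at [z]: the two sides are treated separately
    and their increments add up. *)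
Lemma ksol_increment (s K a b : R) : a <= b ->
  (forall t, a <= t <= b -> `|kder t - s| <= K) ->
  `|ksol b - ksol a - s * (b - a)| <= K * (b - a).
Proof.
(* The derivative is compared on the open interval only, because at [z] itself [kder] takes the
   derivative of the left branch. *)
have M (f df : R -> R) a' b' : a' <= b' ->
    (forall x, a' < x < b' -> has_deriv f x (df x)) ->
    (forall x, a' <= x <= b' -> {for x, continuous f}) ->
    (forall t, a' < t < b' -> `|df t - s| <= K) ->
    `|f b' - f a' - s * (b' - a')| <= K * (b' - a').
  rewrite le_eqVlt => /predU1P[->|ab] fd fc fK.
    by rewrite !subrr !mulr0 subrr normr0.
  have [c cab ->] := mean_value ab fd fc.
  rewrite -mulrBl normrM (ger0_norm (_ : 0 <= b' - a')); last by rewrite subr_ge0 ltW.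
  by rewrite ler_wpM2r ?fK// subr_ge0 ltW.
have h1 a' b' : a' <= b' -> b' <= z ->
    (forall t, a' <= t <= b' -> `|kder t - s| <= K) ->
    `|ksol b' - ksol a' - s * (b' - a')| <= K * (b' - a').
  move=> ab bz kK; rewrite {1 2}/ksol bz (le_trans ab bz).
  have D x : has_deriv (fun x => mratl x * (1 - gPhi z)) x ((1 + x * mratl x) * (1 - gPhi z)).
    eapply is_derive_eqf; first derive_with mratl_deriv.
    by rewrite /=; ring.
  apply: (M (fun x => mratl x * (1 - gPhi z)) _ _ _ ab (fun x _ => D x)).
    by move=> x _; exact: is_derive_cont (D x).
  move=> t /andP[at_ tb]; have := kK t; rewrite (ltW at_) (ltW tb) => /(_ isT).
  by rewrite /kder /ksol /kind (ltW (lt_le_trans tb bz)); congr (`|_| <= _); ring.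
have h2 a' b' : a' <= b' -> z <= a' ->
    (forall t, a' <= t <= b' -> `|kder t - s| <= K) ->
    `|ksol b' - ksol a' - s * (b' - a')| <= K * (b' - a').
  move=> ab za kK; rewrite !ksolr//; last exact: le_trans ab.
  have D x : has_deriv (fun x => mratr x * gPhi z) x ((-1 + x * mratr x) * gPhi z).
    eapply is_derive_eqf; first derive_with mratr_deriv.
    by rewrite /=; ring.
  apply: (M (fun x => mratr x * gPhi z) _ _ _ ab (fun x _ => D x)).
    by move=> x _; exact: is_derive_cont (D x).
  move=> t /andP[at_ tb]; have := kK t; rewrite (ltW at_) (ltW tb) => /(_ isT).
  by rewrite /kder /ksol /kind (leNgt t) (le_lt_trans za at_)/=; congr (`|_| <= _); ring.
move=> ab kK; have [bz|/ltW zb] := leP b z; first exact: h1.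
have [az|/ltW za] := leP a z; last exact: h2.
have H1 : `|ksol z - ksol a - s * (z - a)| <= K * (z - a).
  by apply: h1 => // t /andP[t1 t2]; rewrite kK// t1 (le_trans t2).
have H2 : `|ksol b - ksol z - s * (b - z)| <= K * (b - z).
  by apply: h2 => // t /andP[t1 t2]; rewrite kK// t2 (le_trans az).
rewrite (_ : _ - _ = (ksol b - ksol z - s * (b - z)) + (ksol z - ksol a - s * (z - a))); last by ring.
rewrite (_ : K * (b - a) = K * (b - z) + K * (z - a)); last by ring.
by rewrite (le_trans (ler_normD _ _))// lerD.
Qed.

Lemma ksol_lip x y : `|ksol x - ksol y| <= `|x - y|.
Proof.
wlog xy : x y / y <= x.
  by move=> H; have [|/ltW] := leP y x; [exact: H|rewrite (distrC (ksol x)) (distrC x); exact: H].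
have := @ksol_increment 0 1 y x xy; rewrite mul0r subr0 mul1r => H.
rewrite [leRHS]ger0_norm ?subr_ge0//; apply: H => t _.
by rewrite subr0 kder_bound.
Qed.

(** [kder] is, up to a constant, the sum of the nondecreasing x g(x) and the nonincreasing
    indicator. In [kmon] the indicator has the opposite sign, so that both parts increase; the
    oscillation of [kder] between two points is thus at most the increment of [kmon]. Cutting the
    interval at [c] gives the weights p and q as in [stein_remainder]. *)
Lemma ksol_remainder (p q x y : R) : 0 < p -> 0 < q -> p + q = 1 ->
  `|ksol x - ksol y - (x - y) * (q * kder x + p * kder y)| <=
    (x - y) * (kmon x - kmon y).
Proof.
wlog yx : p q x y / y <= x.
  move=> H p0 q0 pq; have [yx|/ltW xy] := leP y x; first exact: H.
  have := H q p y x xy q0 p0; rewrite addrC => /(_ pq).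
  rewrite -normrN; congr (`|_| <= _); ring.
move=> p0 q0 pq; pose c := y + p * (x - y).
have qE : q = 1 - p by rewrite -pq addrC addKr.
have xy0 : 0 <= x - y by rewrite subr_ge0.
have yc : y <= c by rewrite lerDl mulr_ge0// ltW.
have cx : c <= x.
  by rewrite -subr_ge0 (_ : x - c = q * (x - y)) ?mulr_ge0 ?(ltW q0)// /c qE; ring.
have K1 t : y <= t <= x -> `|kder t - kder y| <= kmon x - kmon y.
  move=> /andP[yt tx]; have := xksol_nondec yt; have := xksol_nondec tx.
  have := kind_noninc yt; have := kind_noninc tx.
  by rewrite ler_norml /kder /kmon => *; apply/andP; split; lra.
have K2 t : y <= t <= x -> `|kder t - kder x| <= kmon x - kmon y.
  move=> /andP[yt tx]; have := xksol_nondec yt; have := xksol_nondec tx.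
  have := kind_noninc yt; have := kind_noninc tx.
  by rewrite ler_norml /kder /kmon => *; apply/andP; split; lra.
have H1 : `|ksol c - ksol y - kder y * (c - y)| <= (kmon x - kmon y) * (c - y).
  by apply: ksol_increment => // t /andP[t1 t2]; rewrite K1// t1 (le_trans t2).
have H2 : `|ksol x - ksol c - kder x * (x - c)| <= (kmon x - kmon y) * (x - c).
  by apply: ksol_increment => // t /andP[t1 t2]; rewrite K2// t2 (le_trans yc).
rewrite (_ : _ - _ = (ksol c - ksol y - kder y * (c - y)) +
   (ksol x - ksol c - kder x * (x - c))); last by rewrite /c qE; ring.
rewrite (_ : (x - y) * _ = (kmon x - kmon y) * (c - y) + (kmon x - kmon y) * (x - c)); last first.
  by rewrite /c; ring.
by rewrite (le_trans (ler_normD _ _))// lerD.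
Qed.

End stein_kolmogorov.

(** * Square-integrable functions *)

Section square_integrable.
Context {d} {T : measurableType d} {R : realType} (mu : probability T R).
Implicit Types f g : T -> R.

Definition L1 f := mu.-integrable setT (EFin \o f).
Definition L2 f := measurable_fun setT f /\ L1 (fun x => f x ^+ 2).
Definition Ex f : R := \int[mu]_x f x.
Definition N2 f : R := Ex (fun x => f x ^+ 2).

Lemma L1_meas f : L1 f -> measurable_fun setT f.
Proof. by move=> /measurable_int/measurable_EFinP. Qed.

Lemma eq_L1 f g : L1 f -> f =1 g -> L1 g.
Proof. by move=> hf /funext <-. Qed.

Lemma L1_le f g : measurable_fun setT f -> L1 g -> (forall x, `|f x| <= g x) -> L1 f.
Proof.
move=> mf ig fg; apply: le_integrable ig => //; first exact/measurable_EFinP.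
by move=> x _ /=; rewrite lee_fin (le_trans (fg x))// ler_norm.
Qed.

Lemma L1_cst c : L1 (fun=> c).
Proof. exact: finite_measure_integrable_cst. Qed.

Lemma L1D f g : L1 f -> L1 g -> L1 (fun x => f x + g x).
Proof. by move=> hf hg; have := integrableD measurableT hf hg. Qed.

Lemma L1Z c f : L1 f -> L1 (fun x => c * f x).
Proof. by move=> hf; have := integrableZl measurableT c hf. Qed.

Lemma L1N f : L1 f -> L1 (fun x => - f x).
Proof.
by move=> hf; rewrite (_ : (fun x => _) = fun x => -1 * f x); [exact: L1Z|apply/funext => x; rewrite mulN1r].
Qed.

Lemma L1B f g : L1 f -> L1 g -> L1 (fun x => f x - g x).
Proof. by move=> hf hg; apply: L1D => //; exact: L1N. Qed.

Lemma L1_norm f : L1 f -> L1 (fun x => `|f x|).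
Proof. by move=> hf; have := integrable_norm hf. Qed.

Lemma L1_bound f g C : L1 f -> measurable_fun setT g -> (forall x, `|g x| <= C) ->
  L1 (fun x => g x * f x).
Proof.
move=> hf mg gC; apply: (@L1_le _ (fun x => C * `|f x|)).
- by apply: measurable_funM => //; exact: L1_meas.
- by apply: L1Z; exact: L1_norm.
- by move=> x; rewrite normrM ler_wpM2r.
Qed.

Lemma L1_sum (F : nat -> T -> R) n : (forall k, (k < n)%N -> L1 (F k)) ->
  L1 (fun x => \sum_(k < n) F k x).
Proof.
elim: n => [|n IH] hF.
  by rewrite (_ : (fun x => _) = fun=> 0); [exact: L1_cst|apply/funext => x; rewrite big_ord0].
rewrite (_ : (fun x => _) = fun x => \sum_(k < n) F k x + F n x).
  apply: L1D; [apply: IH => k kn; apply: hF; exact: ltnW|exact: hF].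
by apply/funext => x; rewrite big_ord_recr.
Qed.

Lemma ExE f : L1 f -> (\int[mu]_x (f x)%:E)%E = (Ex f)%:E.
Proof. by move=> hf; rewrite /Ex /Rintegral fineK//; exact: integrable_fin_num. Qed.

Lemma Ex_cst c : Ex (fun=> c) = c.
Proof.
have m1 : fine (mu setT) = 1 by rewrite probability_setT.
by rewrite /Ex Rintegral_cst// m1 mulr1.
Qed.

Lemma ExD f g : L1 f -> L1 g -> Ex (fun x => f x + g x) = Ex f + Ex g.
Proof. by move=> hf hg; rewrite /Ex RintegralD. Qed.

Lemma ExB f g : L1 f -> L1 g -> Ex (fun x => f x - g x) = Ex f - Ex g.
Proof. by move=> hf hg; rewrite /Ex RintegralB. Qed.

Lemma ExZ c f : L1 f -> Ex (fun x => c * f x) = c * Ex f.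
Proof. by move=> hf; rewrite /Ex RintegralZl. Qed.

Lemma ExN f : L1 f -> Ex (fun x => - f x) = - Ex f.
Proof. by move=> hf; rewrite -[RHS]mulN1r -ExZ//; apply: eq_Rintegral => x _; rewrite mulN1r. Qed.

Lemma eq_Ex f g : f =1 g -> Ex f = Ex g.
Proof. by move=> fg; apply: eq_Rintegral => x _; exact: fg. Qed.

Lemma le_Ex f g : L1 f -> L1 g -> (forall x, f x <= g x) -> Ex f <= Ex g.
Proof. by move=> hf hg fg; apply: le_Rintegral. Qed.

Lemma Ex_ge0 f : (forall x, 0 <= f x) -> 0 <= Ex f.
Proof. by move=> f0; apply: Rintegral_ge0. Qed.

Lemma norm_Ex_le f : L1 f -> `|Ex f| <= Ex (fun x => `|f x|).
Proof. by move=> hf; exact: le_normr_Rintegral. Qed.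

Lemma Ex_sum (F : nat -> T -> R) n : (forall k, (k < n)%N -> L1 (F k)) ->
  Ex (fun x => \sum_(k < n) F k x) = \sum_(k < n) Ex (F k).
Proof.
elim: n => [|n IH] hF.
  rewrite big_ord0 -[RHS](Ex_cst 0); apply: eq_Ex => x; by rewrite big_ord0.
rewrite big_ord_recr /= -IH; last by move=> k kn; apply: hF; exact: ltnW.
rewrite -ExD//; first by apply: eq_Ex => x; rewrite big_ord_recr.
- by apply: L1_sum => k kn; apply: hF; exact: ltnW.
- exact: hF.
Qed.

Lemma ae_eq_Ex f g : L1 f -> measurable_fun setT g -> (\forall x \ae mu, f x = g x) ->
  L1 g /\ Ex f = Ex g.
Proof.
move=> hf mg fg.
have fge : ae_eq mu setT (EFin \o f) (EFin \o g).
  by apply: filterS fg => x /= -> _.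
have mf := measurable_int _ hf.
have mge : measurable_fun setT (EFin \o g) by exact/measurable_EFinP.
split.
  apply/integrableP; split=> //.
  have /integrableP[_] := hf; congr (_ < _)%E.
  apply: ae_eq_integral => //; [exact: measurableT_comp|exact: measurableT_comp|].
  by apply: filterS fg => x /= -> _.
by rewrite /Ex /Rintegral (ae_eq_integral _ _ _ mf mge fge).
Qed.

Lemma Ex_eq0_ae f : L1 f -> (forall x, 0 <= f x) -> Ex f = 0 -> \forall x \ae mu, f x = 0.
Proof.
move=> hf f0 E0; have mf := measurable_int _ hf.
have : (\int[mu]_x `|(f x)%:E| = 0)%E.
  under eq_integral do rewrite gee0_abs ?lee_fin//.
  by rewrite ExE// E0.
move=> /(ae_eq_integral_abs mu measurableT mf).
by apply: filterS => x /(_ I) [].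
Qed.

Lemma L2_meas f : L2 f -> measurable_fun setT f. Proof. by case. Qed.

Lemma L2_mul f g : L2 f -> L2 g -> L1 (fun x => f x * g x).
Proof.
move=> [mf f2] [mg g2]; apply: (@L1_le _ (fun x => f x ^+ 2 + g x ^+ 2)).
- exact: measurable_funM.
- exact: L1D.
- move=> x; rewrite normrM -(real_normK (num_real (f x))) -(real_normK (num_real (g x))).
  have := sqr_ge0 (`|f x| - `|g x|); have := sqr_ge0 (`|f x| + `|g x|).
  have := sqr_ge0 (`|f x|); have := sqr_ge0 (`|g x|); nra.
Qed.

Lemma L2_le f g : measurable_fun setT f -> L2 g -> (forall x, `|f x| <= `|g x|) -> L2 f.
Proof.
move=> mf [mg g2] fg; split=> //; apply: (@L1_le _ (fun x => g x ^+ 2)) => //.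
  exact: measurable_funX.
by move=> x; rewrite normrX -(real_normK (num_real (g x))) lerXn2r ?nnegrE.
Qed.

Lemma L2_cst c : L2 (fun=> c).
Proof. by split; [exact: measurable_cst|exact: L1_cst]. Qed.

Lemma L2_L1 f : L2 f -> L1 f.
Proof.
move=> hf; rewrite (_ : f = fun x => f x * 1); first exact: L2_mul (L2_cst 1).
by apply/funext => x; rewrite mulr1.
Qed.

Lemma L2Z c f : L2 f -> L2 (fun x => c * f x).
Proof.
move=> [mf f2]; split; first exact: measurable_funM.
rewrite (_ : (fun x => _) = fun x => c ^+ 2 * f x ^+ 2); first exact: L1Z.
by apply/funext => x; rewrite exprMn.
Qed.

Lemma L2D f g : L2 f -> L2 g -> L2 (fun x => f x + g x).
Proof.
move=> hf hg; split; first by apply: measurable_funD; [case: hf|case: hg].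
rewrite (_ : (fun x => _) = fun x => (f x ^+ 2 + 2 * (f x * g x)) + g x ^+ 2).
  by apply: L1D; [apply: L1D; [case: hf|apply: L1Z; exact: L2_mul]|case: hg].
by apply/funext => x; ring.
Qed.

Lemma L2N f : L2 f -> L2 (fun x => - f x).
Proof.
by move=> hf; rewrite (_ : (fun x => _) = fun x => -1 * f x); [exact: L2Z|apply/funext => x; rewrite mulN1r].
Qed.

Lemma L2B f g : L2 f -> L2 g -> L2 (fun x => f x - g x).
Proof. by move=> hf hg; apply: L2D => //; exact: L2N. Qed.

Lemma L2_bound f g C : L2 f -> measurable_fun setT g -> (forall x, `|g x| <= C) ->
  L2 (fun x => g x * f x).
Proof.
move=> hf mg gC; apply: (@L2_le _ (fun x => C * f x)).
- by apply: measurable_funM => //; case: hf.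
- exact: L2Z.
- by move=> x; rewrite !normrM ler_wpM2r// (le_trans (gC x))// ler_norm.
Qed.

Lemma L2_norm f : L2 f -> L2 (fun x => `|f x|).
Proof.
move=> hf; apply: (L2_le _ hf); last by move=> x; rewrite normr_id.
by apply: measurableT_comp => //; case: hf.
Qed.

Lemma N2_ge0 f : 0 <= N2 f.
Proof. by apply: Ex_ge0 => x; exact: sqr_ge0. Qed.

Lemma N2Z c f : L2 f -> N2 (fun x => c * f x) = c ^+ 2 * N2 f.
Proof. by move=> [_ f2]; rewrite /N2 -ExZ//; apply: eq_Ex => x; rewrite exprMn. Qed.

Lemma N2N f : N2 (fun x => - f x) = N2 f.
Proof. by apply: eq_Ex => x; rewrite sqrrN. Qed.

Lemma N2_sub f g : N2 (fun x => f x - g x) = N2 (fun x => g x - f x).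
Proof. by apply: eq_Ex => x; rewrite -sqrrN opprB. Qed.

Lemma N2D f g : L2 f -> L2 g ->
  N2 (fun x => f x + g x) = N2 f + 2 * Ex (fun x => f x * g x) + N2 g.
Proof.
move=> hf hg; have h1 := L2_mul hf hg.
rewrite /N2 -ExZ// -ExD ?(proj2 hf)//; last exact: L1Z.
rewrite -ExD ?(proj2 hg)//; last by apply: L1D; [case: hf|exact: L1Z].
by apply: eq_Ex => x; ring.
Qed.

Lemma N2_le f g : L2 f -> L2 g -> (forall x, `|f x| <= `|g x|) -> N2 f <= N2 g.
Proof.
move=> [_ hf] [_ hg] fg; apply: le_Ex => // x.
by rewrite -(real_normK (num_real (f x))) -(real_normK (num_real (g x))) lerXn2r ?nnegrE.
Qed.

Lemma parallelogram f g : L2 f -> L2 g ->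
  N2 (fun x => f x + g x) + N2 (fun x => f x - g x) = 2 * N2 f + 2 * N2 g.
Proof.
move=> hf hg.
have hgN := L2N hg.
rewrite N2D// (N2D hf hgN) N2N.
rewrite (_ : Ex (fun x => f x * - g x) = - Ex (fun x => f x * g x)).
  by ring.
by rewrite -ExN; [apply: eq_Ex => x; rewrite mulrN|exact: L2_mul].
Qed.

Lemma N2D_le f g : L2 f -> L2 g -> N2 (fun x => f x + g x) <= 2 * N2 f + 2 * N2 g.
Proof. by move=> hf hg; rewrite -parallelogram// lerDl N2_ge0. Qed.

Lemma N2B_le f g h : L2 f -> L2 g -> L2 h ->
  N2 (fun x => f x - h x) <= 2 * N2 (fun x => f x - g x) + 2 * N2 (fun x => g x - h x).
Proof.
move=> hf hg hh; have := N2D_le (L2B hf hg) (L2B hg hh).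
by rewrite (_ : (fun x => _ + _) = fun x => f x - h x)//; apply/funext => x; rewrite addrA subrK.
Qed.

Lemma cauchy_schwarz f g : L2 f -> L2 g -> (Ex (fun x => f x * g x)) ^+ 2 <= N2 f * N2 g.
Proof.
move=> hf hg; set c := Ex _.
have H t : 0 <= N2 f + 2 * (t * c) + t ^+ 2 * N2 g.
  rewrite -N2Z// (_ : t * c = Ex (fun x => f x * (t * g x))).
    by rewrite -N2D//; [exact: N2_ge0|exact: L2Z].
  by rewrite -ExZ; [apply: eq_Ex => x; rewrite mulrCA|exact: L2_mul].
have f0 := N2_ge0 f; have := N2_ge0 g; rewrite le_eqVlt => /predU1P[g0|g0].
  rewrite -g0 mulr0; have [->|c0] := eqVneq c 0; first by rewrite expr0n.
  have := H (- (N2 f + 1) / (2 * c)).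
  rewrite -g0 mulr0 addr0 (_ : 2 * _ = - (N2 f + 1)); first by lra.
  by field.
have := H (- c / N2 g).
rewrite (_ : _ + _ = N2 f - c ^+ 2 / N2 g); last by field; exact: lt0r_neq0.
by rewrite subr_ge0 ler_pdivrMr.
Qed.

Lemma Ex_norm_mul_le f g : L2 f -> L2 g -> Ex (fun x => `|f x * g x|) <= (N2 f + N2 g) / 2.
Proof.
move=> hf hg; rewrite -ExD ?(proj2 hf) ?(proj2 hg)// mulrC -ExZ; last by apply: L1D; [case: hf|case: hg].
apply: le_Ex.
- exact: L1_norm (L2_mul hf hg).
- by apply: L1Z; apply: L1D; [case: hf|case: hg].
- move=> x; rewrite normrM -(real_normK (num_real (f x))) -(real_normK (num_real (g x))).
  have := sqr_ge0 (`|f x| - `|g x|); lra.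
Qed.

Lemma Ex_sqr_le f : L2 f -> Ex f ^+ 2 <= N2 f.
Proof.
move=> hf; have := cauchy_schwarz hf (L2_cst 1).
rewrite /N2 (Ex_cst (1 ^+ 2)) expr1n mulr1.
by rewrite (_ : Ex (fun x => f x * 1) = Ex f)//; apply: eq_Ex => x; rewrite mulr1.
Qed.

Lemma ae_eq_N2 f g : L2 f -> measurable_fun setT g -> (\forall x \ae mu, f x = g x) ->
  L2 g /\ N2 f = N2 g.
Proof.
move=> [_ hf] mg fg.
have [] := @ae_eq_Ex (fun x => f x ^+ 2) (fun x => g x ^+ 2) hf.
- exact: measurable_funX.
- by apply: filterS fg => x ->.
by move=> h1 h2; split=> //; split.
Qed.

Lemma N2_eq0_ae f : L2 f -> N2 f = 0 -> \forall x \ae mu, f x = 0.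
Proof.
move=> [mf hf] /(Ex_eq0_ae hf (fun x => sqr_ge0 (f x))).
by apply: filterS => x /eqP; rewrite sqrf_eq0 => /eqP.
Qed.

Lemma fatou_L2 (u : nat -> T -> R) (h : T -> R) C : (forall n, L2 (u n)) -> measurable_fun setT h ->
  (\forall x \ae mu, u n x @[n --> \oo] --> h x) ->
  (\forall n \near \oo, N2 (u n) <= C) -> L2 h /\ N2 h <= C.
Proof.
move=> hu mh uh uC.
have mh2 : measurable_fun setT (fun x => h x ^+ 2) by exact: measurable_funX.
have H : (\int[mu]_x (h x ^+ 2)%:E <= C%:E)%E.
  have mu2 n : measurable_fun setT (fun x => (u n x ^+ 2)%:E).
    by apply/measurable_EFinP; apply: measurable_funX; case: (hu n).
  have := @fatou _ _ _ mu setT measurableT (fun n x => (u n x ^+ 2)%:E) mu2.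
  move=> /(_ (fun n x _ => _)) F.
  have {F} F : (\int[mu]_x limn_einf (fun n => (u n x ^+ 2)%:E) <=
     limn_einf (fun n => \int[mu]_x (u n x ^+ 2)%:E))%E.
    by apply: F => n x; rewrite lee_fin sqr_ge0.
  have E : (\int[mu]_x (h x ^+ 2)%:E = \int[mu]_x limn_einf (fun n => (u n x ^+ 2)%:E))%E.
    apply: ae_eq_integral => //.
    - exact/measurable_EFinP.
    - rewrite (_ : (fun x => _) = fun x => (- limn_esup (fun n => - (u n x ^+ 2)%:E))%E).
        apply: measurableT_comp => //; apply: measurable_fun_limn_esup => n.
        exact: measurableT_comp.
      by apply/funext => x; rewrite (limn_esupN (fun n => (u n x ^+ 2)%:E)) oppeK.
    - apply: filterS uh => x ux _.
      have : (u n x ^+ 2)%:E @[n --> \oo] --> (h x ^+ 2)%:E.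
        by apply/fine_cvgP; split; [exact: nearW|exact: cvgM].
      by move=> c; rewrite is_cvg_limn_einfE; [rewrite (cvg_lim _ c)|apply/cvg_ex; exists (h x ^+ 2)%:E].
  rewrite E (le_trans F)//.
  have [N _ NC] := uC.
  rewrite limn_einf_lim; apply: lime_le; first exact: is_cvg_einfs.
  near=> n.
  apply: (@le_trans _ _ (\int[mu]_x (u (maxn n N) x ^+ 2)%:E)%E).
    apply: ereal_inf_lbound; exists (maxn n N) => //=; exact: leq_maxl.
  by rewrite ExE ?(proj2 (hu _))// lee_fin NC//= leq_maxr.
have h2 : L1 (fun x => h x ^+ 2).
  apply/integrableP; split; first exact/measurable_EFinP.
  under eq_integral => x _ do rewrite /= ger0_norm ?sqr_ge0//.
  by rewrite (le_lt_trans H)// ltry.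
by split=> //; move: H; rewrite ExE// lee_fin.
Unshelve. all: by end_near. Qed.

Lemma series_sumE (u : nat -> R) n : series u n = \sum_(k < n) u k.
Proof. by rewrite /series/= big_mkord. Qed.

Lemma nondec_bounded_cvg (u : nat -> R) C : (forall k, 0 <= u k) ->
  (forall n, \sum_(k < n) u k <= C) -> cvgn (series u).
Proof.
move=> u0 uC; apply: nondecreasing_is_cvgn.
  by move=> m n mn; apply: nondecreasing_series.
by exists C => _ [n _ <-]; rewrite series_sumE.
Qed.

(** A single [S] serves both the pointwise series and the limits of expectations against all bounded
    weights, so it can be fixed before any test function. Dominated convergence applies with M times
    the sum of the |u_k|, which the bound [C] makes integrable. *)
Lemma summable_series (u : nat -> T -> R) C : (forall k, L1 (u k)) ->
  (forall n, \sum_(k < n) Ex (fun x => `|u k x|) <= C) ->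
  exists S : T -> R, [/\ L1 S, (\forall x \ae mu, series (u ^~ x) n @[n --> \oo] --> S x) &
    forall (m : T -> R) (M : R), measurable_fun setT m -> (forall x, `|m x| <= M) ->
     series (fun k => Ex (fun x => m x * u k x)) n @[n --> \oo] --> Ex (fun x => m x * S x)].
Proof.
move=> hu uC.
have mu_ k : measurable_fun setT (u k) := L1_meas (hu k).
pose G x := (\sum_(0 <= k <oo) `|u k x|%:E)%E.
have mnu k : measurable_fun setT (fun x => `|u k x|%:E).
  by apply/measurable_EFinP; apply: measurableT_comp.
have mG : measurable_fun setT G by apply: ge0_emeasurable_sum => // k x _ _; rewrite lee_fin.
have G0 x : (0 <= G x)%E by apply: nneseries_ge0 => k _ _; rewrite lee_fin.
have iG : mu.-integrable setT G.
  apply/integrableP; split => //.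
  under eq_integral => x _ do rewrite gee0_abs//.
  rewrite integral_nneseries//.
  rewrite (@le_lt_trans _ _ C%:E)// ?ltry//.
  apply: lime_le; first by apply: is_cvg_nneseries => k _ _; apply: integral_ge0 => x _; rewrite lee_fin.
  apply: nearW => n; rewrite big_mkord.
  rewrite (eq_bigr (fun k : 'I_n => (Ex (fun x => `|u k x|))%:E)).
    by rewrite sumEFin lee_fin uC.
  by move=> k _; rewrite ExE//; exact: L1_norm.
have acv : \forall x \ae mu, cvgn (series (u ^~ x)) /\ forall n, (`|series (u ^~ x) n|%:E <= G x)%E.
  apply: filterS (integrable_ae measurableT iG) => x /(_ I) Gfin.
  have B n : ((\sum_(k < n) `|u k x|)%:E <= G x)%E.
    rewrite -sumEFin -(big_mkord xpredT (fun k => `|u k x|%:E)).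
    by apply: nneseries_lim_ge => k _; rewrite lee_fin.
  split.
    apply: normed_cvg; apply: (@nondec_bounded_cvg _ (fine (G x))) => [k|n].
      exact: normr_ge0.
    by rewrite -lee_fin fineK//; exact: B.
  move=> n; apply: le_trans (B n); rewrite lee_fin series_sumE; exact: ler_norm_sum.
(* The upper limit is measurable on the whole space, including the null set where the series may
   diverge. *)
pose S x := fine (limn_esup (fun n => (series (u ^~ x) n)%:E)).
have ms n : measurable_fun setT (fun x => series (u ^~ x) n).
  rewrite (_ : (fun x => _) = fun x => \sum_(k < n) u k x).
    by apply: measurable_sum.
  by apply/funext => x; rewrite series_sumE.
have mS : measurable_fun setT S.
  apply: measurableT_comp => //; apply: measurable_fun_limn_esup => n.
  exact/measurable_EFinP.
have SE : \forall x \ae mu, series (u ^~ x) n @[n --> \oo] --> S x.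
  apply: filterS acv => x [cx _].
  have c2 : (series (u ^~ x) n)%:E @[n --> \oo] --> (limn (series (u ^~ x)))%:E.
    by apply/fine_cvgP; split; [exact: nearW|].
  by rewrite /S is_cvg_limn_esupE ?(cvg_lim _ c2)//; apply/cvg_ex; eexists; exact: c2.
have key (m : T -> R) (M : R) : measurable_fun setT m -> (forall x, `|m x| <= M) ->
    L1 (fun x => m x * S x) /\
    series (fun k => Ex (fun x => m x * u k x)) n @[n --> \oo] --> Ex (fun x => m x * S x).
  move=> mm mM.
  have := @dominated_convergence _ _ _ mu setT measurableT
    (fun n x => (m x * series (u ^~ x) n)%:E) (fun x => (m x * S x)%:E) (fun x => (M%:E * G x)%E).
  case.
  - by move=> n; apply/measurable_EFinP; exact: measurable_funM.
  - by apply/measurable_EFinP; exact: measurable_funM.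
  - apply: filterS SE => x Sx _; apply/fine_cvgP; split; first exact: nearW.
    by apply: cvgM => //; exact: cvg_cst.
  - exact: integrableZl.
  - apply: filterS acv => x [_ H] n _.
    rewrite abse_EFin normrM EFinM lee_pmul ?lee_fin//.
  move=> iS _ cv; split=> //.
  rewrite (_ : series _ = fun n => fine (\int[mu]_x (m x * series (u ^~ x) n)%:E)).
    by apply: (fine_cvg); rewrite -ExE.
  apply/funext => n; rewrite series_sumE -(@Ex_sum (fun k x => m x * u k x)) => [|k _]; last exact: L1_bound mM.
  rewrite /Ex /Rintegral; congr fine; apply: eq_integral => x _.
  by rewrite series_sumE mulr_sumr.
exists S; split => // [|m M mm mM].
- have [] // := key (fun=> 1) 1; first by move=> x; rewrite normr1.
  by rewrite (_ : (fun x => _) = S)//; apply/funext => x; rewrite mul1r.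
- by have [] := key m M mm mM.
Qed.

(** [e n] bounds the L^2 norms of the increments, which makes them absolutely summable in L^1. The
    almost sure limit inherits the quadratic bounds by Fatou's lemma. *)
Lemma L2_complete (u : nat -> T -> R) (e : nat -> R) : (forall n, L2 (u n)) ->
  (forall n m, (n <= m)%N -> N2 (fun x => u m x - u n x) <= e n ^+ 2) ->
  (forall n, 0 <= e n) -> cvgn (series e) ->
  exists h, L2 h /\ forall n, N2 (fun x => u n x - h x) <= e n ^+ 2.
Proof.
move=> hu ue e0 es.
pose w k x := u k.+1 x - u k x.
have hw k : L2 (w k) by exact: L2B.
have [|n|S [hS wS _]] := @summable_series w (limn (series e)); first by move=> k; exact: L2_L1.
  apply: (@le_trans _ _ (series e n)); last first.
    by apply: nondecreasing_cvgn_le => // a b ab; apply: nondecreasing_series.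
  rewrite series_sumE; apply: ler_sum => k _.
  rewrite -(@ler_pXn2r _ 2)// ?nnegrE//; last by apply: Ex_ge0.
  apply: le_trans (Ex_sqr_le (L2_norm (hw k))) _.
  apply: le_trans (ue k k.+1 _) => //.
  by rewrite le_eqVlt; apply/orP; left; apply/eqP; apply: eq_Ex => x; rewrite real_normK ?num_real.
pose h x := u 0 x + S x.
have mh : measurable_fun setT h by apply: measurable_funD; [case: (hu 0)|exact: L1_meas].
have uh : \forall x \ae mu, u n x @[n --> \oo] --> h x.
  apply: filterS wS => x wx.
  rewrite (_ : u ^~ x = fun n => u 0 x + series (w ^~ x) n).
    by apply: cvgD => //; exact: cvg_cst.
  apply/funext => n; rewrite /series/=; elim: n => [|n IH]; first by rewrite big_nil addr0.
  by rewrite big_nat_recr//= addrA -IH /w addrC subrK.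
have H n : L2 (fun x => u n x - h x) /\ N2 (fun x => u n x - h x) <= e n ^+ 2.
  apply: (@fatou_L2 (fun m x => u n x - u m x)).
  - by move=> m; exact: L2B.
  - by apply: measurable_funB => //; case: (hu n).
  - by apply: filterS uh => x ux; apply: cvgB => //; exact: cvg_cst.
  - by exists n => // m /= nm; rewrite N2_sub; exact: ue.
exists h; split; last by move=> n; have [] := H n.
have [H0 _] := H 0.
rewrite (_ : h = fun x => u 0 x - (u 0 x - h x)); first exact: L2B.
by apply/funext => x; rewrite subKr.
Qed.

(* In the theorem [g] involves versions picked by [xget], which need not be measurable. *)
Lemma le_expectation_nonmeas (f g : T -> R) : measurable_fun setT f ->
  (forall x, 0 <= f x) -> (forall x, 0 <= g x) -> (\forall x \ae mu, f x = g x) ->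
  ('E_mu[f] <= 'E_mu[g])%E.
Proof.
move=> mf f0 g0 [N [mN N0 fgN]].
pose f' x := f x * \1_(~` N) x.
have mf' : measurable_fun setT f'.
  by apply: measurable_funM => //; apply: measurable_indic; exact: measurableC.
have f'0 x : 0 <= f' x by rewrite mulr_ge0// indicE.
have -> : ('E_mu[f] = 'E_mu[f'])%E.
  rewrite unlock; apply: ae_eq_integral => //; [exact/measurable_EFinP|exact/measurable_EFinP|].
  exists N; split=> // x /= H; apply: contrapT => xN; apply: H => _.
  by rewrite /f' indicE mem_set ?mulr1.
rewrite unlock !ge0_integralTE//; try by move=> x; rewrite lee_fin.
apply: le_ereal_sup => _ [s sf <-]; exists s => // x; apply: le_trans (sf x) _.
rewrite lee_fin /f' indicE; case: (pselect (N x)) => xN.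
  by rewrite memNset ?mulr0//=; exact/not_notP.
rewrite mem_set// mulr1; have [->//|fg] := pselect (f x = g x).
by exfalso; apply: xN; exact: fgN.
Qed.

End square_integrable.

(** * Functions of a sequence of bits *)

Definition coord_sets : set (set (nat -> bool)) := [set A | exists k, A = [set x : nat -> bool | x k]].
Definition bits := g_sigma_algebraType coord_sets.

Definition put (k : nat) (b : bool) (x : bits) : bits := fun j => if j == k then b else x j.
Definition splice (n : nat) (x y : bits) : bits := fun j => if (j < n)%N then x j else y j.

Lemma put_id k (x : bits) : put k (x k) x = x.
Proof. by apply/funext => j; rewrite /put; case: eqP => [->|]. Qed.

Lemma put_put k b c (x : bits) : put k b (put k c x) = put k b x.
Proof. by apply/funext => j; rewrite /put; case: eqP. Qed.

Lemma put_comm j k b c (x : bits) : j != k -> put j b (put k c x) = put k c (put j b x).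
Proof.
move=> jk; apply/funext => i; rewrite /put; have [->|//] := eqVneq i j.
by rewrite (negbTE jk).
Qed.

Lemma put_same k b (x : bits) : put k b x k = b.
Proof. by rewrite /put eqxx. Qed.

Lemma put_other j k b (x : bits) : j != k -> put k b x j = x j.
Proof. by rewrite /put => /negbTE ->. Qed.

Lemma splice0 x y : splice 0 x y = y. Proof. exact/funext. Qed.

(** Builds [splice] from successive applications of [put], so that facts about fixing one coordinate
    pass to the first n by induction. *)
Lemma spliceS n x y : splice n.+1 x y = splice n x (put n (x n) y).
Proof.
apply/funext => j; rewrite /splice /put ltnS leq_eqVlt.
by have [->|jn] := eqVneq j n; rewrite ?ltnn.
Qed.

Lemma put_splice n b x y : put n b (splice n x y) = splice n x (put n b y).
Proof.
apply/funext => j; rewrite /splice /put.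
by have [->|//] := eqVneq j n; rewrite ltnn.
Qed.

Lemma measurable_bits d (T : measurableType d) (F : T -> bits) :
  (forall k, measurable_fun setT (fun w => F w k)) -> measurable_fun setT F.
Proof.
move=> mF; apply: (measurability (coord_sets : set (set bits))) => //.
move=> _ [_ [k ->] <-]; rewrite setTI.
have : measurable (setT `&` (F ^~ k) @^-1` [set true]) by exact: mF.
by rewrite setTI; congr measurable; apply/seteqP; split => x /=.
Qed.

Lemma measurable_coord k : measurable_fun setT (fun x : bits => x k).
Proof.
apply: (@measurable_fun_bool _ _ _ _ true).
by rewrite setTI; apply: sub_sigma_algebra; exists k; apply/seteqP; split => x /=.
Qed.

Lemma measurable_put k b : measurable_fun setT (put k b).
Proof.
apply: measurable_bits => j; rewrite /put; case: eqP => _; first exact: measurable_cst.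
exact: measurable_coord.
Qed.

Lemma measurable_splice n x : measurable_fun setT (splice n x).
Proof.
apply: measurable_bits => j; rewrite /splice; case: (j < n)%N; first exact: measurable_cst.
exact: measurable_coord.
Qed.

Section dependence.
Context {R : realType}.
Implicit Types f g : bits -> R.

Definition depends_on (M : set nat) f :=
  forall x y : bits, (forall j, M j -> x j = y j) -> f x = f y.
Definition free_of k f := forall b x, f (put k b x) = f x.
Definition level n f := depends_on [set j | (j < n)%N] f.

Lemma depends_on_sub (M N : set nat) f : M `<=` N -> depends_on M f -> depends_on N f.
Proof. by move=> MN fM x y xy; apply: fM => j /MN; exact: xy. Qed.

Lemma depends_on_free M f k : depends_on M f -> ~ M k -> free_of k f.
Proof.
by move=> fM Mk b x; apply: fM => j Mj; rewrite put_other//; apply/eqP => jk; rewrite jk in Mj.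
Qed.

Lemma level_step n f : level n.+1 f -> forall b, level n (f \o put n b).
Proof.
move=> fn b x y xy; apply: fn => j; rewrite /= ltnS leq_eqVlt /put => /predU1P[->|jn].
  by rewrite eqxx.
by case: ifP => // _; exact: xy.
Qed.

(** A function of n bits is a finite case distinction, made one coordinate at a time. *)
Lemma level_meas_bounded n f : level n f ->
  measurable_fun setT f /\ exists C, forall x, `|f x| <= C.
Proof.
elim: n f => [|n IH] f fn.
  have -> : f = fun=> f (fun=> true) by apply/funext => x; exact: fn.
  by split; [exact: measurable_cst|exists `|f (fun=> true)|].
have [m1 [C1 h1]] := IH _ (level_step fn true).
have [m2 [C2 h2]] := IH _ (level_step fn false).
have E x : f x = if x n then (f \o put n true) x else (f \o put n false) x.
  by rewrite /=; case: ifP => xn; rewrite -[in LHS](put_id n x) xn.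
split; last first.
  by exists (`|C1| + `|C2|) => x; rewrite E; case: ifP => _;
    [apply: (le_trans (h1 x))|apply: (le_trans (h2 x))];
    rewrite (le_trans (ler_norm _))// ?lerDl ?lerDr.
by rewrite (funext E); apply: measurable_fun_ifT => //; exact: measurable_coord.
Qed.

End dependence.

(** * Gradients and conditional expectations under the resampling identity *)

Section canonical.
Context {R : realType} (mu : probability bits R) (p q : nat -> R).
Hypothesis p01 : forall k, 0 < p k < 1.
Hypothesis pq1 : forall k, p k = 1 - q k.
Hypothesis resample : forall k (f : bits -> \bar R), measurable_fun setT f ->
  (forall x, 0 <= f x)%E ->
  (\int[mu]_x f x = (p k)%:E * (\int[mu]_x f (put k true x)) +
     (q k)%:E * (\int[mu]_x f (put k false x)))%E.
Implicit Types (f g u : bits -> R) (k n : nat).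

Local Notation L1 := (L1 mu).
Local Notation L2 := (L2 mu).
Local Notation Ex := (Ex mu).
Local Notation N2 := (N2 mu).

Lemma p_gt0 k : 0 < p k. Proof. by case/andP: (p01 k). Qed.
Lemma q_gt0 k : 0 < q k. Proof. by have /andP[_] := p01 k; rewrite pq1; lra. Qed.
Lemma pDq k : p k + q k = 1. Proof. by rewrite pq1 subrK. Qed.
Lemma qE k : q k = 1 - p k. Proof. by rewrite pq1 opprB addrC subrK. Qed.
Lemma onem2pq k : 1 - 2 * p k * q k = p k ^+ 2 + q k ^+ 2.
Proof. by rewrite (pq1 k); ring. Qed.
Definition spq k := Num.sqrt (p k * q k).
Lemma spq_gt0 k : 0 < spq k. Proof. by rewrite sqrtr_gt0 mulr_gt0 ?p_gt0 ?q_gt0. Qed.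
Lemma spq_neq0 k : spq k != 0. Proof. exact: lt0r_neq0 (spq_gt0 k). Qed.
Lemma spq2 k : spq k ^+ 2 = p k * q k.
Proof. by rewrite sqr_sqrtr// ltW// mulr_gt0 ?p_gt0 ?q_gt0. Qed.
Lemma measurable_comp_put k b f : measurable_fun setT f -> measurable_fun setT (f \o put k b).
Proof. by move=> mf; apply: measurableT_comp => //; exact: measurable_put. Qed.

(** Both values of the coordinate have positive weight, so an infinite integral after fixing it
    would make the integral of |f| infinite. *)
Lemma L1_put k b f : L1 f -> L1 (f \o put k b).
Proof.
move=> hf; have mf := L1_meas hf.
have mfk : measurable_fun setT (f \o put k b) by exact: measurable_comp_put.
apply/integrableP; split; first exact/measurable_EFinP.
have /integrableP[_] := hf.
rewrite (@resample k (fun x => `|(f x)%:E|)%E)//; last first.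
  by apply: measurableT_comp => //; exact/measurable_EFinP.
have I c : (0 <= \int[mu]_x `|(f (put k c x))%:E|)%E by apply: integral_ge0.
have p0 := p_gt0 k; have q0 := q_gt0 k.
move=> H; apply: contrapT => /negP; rewrite -leNgt leye_eq => /eqP Hb.
move: H; case: b Hb mfk => /= -> _.
- rewrite gt0_muley ?lte_fin// addye ?ltxx//.
  by apply/negP => /eqP E; have := mule_ge0 (ltW q0 : (0 <= (q k)%:E)%E) (I false); rewrite E.
- rewrite [X in (_ + X)%E]gt0_muley ?lte_fin// addey ?ltxx//.
  by apply/negP => /eqP E; have := mule_ge0 (ltW p0 : (0 <= (p k)%:E)%E) (I true); rewrite E.
Qed.

Lemma Ex_resample_ge0 k f : L1 f -> (forall x, 0 <= f x) ->
  Ex f = p k * Ex (f \o put k true) + q k * Ex (f \o put k false).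
Proof.
move=> hf f0; apply: EFin_inj; rewrite EFinD !EFinM -!ExE//; try exact: L1_put.
apply: (@resample k (fun x => (f x)%:E)).
  by apply/measurable_EFinP; exact: L1_meas hf.
by move=> x; rewrite lee_fin.
Qed.

Lemma Ex_resample k f : L1 f ->
  Ex f = p k * Ex (f \o put k true) + q k * Ex (f \o put k false).
Proof.
move=> hf.
(* The resampling identity is available for nonnegative functions, and f is the difference of these
   two. *)
pose a x := (`|f x| + f x); pose b x := `|f x|.
have hb : L1 b := L1_norm hf.
have ha : L1 a := L1D hb hf.
have E g' : L1 g' -> Ex g' = Ex (fun x => `|g' x| + g' x) - Ex (fun x => `|g' x|).
  by move=> hg; rewrite ExD//; [rewrite addrC addKr|exact: L1_norm].
have a0 x : 0 <= a x by rewrite /a -lerBlDr sub0r ler_normr lexx orbT.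
have b0 x : 0 <= b x by exact: normr_ge0.
have -> : Ex f = Ex a - Ex b := E f hf.
rewrite (Ex_resample_ge0 k ha a0) (Ex_resample_ge0 k hb b0).
rewrite (E _ (L1_put k true hf)) (E _ (L1_put k false hf)) /a /b /comp /=; ring.
Qed.

Lemma L2_put k b f : L2 f -> L2 (f \o put k b).
Proof. by move=> [mf f2]; split; [exact: measurable_comp_put|exact: (L1_put k b f2)]. Qed.

(* E[. | G_k], the gradient, and Y_k, as operators on functions of bits. *)
Definition Eint k f x := p k * f (put k true x) + q k * f (put k false x).
Definition Dh k f x := spq k * (f (put k true x) - f (put k false x)).
Definition Ym k (x : bits) := if x k then Num.sqrt (q k / p k) else - Num.sqrt (p k / q k).

Lemma L1_Eint k f : L1 f -> L1 (Eint k f).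
Proof. by move=> hf; apply: L1D; apply: L1Z; exact: L1_put. Qed.

Lemma L2_Eint k f : L2 f -> L2 (Eint k f).
Proof. by move=> hf; apply: L2D; apply: L2Z; exact: L2_put. Qed.

Lemma L2_Dh k f : L2 f -> L2 (Dh k f).
Proof. by move=> hf; apply: L2Z; apply: L2B; exact: L2_put. Qed.

Lemma Dh_free k f : free_of k (Dh k f).
Proof. by move=> b x; rewrite /Dh !put_put. Qed.

Lemma Ex_Eint k f : L1 f -> Ex (Eint k f) = Ex f.
Proof.
move=> hf; rewrite (@Ex_resample k f)// -!ExZ ?(L1_put)// -ExD//;
  by apply: L1Z; exact: L1_put.
Qed.

Lemma sqrt_qp k : Num.sqrt (q k / p k) = q k / spq k.
Proof.
have p0 := p_gt0 k; have q0 := q_gt0 k.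
rewrite -(@ger0_norm _ (q k / spq k)) ?divr_ge0 ?ltW ?spq_gt0//.
rewrite -sqrtr_sqr expr_div_n spq2; congr Num.sqrt; field.
by rewrite !lt0r_neq0.
Qed.

Lemma sqrt_pq k : Num.sqrt (p k / q k) = p k / spq k.
Proof.
have p0 := p_gt0 k; have q0 := q_gt0 k.
rewrite -(@ger0_norm _ (p k / spq k)) ?divr_ge0 ?ltW ?spq_gt0//.
rewrite -sqrtr_sqr expr_div_n spq2; congr Num.sqrt; field.
by rewrite !lt0r_neq0.
Qed.

Lemma Ym_put k b x : Ym k (put k b x) = (if b then q k else - p k) / spq k.
Proof. by rewrite /Ym put_same; case: b; rewrite ?sqrt_qp ?sqrt_pq ?mulNr. Qed.

Lemma DhE k f x : f x - Eint k f x = Ym k x * Dh k f x.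
Proof.
rewrite /Eint /Dh -{1 4}(put_id k x) Ym_put mulrA divfK ?spq_neq0//.
by rewrite qE; case: (x k); ring.
Qed.

Lemma measurable_Ym k : measurable_fun setT (Ym k).
Proof. by apply: measurable_fun_ifT; [exact: measurable_coord| |]. Qed.

Definition Ybd k := (p k + q k) / spq k.

Lemma Ym_bound k x : `|Ym k x| <= Ybd k.
Proof.
have p0 := p_gt0 k; have q0 := q_gt0 k; have s0 := spq_gt0 k.
rewrite -(put_id k x) Ym_put /Ybd normrM (ger0_norm (_ : 0 <= (spq k)^-1)) ?invr_ge0 ?(ltW s0)//.
rewrite ler_wpM2r ?invr_ge0 ?(ltW s0)//; case: (x k); rewrite ?normrN ger0_norm ?(ltW p0) ?(ltW q0)//.
- by rewrite lerDr ltW.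
- by rewrite lerDl ltW.
Qed.

Lemma L1_Ym k f : L1 f -> L1 (fun x => Ym k x * f x).
Proof. by move=> hf; apply: L1_bound hf (measurable_Ym k) (Ym_bound k). Qed.

Lemma L2_Ym k f : L2 f -> L2 (fun x => Ym k x * f x).
Proof. by move=> hf; apply: L2_bound hf (measurable_Ym k) (Ym_bound k). Qed.

(** One-coordinate integration by parts. After resampling, the weights are p q / sqrt(pq) on the
    value 1 and -q p / sqrt(pq) on the other, that is plus and minus sqrt(pq). *)
Lemma Ex_Ym_mul k u f : free_of k u -> L1 (fun x => u x * f x) ->
  Ex (fun x => Ym k x * (u x * f x)) = Ex (fun x => u x * Dh k f x).
Proof.
move=> uf h; rewrite (Ex_resample k); last exact: L1_Ym.
have E b : Ex ((fun x => Ym k x * (u x * f x)) \o put k b) =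
    (if b then q k else - p k) / spq k * Ex (fun x => u x * f (put k b x)).
  rewrite -ExZ; first by apply: eq_Ex => x /=; rewrite Ym_put uf.
  by apply: (eq_L1 (L1_put k b h)) => x /=; rewrite uf.
rewrite !E /Dh.
have L b : L1 (fun x => u x * f (put k b x)).
  by apply: (eq_L1 (L1_put k b h)) => x /=; rewrite uf.
rewrite (@eq_Ex _ _ _ _ (fun x => u x * (spq k * (f (put k true x) - f (put k false x))))
  (fun x => spq k * (u x * f (put k true x)) - spq k * (u x * f (put k false x)))); last first.
  by move=> x; ring.
rewrite ExB ?ExZ//; try exact: L1Z.
rewrite (_ : spq k * _ - _ = spq k ^+ 2 / spq k * (Ex (fun x => u x * f (put k true x)) -
  Ex (fun x => u x * f (put k false x)))); last by field; exact: spq_neq0.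
by rewrite spq2; ring.
Qed.

Lemma Ex_Ym2 k u : free_of k u -> L1 u -> Ex (fun x => Ym k x ^+ 2 * u x) = Ex u.
Proof.
move=> uf hu.
rewrite (@eq_Ex _ _ _ _ _ (fun x => Ym k x * (u x * Ym k x))); last by move=> x; ring.
have uY : L1 (fun x => u x * Ym k x).
  by apply: (eq_L1 (L1_Ym k hu)) => x; rewrite mulrC.
rewrite Ex_Ym_mul//; apply: eq_Ex => x; rewrite /Dh !Ym_put.
rewrite -mulrBl opprK mulrCA addrC pDq mul1r.
by rewrite mulrC divfK ?spq_neq0.
Qed.

Lemma N2_Ym k u : free_of k u -> L2 u -> N2 (fun x => Ym k x * u x) = N2 u.
Proof.
move=> uf [_ hu]; rewrite /N2 -(@Ex_Ym2 k _ _ hu); last by move=> b x; rewrite uf.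
by apply: eq_Ex => x; rewrite exprMn.
Qed.

Lemma Ex_Ym0 k u : free_of k u -> L1 u -> Ex (fun x => Ym k x * u x) = 0.
Proof.
move=> uf hu; rewrite (@eq_Ex _ _ _ _ _ (fun x => Ym k x * (u x * 1))); last first.
  by move=> x; rewrite mulr1.
rewrite Ex_Ym_mul//.
  by rewrite -[RHS](Ex_cst mu 0); apply: eq_Ex => x; rewrite /Dh subrr !mulr0.
by apply: (eq_L1 (hu)) => x; rewrite mulr1.
Qed.

(** Variance of a two-point law: p a^2 + q b^2 = (p a + q b)^2 + p q (a - b)^2. *)
Lemma N2_decomp k f : L2 f -> N2 f = N2 (Eint k f) + N2 (Dh k f).
Proof.
move=> hf; have h2 := proj2 hf.
rewrite /N2 -(Ex_Eint k h2) -ExD ?(proj2 (L2_Eint k hf)) ?(proj2 (L2_Dh k hf))//.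
apply: eq_Ex => x; rewrite /Eint /Dh exprMn spq2 qE; ring.
Qed.

Lemma N2_Dh_le k f : L2 f -> N2 (Dh k f) <= N2 f.
Proof. by move=> hf; rewrite (N2_decomp k hf) lerDr N2_ge0. Qed.

Lemma N2_Eint_le k f : L2 f -> N2 (Eint k f) <= N2 f.
Proof. by move=> hf; rewrite (N2_decomp k hf) lerDl N2_ge0. Qed.

Lemma DhB k f g : Dh k (fun x => f x - g x) = fun x => Dh k f x - Dh k g x.
Proof. by apply/funext => x; rewrite /Dh; ring. Qed.

Lemma DhD k f g : Dh k (fun x => f x + g x) = fun x => Dh k f x + Dh k g x.
Proof. by apply/funext => x; rewrite /Dh; ring. Qed.

Lemma DhZ k c f : Dh k (fun x => c * f x) = fun x => c * Dh k f x.
Proof. by apply/funext => x; rewrite /Dh; ring. Qed.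

Lemma Dh_free0 k f : free_of k f -> Dh k f = fun=> 0.
Proof. by move=> ff; apply/funext => x; rewrite /Dh !ff subrr mulr0. Qed.

Lemma Dh_Eint j k f : j != k -> Dh j (Eint k f) = Eint k (Dh j f).
Proof.
by move=> jk; apply/funext => x; rewrite /Dh /Eint !(put_comm _ _ _ jk); ring.
Qed.

Lemma depends_on_Eint M k f : depends_on M f -> depends_on (M `&` [set j | j != k]) (Eint k f).
Proof.
move=> fM x y xy; rewrite /Eint.
have E b : f (put k b x) = f (put k b y).
  apply: fM => j Mj; rewrite /put; case: eqVneq => // jk.
  by apply: xy; split.
by rewrite !E.
Qed.

Lemma level_L2 n f : level n f -> L2 f.
Proof.
move=> /level_meas_bounded[mf [C fC]]; apply: (L2_le mf (L2_cst mu C)) => x.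
by rewrite (le_trans (fC x))// ler_norm.
Qed.

(* By successively averaging out the coordinates. *)
Fixpoint Esucc n f := if n is m.+1 then Eint m (Esucc m f) else f.

Lemma L2_Esucc n f : L2 f -> L2 (Esucc n f).
Proof. by elim: n => //= n IH hf; apply: L2_Eint; exact: IH. Qed.

Lemma Ex_Esucc n f : L2 f -> Ex (Esucc n f) = Ex f.
Proof.
by elim: n => //= n IH hf; rewrite Ex_Eint ?IH//; apply: L2_L1; exact: L2_Esucc.
Qed.

Lemma N2_Esucc_le n f : L2 f -> N2 (Esucc n f) <= N2 f.
Proof.
elim: n => //= n IH hf; apply: le_trans (IH hf); apply: N2_Eint_le; exact: L2_Esucc.
Qed.

Lemma Dh_Esucc n j f : (n <= j)%N -> Dh j (Esucc n f) = Esucc n (Dh j f).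
Proof.
elim: n => //= n IH nj; rewrite Dh_Eint ?IH//; first exact: ltnW.
by rewrite neq_ltn nj orbT.
Qed.

Lemma level_Esucc n f : level n f -> forall m, (m <= n)%N ->
  depends_on [set j | (m <= j < n)%N] (Esucc m f).
Proof.
move=> fn; elim=> [|m IH] mn; first by apply: depends_on_sub fn => j.
apply: (@depends_on_sub _ _ _ _ _ (@depends_on_Eint _ m _ (IH (ltnW mn)))) => j /= [/andP[mj jn] jm].
by rewrite jn andbT ltn_neqAle eq_sym jm.
Qed.

(** Telescopes [N2_decomp] along the successive averages. The gradient in coordinate m commutes with
    averaging over the earlier coordinates, which contracts the L^2 norm; once all n coordinates are
    averaged out, a constant remains. *)
Lemma efron_stein n f : level n f -> N2 f <= Ex f ^+ 2 + \sum_(k < n) N2 (Dh k f).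
Proof.
move=> fn; have hf := level_L2 fn.
have H m : N2 f <= N2 (Esucc m f) + \sum_(k < m) N2 (Dh k f).
  elim: m => [|m IH]; first by rewrite big_ord0 addr0.
  rewrite (le_trans IH)// big_ord_recr/= (N2_decomp m (L2_Esucc m hf)).
  rewrite Dh_Esucc// -!addrA lerD2l addrC lerD2l N2_Esucc_le//.
  exact: L2_Dh.
apply: (le_trans (H n)); rewrite lerD2r -(Ex_Esucc n hf).
have E : Esucc n f = fun=> Esucc n f (fun=> true).
  apply/funext => x; apply: (level_Esucc fn (leqnn n)) => j /= /andP[nj].
  by rewrite ltnNge nj.
by rewrite E /N2 !Ex_cst.
Qed.

(* Conditional expectation given the first [n] coordinates. *)
Definition Ege n f x := Ex (f \o splice n x).

Lemma comp_spliceS n f x : f \o splice n.+1 x = (f \o splice n x) \o put n (x n).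
Proof. by apply/funext => y /=; rewrite spliceS. Qed.

Lemma L1_splice n f x : L1 f -> L1 (f \o splice n x).
Proof.
move=> hf; elim: n => [|n IH]; last by rewrite comp_spliceS; exact: L1_put.
by rewrite (_ : f \o _ = f)//; apply/funext => y /=; rewrite splice0.
Qed.

Lemma L2_splice n f x : L2 f -> L2 (f \o splice n x).
Proof.
move=> [mf f2]; split; last exact: (L1_splice n x f2).
by apply: measurableT_comp => //; exact: measurable_splice.
Qed.

Lemma Ege0 f x : Ege 0 f x = Ex f.
Proof. by apply: eq_Ex => y /=; rewrite splice0. Qed.

Lemma Ege_level n f : level n (Ege n f).
Proof.
move=> x y xy; apply: eq_Ex => z /=; congr f; apply/funext => j.
by rewrite /splice; case: ifP => // jn; exact: xy.
Qed.

Lemma Ege_id n f : level n f -> Ege n f = f.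
Proof.
move=> fn; apply/funext => x; rewrite -[RHS](Ex_cst mu); apply: eq_Ex => y /=.
by apply: fn => j /= jn; rewrite /splice jn.
Qed.

Lemma Ege_Dh n f x : L1 f ->
  Ege n (Dh n f) x = spq n * (Ex ((f \o splice n x) \o put n true) - Ex ((f \o splice n x) \o put n false)).
Proof.
move=> hf; have h b := L1_put n b (L1_splice n x hf).
rewrite -ExB// -ExZ; last exact: L1B.
by apply: eq_Ex => y /=; rewrite /Dh !put_splice.
Qed.

(** Given the first n bits, the increment is a centered function of bit n alone, hence a multiple of
    Y_n. The identity holds at every point because fixing coordinates preserves integrability. *)
Lemma EgeS n f x : L1 f -> Ege n.+1 f x - Ege n f x = Ym n x * Ege n (Dh n f) x.
Proof.
move=> hf; rewrite Ege_Dh// /Ege comp_spliceS (Ex_resample n (L1_splice n x hf)).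
rewrite -(put_id n x) Ym_put put_same mulrA divfK ?spq_neq0// put_id.
by rewrite qE; case: (x n); ring.
Qed.

Lemma L2_Ege n f : L2 (Ege n f). Proof. exact: level_L2 (@Ege_level n f). Qed.

Lemma Ege_free n f : free_of n (Ege n f).
Proof. by apply: (depends_on_free (@Ege_level n f)) => /=; rewrite ltnn. Qed.

Lemma Ex_Ege n f : L1 f -> Ex (Ege n f) = Ex f.
Proof.
move=> hf; elim: n => [|n IH].
  by rewrite -[RHS](Ex_cst mu); apply: eq_Ex => x; rewrite Ege0.
rewrite -IH -[LHS](subrK (Ex (Ege n f))) -ExB; [|exact: L2_L1 (L2_Ege _ _)..].
rewrite (@eq_Ex _ _ _ _ _ (fun x => Ym n x * Ege n (Dh n f) x)); last first.
  by move=> x; exact: EgeS.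
rewrite Ex_Ym0 ?add0r//; first exact: Ege_free.
exact: L2_L1 (L2_Ege _ _).
Qed.

(** Jensen's inequality for the spliced function at each point, followed by integration with
    [Ex_Ege]. *)
Lemma N2_Ege_le n f : L2 f -> N2 (Ege n f) <= N2 f.
Proof.
move=> hf; have h2 := proj2 hf.
rewrite /N2 -(Ex_Ege n h2); apply: le_Ex.
- exact: (proj2 (L2_Ege n f)).
- exact: L2_L1 (L2_Ege _ _).
- by move=> x; exact: Ex_sqr_le (L2_splice n x hf).
Qed.

Lemma EgeM n u f x : level n u -> L1 f -> Ege n (fun y => u y * f y) x = u x * Ege n f x.
Proof.
move=> un hf; rewrite -ExZ; last exact: L1_splice.
apply: eq_Ex => y /=; congr (_ * _); apply: un => j /= jn.
by rewrite /splice jn.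
Qed.

Lemma Ex_Ege_mul n u f : level n u -> L1 f ->
  Ex (fun x => u x * Ege n f x) = Ex (fun x => u x * f x).
Proof.
move=> un hf; have [mu_ [C uC]] := level_meas_bounded un.
rewrite -(Ex_Ege n (L1_bound hf mu_ uC)); apply: eq_Ex => x.
by rewrite EgeM.
Qed.

Lemma EgeB n f g x : L1 f -> L1 g -> Ege n (fun y => f y - g y) x = Ege n f x - Ege n g x.
Proof. by move=> hf hg; rewrite -ExB//; exact: L1_splice. Qed.

(** Young's inequality with a free weight, by which the smallness of one factor can outweigh the
    mere boundedness of the other. *)
Lemma Ex_mul_weighted s f g : 0 < s -> L2 f -> L2 g ->
  `|Ex (fun x => f x * g x)| <= (s * N2 f + N2 g / s) / 2.
Proof.
move=> s0 hf hg; have r0 : 0 < Num.sqrt s by rewrite sqrtr_gt0.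
have := Ex_norm_mul_le (L2Z (Num.sqrt s) hf) (L2Z (Num.sqrt s)^-1 hg).
rewrite (N2Z _ hf) (N2Z _ hg) exprVn (sqr_sqrtr (ltW s0)) [s^-1 * N2 g]mulrC; apply: le_trans.
apply: le_trans (norm_Ex_le (L2_mul hf hg)) _.
rewrite le_eqVlt; apply/orP; left; apply/eqP; apply: eq_Ex => x; congr `|_|.
by field; exact: lt0r_neq0.
Qed.

Definition enD f K := \sum_(k < K) N2 (Dh k f).

Lemma enD_ge0 f K : 0 <= enD f K.
Proof. by apply: sumr_ge0 => k _; exact: N2_ge0. Qed.

Lemma enD_mono f m n : (m <= n)%N -> enD f m <= enD f n.
Proof.
move=> /subnKC <-; elim: (n - m)%N => [|j IH]; first by rewrite addn0.
by rewrite addnS (le_trans IH)// /enD big_ord_recr/= lerDl N2_ge0.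
Qed.

Lemma level_Dh0 n g k : level n g -> (n <= k)%N -> Dh k g = fun=> 0.
Proof.
move=> gn nk; apply: Dh_free0; apply: (depends_on_free gn) => /=.
by apply/negP; rewrite -leqNgt.
Qed.

Lemma N2_0 : N2 (fun=> 0) = 0.
Proof. by rewrite /N2 Ex_cst expr0n. Qed.

Lemma enD_level n g K : level n g -> (n <= K)%N -> enD g K = enD g n.
Proof.
move=> gn /subnKC <-; elim: (K - n)%N => [|j IH]; first by rewrite addn0.
by rewrite addnS /enD big_ord_recr/= -/(enD g (n + j)) IH (level_Dh0 gn) ?leq_addr// N2_0 addr0.
Qed.

Lemma enD_level_le n g K : level n g -> enD g K <= enD g n.
Proof.
by move=> gn; rewrite -(enD_level gn (leq_addl K n)); apply: enD_mono; exact: leq_addr.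
Qed.

Lemma enD_sub f g K : enD (fun x => f x - g x) K = enD (fun x => g x - f x) K.
Proof. by apply: eq_bigr => k _; rewrite !DhB N2_sub. Qed.

Lemma enDB_le f g h K : L2 f -> L2 g -> L2 h ->
  enD (fun x => f x - h x) K <= 2 * enD (fun x => f x - g x) K + 2 * enD (fun x => g x - h x) K.
Proof.
move=> hf hg hh; rewrite /enD !mulr_sumr -big_split; apply: ler_sum => k _.
by rewrite !DhB; apply: N2B_le; exact: L2_Dh.
Qed.

Lemma enD_parallelogram f g K : L2 f -> L2 g ->
  enD (fun x => f x + g x) K + enD (fun x => f x - g x) K = 2 * enD f K + 2 * enD g K.
Proof.
move=> hf hg; rewrite /enD !mulr_sumr -!big_split; apply: eq_bigr => k _ /=.
by rewrite DhB DhD parallelogram//; exact: L2_Dh.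
Qed.

Lemma enDZ c f K : L2 f -> enD (fun x => c * f x) K = c ^+ 2 * enD f K.
Proof.
by move=> hf; rewrite /enD mulr_sumr; apply: eq_bigr => k _; rewrite DhZ N2Z//; exact: L2_Dh.
Qed.

Lemma enD_N2_le f K : L2 f -> enD f K <= K%:R * N2 f.
Proof.
move=> hf; rewrite /enD mulr_natl -[X in _ *+ X]card_ord -sumr_const.
by apply: ler_sum => k _; exact: N2_Dh_le.
Qed.

(* The energy bound holds for all partial sums, hence for the whole series. *)
Definition domD f := L2 f /\ forall e, 0 < e -> exists g n,
  [/\ level n g, N2 (fun x => g x - f x) <= e & forall K, enD (fun x => g x - f x) K <= e].

Lemma domD_energy f : domD f -> exists C, forall K, enD f K <= C.
Proof.
move=> [hf /(_ 1 ltr01)[g [n [gn _ gf]]]].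
have hg := level_L2 gn; exists (2 * 1 + 2 * enD g n) => K.
have E (u : bits -> R) : enD (fun x => u x - 0) K = enD u K.
  by apply: eq_bigr => k _; congr N2; apply/funext => x; rewrite /Dh !subr0.
rewrite -E (le_trans (enDB_le K hf hg (L2_cst mu 0)))//.
by rewrite lerD// ler_pM2l// ?E ?enD_level_le// enD_sub gf.
Qed.

(** An approximant of level n has zero gradient from coordinate n on, so there the approximation
    error is the energy of f itself. *)
Lemma domD_tail f e : domD f -> 0 < e ->
  exists n, forall m, \sum_(n <= k < n + m) N2 (Dh k f) <= e.
Proof.
move=> [hf H] /H[g [n [gn _ gf]]]; exists n => m.
apply: le_trans (gf (n + m)%N).
rewrite /enD -(big_mkord xpredT (fun k => N2 (Dh k (fun x => g x - f x)))).
rewrite [leRHS](@big_cat_nat _ _ _ n)//= ?leq_addr// -[leLHS]add0r lerD//.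
  by apply: sumr_ge0 => k _; exact: N2_ge0.
rewrite [leLHS]big_nat_cond [leRHS]big_nat_cond le_eqVlt; apply/orP; left; apply/eqP.
apply: eq_bigr => k /andP[/andP[nk _] _].
by rewrite DhB (level_Dh0 gn nk) N2_sub; congr N2; apply/funext => x; rewrite subr0.
Qed.

(** * Lipschitz functions of elements of the domain *)

Section lipschitz.
Variables (l : R -> R) (C : R).
Hypothesis lC : forall x y, `|l x - l y| <= C * `|x - y|.

Let C0 : 0 <= C.
Proof. by have := lC 1 0; rewrite subr0 normr1 mulr1; apply: le_trans. Qed.

Lemma lip_measurable f : measurable_fun setT f -> measurable_fun setT (fun x => l (f x)).
Proof.
move=> mf; apply: measurableT_comp => //; apply: continuous_measurable_fun.
exact: lipschitz_continuous lC.
Qed.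

Lemma L2_lip f : L2 f -> L2 (fun x => l (f x)).
Proof.
move=> hf; apply: (@L2_le _ _ _ _ _ (fun x => `|l 0| + C * `|f x|)).
- by apply: lip_measurable; case: hf.
- by apply: L2D; [exact: L2_cst|apply: L2Z; exact: L2_norm].
move=> x; rewrite [leRHS]ger0_norm ?addr_ge0 ?mulr_ge0//.
rewrite -[X in `|X|](subrK (l 0)) (le_trans (ler_normD _ _))// addrC lerD2l.
by have := lC (f x) 0; rewrite subr0.
Qed.

Lemma N2_lip_sub f g : L2 f -> L2 g ->
  N2 (fun x => l (g x) - l (f x)) <= C ^+ 2 * N2 (fun x => g x - f x).
Proof.
move=> hf hg; rewrite -N2Z; last exact: L2B.
apply: N2_le; [by apply: L2B; exact: L2_lip|by apply: L2Z; exact: L2B|].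
by move=> x; rewrite normrM (ger0_norm C0).
Qed.

Lemma Dh_lip f k x : `|Dh k (fun y => l (f y)) x| <= C * `|Dh k f x|.
Proof.
by rewrite /Dh !normrM mulrCA ler_wpM2l// (ger0_norm (ltW (spq_gt0 k))).
Qed.

Lemma N2_Dh_lip f k : L2 f -> N2 (Dh k (fun x => l (f x))) <= C ^+ 2 * N2 (Dh k f).
Proof.
move=> hf; rewrite -N2Z; last exact: L2_Dh.
apply: N2_le; [by apply: L2_Dh; exact: L2_lip|by apply: L2Z; exact: L2_Dh|].
by move=> x; rewrite [leRHS]normrM (ger0_norm C0); exact: Dh_lip.
Qed.

(** The gradient of l(g) - l(f) is not dominated by that of g - f. On the first n0 coordinates each
    gradient is bounded by the L^2 norm of l(g) - l(f), which is small; beyond n0 the gradients of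
    l(g) and l(f) are bounded separately by those of g and f, whose tails are small. *)
Lemma domD_lip f : domD f -> domD (fun x => l (f x)).
Proof.
move=> df; have [hf H] := df; split; first exact: L2_lip.
move=> e e0.
have D0 : 0 < C ^+ 2 + 1 by rewrite ltr_wpDl ?sqr_ge0.
(* The tail will cost 4 C^2 e2 + 6 C^2 e1 <= 10 C^2 e1, at most e/2. The second term in the minimum
   [e2] lets the n0 initial coordinates cost at most the other half. *)
pose e1 := e / (20 * (C ^+ 2 + 1)).
have e10 : 0 < e1 by rewrite divr_gt0// mulr_gt0.
have [n0 tail] := domD_tail df e10.
pose e2 := Num.min e1 (e / (2 * (n0.+1%:R * (C ^+ 2 + 1)))).
have e20 : 0 < e2 by rewrite lt_min e10/= divr_gt0// !mulr_gt0.
have e2e1 : e2 <= e1 by rewrite ge_min lexx.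
have [g [n [gn gf1 gf2]]] := H _ e20.
have hg := level_L2 gn.
have hlf := L2_lip hf; have hlg := L2_lip hg.
have CC : C ^+ 2 <= C ^+ 2 + 1 by rewrite lerDl.
have e1E : e1 * (20 * (C ^+ 2 + 1)) = e by rewrite divfK// mulf_neq0// lt0r_neq0.
have e2E : e2 * (n0.+1%:R * (C ^+ 2 + 1)) <= e / 2.
  have : e2 <= e / (2 * (n0.+1%:R * (C ^+ 2 + 1))) by rewrite ge_min lexx orbT.
  by rewrite ler_pdivlMr ?mulr_gt0// mulrCA ler_pdivlMr// mulrC.
have Nu : N2 (fun x => l (g x) - l (f x)) <= C ^+ 2 * e2.
  by rewrite (le_trans (N2_lip_sub hf hg))// ler_wpM2l ?sqr_ge0.
exists (fun x => l (g x)), n; split.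
- by move=> x y xy; rewrite (gn x y xy).
- rewrite (le_trans Nu)// (@le_trans _ _ ((C ^+ 2 + 1) * e1))//.
    by rewrite ler_pM ?sqr_ge0 ?(ltW e20).
  by rewrite -e1E mulrC mulrCA ler_peMl ?ler1n// mulr_ge0 ?ltW.
move=> K; rewrite (le_trans (enD_mono _ (leq_addl n0 K)))//.
set u := fun x => l (g x) - l (f x).
have hu : L2 u by exact: L2B.
have part1 : enD u n0 <= e / 2.
  rewrite (le_trans (enD_N2_le n0 hu))// (le_trans _ e2E)// [leRHS]mulrC -[leRHS]mulrA.
  rewrite ler_pM// ?N2_ge0 ?ler_nat//.
  by rewrite (le_trans Nu)// ler_wpM2r// ltW.
have b k : N2 (Dh k u) <= 4 * C ^+ 2 * N2 (Dh k (fun x => g x - f x)) + 6 * C ^+ 2 * N2 (Dh k f).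
  have h1 : N2 (Dh k u) <= 2 * N2 (Dh k (fun x => l (g x))) + 2 * N2 (Dh k (fun x => l (f x))).
    rewrite DhB -[X in _ + 2 * X]N2N; apply: N2D_le; first exact: L2_Dh.
    by apply: L2N; exact: L2_Dh.
  have h2 : N2 (Dh k g) <= 2 * N2 (Dh k (fun x => g x - f x)) + 2 * N2 (Dh k f).
    rewrite DhB; have := N2D_le (L2B (L2_Dh k hg) (L2_Dh k hf)) (L2_Dh k hf).
    by congr (N2 _ <= _); apply/funext => x; rewrite subrK.
  have h3 := N2_Dh_lip k hf; have h4 := N2_Dh_lip k hg.
  have h5 : C ^+ 2 * N2 (Dh k g) <= C ^+ 2 * (2 * N2 (Dh k (fun x => g x - f x)) + 2 * N2 (Dh k f)).
    by rewrite ler_wpM2l ?sqr_ge0.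
  lra.
have part2 : \sum_(n0 <= k < n0 + K) N2 (Dh k u) <= e / 2.
  apply: (@le_trans _ _ (4 * C ^+ 2 * e2 + 6 * C ^+ 2 * e1)).
    apply: (@le_trans _ _ (\sum_(n0 <= k < n0 + K) (4 * C ^+ 2 * N2 (Dh k (fun x => g x - f x)) + 6 * C ^+ 2 * N2 (Dh k f)))).
      by apply: ler_sum => k _; exact: b.
    rewrite big_split/= -!mulr_sumr lerD// ler_wpM2l ?mulr_ge0 ?sqr_ge0//.
    apply: le_trans (gf2 (n0 + K)%N).
    rewrite /enD -(big_mkord xpredT (fun k => N2 (Dh k (fun x => g x - f x)))).
    rewrite [leRHS](@big_cat_nat _ _ _ n0)//= ?leq_addr// lerDr.
    by apply: sumr_ge0 => k _; exact: N2_ge0.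
  have : C ^+ 2 * e2 <= C ^+ 2 * e1 by rewrite ler_wpM2l ?sqr_ge0.
  by rewrite -e1E; have := mulr_ge0 (sqr_ge0 C) (ltW e10); lra.
have -> : enD u (n0 + K) = enD u n0 + \sum_(n0 <= k < n0 + K) N2 (Dh k u).
  rewrite /enD -(big_mkord xpredT (fun k => N2 (Dh k u))).
  by rewrite (@big_cat_nat _ _ _ n0)//= ?leq_addr// big_mkord.
by rewrite [leRHS](splitr e) lerD.
Qed.

End lipschitz.

(** A cylindrical approximant is fixed by [Ege n] for large n, and [Ege n] is an L^2 contraction. *)
Lemma Ege_cvg f e : domD f -> 0 < e ->
  exists n0, forall n, (n0 <= n)%N -> N2 (fun x => Ege n f x - f x) <= e.
Proof.
move=> [hf H] e0; have e40 : 0 < e / 4 by rewrite divr_gt0.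
have [g [n0 [gn gf _]]] := H _ e40; have hg := level_L2 gn.
exists n0 => n n0n.
have gn' : level n g by apply: depends_on_sub gn => j /= /leq_trans; exact.
have H2 := N2B_le (L2_Ege n f) hg hf; apply: (le_trans H2).
rewrite (_ : (fun x => Ege n f x - g x) = Ege n (fun x => f x - g x)); last first.
  by apply/funext => x; rewrite EgeB ?(Ege_id gn')//; exact: L2_L1.
have := N2_Ege_le n (L2B hf hg); rewrite N2_sub => h1.
have : N2 (Ege n (fun x => f x - g x)) <= e / 4 by exact: le_trans h1 gf.
lra.
Qed.

(** By [EgeS] and [Ex_Ym_mul] the partial sums telescope to E[E[f | F_n] phi]; the initial term
    vanishes because f is centered. *)
Theorem clark_ocone f phi : domD f -> Ex f = 0 -> L2 phi ->
  series (fun k => Ex (fun x => Ege k (Dh k f) x * Dh k phi x)) n @[n --> \oo] -->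
    Ex (fun x => f x * phi x).
Proof.
move=> df f0 hphi; have hf := proj1 df.
have part n : series (fun k => Ex (fun x => Ege k (Dh k f) x * Dh k phi x)) n =
    Ex (fun x => Ege n f x * phi x).
  elim: n => [|n IH].
    rewrite series_sumE big_ord0 (eq_Ex mu (g := fun x => 0 * phi x)).
      by rewrite ExZ ?mul0r//; exact: L2_L1.
    by move=> x; rewrite Ege0 f0.
  move: IH; rewrite !series_sumE big_ord_recr/= => ->; rewrite -Ex_Ym_mul; last 2 first.
  - exact: Ege_free.
  - by apply: L2_mul => //; exact: L2_Ege.
  rewrite -ExD.
  - apply: eq_Ex => x; rewrite mulrA -EgeS; last exact: L2_L1.
    by rewrite -mulrDl addrC subrK.
  - by apply: L2_mul => //; exact: L2_Ege.
  - by apply: L1_Ym; apply: L2_mul => //; exact: L2_Ege.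
apply/cvgrPdist_le => /= e e0.
have N0 : 0 < N2 phi + 1 by rewrite ltr_wpDl ?N2_ge0.
have [|n0' H'] := @Ege_cvg _ (e ^+ 2 / (N2 phi + 1)) df; first by rewrite divr_gt0// exprn_gt0.
exists n0' => // n /= n0n; rewrite part distrC -ExB; [|by apply: L2_mul => //; exact: L2_Ege|exact: L2_mul].
rewrite (@eq_Ex _ _ _ _ _ (fun x => (Ege n f x - f x) * phi x)); last by move=> x; rewrite mulrBl.
have hE := L2B (L2_Ege n f) hf.
rewrite -(@ler_pXn2r _ 2) ?nnegrE ?(ltW e0)// -normrX ger0_norm ?sqr_ge0//.
rewrite (le_trans (cauchy_schwarz hE hphi))//.
rewrite (@le_trans _ _ (e ^+ 2 / (N2 phi + 1) * (N2 phi + 1)))//.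
  by rewrite ler_pM ?N2_ge0 ?H'// lerDl.
by rewrite divfK// lt0r_neq0.
Qed.

Lemma le0_of_null_sequence (e : nat -> R) C x : e n @[n --> \oo] --> (0 : R) ->
  (\forall n \near \oo, - (C * e n) <= x) -> 0 <= x.
Proof.
move=> e0 H.
have c : - (C * e n) @[n --> \oo] --> - (C * 0) by apply: cvgN; apply: cvgM => //; exact: cvg_cst.
rewrite mulr0 oppr0 in c.
rewrite -(cvg_lim (@Rhausdorff R) c); apply: limr_le => //.
by apply/cvg_ex; exists 0.
Qed.

(** * Inverse of the generator by energy minimization *)

Section inverse.
Variable f : bits -> R.
Hypotheses (df : domD f) (f0 : Ex f = 0).

Let hf : L2 f := proj1 df.

(* The inverse is the minimizer of [J]; by the parallelogram identity a minimizing
   sequence is Cauchy in energy, hence in L^2 by [efron_stein]. *)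
Let J n v := enD v n / 2 + Ex (fun x => f x * v x).

Let S := [set r | exists v n, [/\ level n v, Ex v = 0 & r = J n v]].

Let S0 : S !=set0.
Proof.
exists (J 0 (fun=> 0)), (fun=> 0), 0%N; split => //; exact: Ex_cst.
Qed.

Let S_lb r : S r -> - (N2 f / 2) <= r.
Proof.
move=> [v [n [vn v0 ->]]]; have hv := level_L2 vn.
have := efron_stein vn; rewrite v0 expr0n/= add0r -/(enD v n) => P.
have := Ex_mul_weighted ltr01 hf hv; rewrite mul1r divr1 ler_norml => /andP[A _].
rewrite /J; lra.
Qed.

Let m := inf S.
Let S_inf : has_inf S.
Proof. by split; [exact: S0|exists (- (N2 f / 2)) => r; exact: S_lb]. Qed.

Let m_le n v : level n v -> Ex v = 0 -> m <= J n v.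
Proof. by move=> vn v0; apply: ge_inf; [case: S_inf|exists v, n]. Qed.

Let e (n : nat) : R := 4 * 2^-1 ^+ n.

Let e_gt0 n : 0 < e n. Proof. by rewrite mulr_gt0// exprn_gt0// invr_gt0. Qed.

(** The factor 16 is fitted to the parallelogram identity, which bounds the energy of u_j - u_i by 4
    (eps_i + eps_j) <= 8 eps_i = e_i^2 / 2 for i <= j. *)
Let eps n := e n ^+ 2 / 16.
Let eps_gt0 n : 0 < eps n. Proof. by rewrite divr_gt0// exprn_gt0. Qed.

Let J_mono n n' v : level n v -> (n <= n')%N -> J n' v = J n v.
Proof. by move=> vn nn; rewrite /J (enD_level vn nn). Qed.

Let e_noninc i j : (i <= j)%N -> e j <= e i.
Proof.
by move=> ij; rewrite ler_pM2l// ler_wiXn2l// ?invr_ge0// invf_le1// ler1n.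
Qed.

Let e_cvg : e n @[n --> \oo] --> (0 : R).
Proof.
by apply: (@cvg_geometric _ 4 2^-1); rewrite ger0_norm ?invr_ge0// invf_lt1// ltr1n.
Qed.

Let min_seq : {u : nat -> bits -> R & forall i, exists n,
  [/\ level n (u i), Ex (u i) = 0 & J n (u i) <= m + eps i]}.
Proof.
apply: (@choice _ _ (fun i (u : bits -> R) => exists n, [/\ level n u, Ex u = 0 & J n u <= m + eps i])) => i.
have [_ [v [n [vn v0 ->]]] H] := inf_adherent (eps_gt0 i) S_inf.
by exists v, n; split=> //; exact: ltW.
Qed.

(** The limit relation is the Euler-Lagrange equation of [J], that is the weak form of L h = f. It
    is obtained for cylindrical phi and extended to [domD] by approximation. *)
Lemma pregenerator_inverse : exists h, [/\ domD h, Ex h = 0 &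
  forall phi, domD phi ->
   series (fun k => Ex (fun x => Dh k phi x * Dh k h x)) n @[n --> \oo] -->
     - Ex (fun x => phi x * f x)].
Proof.
have [u uP] := min_seq.
have hu i : L2 (u i) by have [n [un _ _]] := uP i; exact: level_L2 un.
have u0 i : Ex (u i) = 0 by have [n [_ ? _]] := uP i.
have lev2 i j : exists n, [/\ level n (u i), level n (u j), J n (u i) <= m + eps i & J n (u j) <= m + eps j].
  have [n [un _ Jn]] := uP i; have [n' [un' _ Jn']] := uP j.
  have l1 : level (n + n') (u i) by apply: depends_on_sub un => a /= H; rewrite ltn_addr.
  have l2 : level (n + n') (u j) by apply: depends_on_sub un' => a /= H; rewrite ltn_addl.
  exists (n + n')%N; split => //; first by rewrite (J_mono un) ?leq_addr.
  by rewrite (J_mono un') ?leq_addl.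
have cauchyD i j : (i <= j)%N -> forall K, enD (fun x => u j x - u i x) K <= e i ^+ 2 / 2.
  move=> ij K; have [n [l1 l2 J1 J2]] := lev2 i j.
  have lB : level n (fun x => u j x - u i x) by move=> x y xy; rewrite (l1 x y xy) (l2 x y xy).
  (* The midpoint of two almost minimizers is admissible, so its value of [J] is at least the
     infimum. *)
  have lD : level n (fun x => 2^-1 * (u j x + u i x)) by move=> x y xy; rewrite (l1 x y xy) (l2 x y xy).
  rewrite (le_trans (enD_level_le K lB))//.
  have := m_le lD; rewrite ExZ ?ExD ?u0 ?addr0 ?mulr0; try exact: L2_L1; last first.
    by apply: L1D; exact: L2_L1.
  move=> /(_ erefl); rewrite /J enDZ; last exact: L2D.
  rewrite (_ : Ex _ = (Ex (fun x => f x * u j x) + Ex (fun x => f x * u i x)) / 2); last first.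
    rewrite -ExD; [|exact: L2_mul|exact: L2_mul].
    rewrite mulrC -ExZ; last by apply: L1D; exact: L2_mul.
    by apply: eq_Ex => x; ring.
  have := enD_parallelogram n (hu j) (hu i).
  have ee : eps j <= eps i.
    rewrite ler_pM2r ?invr_gt0//; have := e_noninc ij; have := e_gt0 j; have := e_gt0 i.
    by move=> i0 j0 h; rewrite lerXn2r// nnegrE ltW.
  move: J1 J2; rewrite /J exprVn.
  rewrite (_ : e i ^+ 2 = eps i * 16); last by rewrite /eps divfK.
  by lra.
(* The difference is centered, so [efron_stein] bounds its L^2 norm by its energy. *)
have cauchy i j : (i <= j)%N -> N2 (fun x => u j x - u i x) <= e i ^+ 2.
  move=> ij; have [n [l1 l2 _ _]] := lev2 i j.
  have lB : level n (fun x => u j x - u i x) by move=> x y xy; rewrite (l1 x y xy) (l2 x y xy).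
  have := efron_stein lB; rewrite ExB ?u0 ?subrr ?expr0n/= ?add0r; try exact: L2_L1.
  move=> /le_trans; apply; have := cauchyD _ _ ij n; rewrite /enD; move/le_trans; apply.
  by have := sqr_ge0 (e i); lra.
have es : cvgn (series e).
  by apply: (@is_cvg_geometric_series _ 4 2^-1); rewrite ger0_norm ?invr_ge0// invf_lt1// ltr1n.
have [h [hh uh]] := L2_complete hu cauchy (fun n => ltW (e_gt0 n)) es.
(* For fixed K the partial energy is continuous in L^2, so the Cauchy bound passes to the limit; its
   factor 1/2 cancels the 2 of [enDB_le]. *)
have uhD n K : enD (fun x => u n x - h x) K <= e n ^+ 2.
  rewrite -subr_ge0; apply: (@le0_of_null_sequence (fun i => e i ^+ 2) (2 * K%:R)).
    by rewrite -[X in _ --> X](mulr0 (0 : R)); apply: cvgM; exact: e_cvg.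
  exists n => // i /= ni.
  have := enDB_le K (hu n) (hu i) hh.
  have := cauchyD _ _ ni K; rewrite enD_sub.
  have := enD_N2_le K (L2B (hu i) hh).
  have : K%:R * N2 (fun x => u i x - h x) <= K%:R * e i ^+ 2 by rewrite ler_wpM2l.
  lra.
have e2_cvg : e n ^+ 2 @[n --> \oo] --> (0 : R).
  by rewrite -[X in _ --> X](mulr0 (0 : R)); apply: cvgM; exact: e_cvg.
have dh : domD h.
  split=> // t t0.
  have [i _ iP] : \forall i \near \oo, e i ^+ 2 <= t.
    move/cvgrPdist_le : e2_cvg => /(_ _ t0); apply: filterS => i.
    by rewrite sub0r normrN ger0_norm ?sqr_ge0.
  have [n [un _ _]] := uP i.
  exists (u i), n; split=> //; first by rewrite (le_trans (uh i))// iP/=.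
  by move=> K; rewrite (le_trans (uhD i K))// iP/=.
have h0 : Ex h = 0.
  apply/eqP; rewrite -sqrf_eq0 eq_le sqr_ge0 andbT -oppr_ge0.
  apply: (@le0_of_null_sequence _ 1 _ e2_cvg); apply: nearW => i.
  rewrite mul1r lerN2.
  have : Ex h = - Ex (fun x => u i x - h x).
    by rewrite ExB ?u0 ?sub0r ?opprK//; exact: L2_L1.
  move=> ->; rewrite sqrrN (le_trans _ (uh i))//.
  by apply: Ex_sqr_le; exact: L2B.
have var v n : level n v -> Ex v = 0 ->
    \sum_(k < n) Ex (fun x => Dh k v x * Dh k h x) + Ex (fun x => f x * v x) = 0.
  move=> vn v0; have hv := level_L2 vn.
  set a := _ + _; pose b := enD v n / 2.
  have b0 : 0 <= b by rewrite divr_ge0// enD_ge0.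
  (* J(u_i + t v) >= m >= J(u_i) - eps_i, while J(u_i + t v) - J(u_i) is t times the first variation
     at u_i plus t^2 b. Let i tend to infinity. *)
  have key t : 0 <= t * a + t ^+ 2 * b.
    pose c := n%:R * (N2 v + 1).
    apply: (@le0_of_null_sequence e (1 + `|t| * c)) => //; apply: nearW => i.
    have [n' [un' _ Jn']] := uP i.
    pose N := (n + n')%N.
    have vN : level N v by apply: depends_on_sub vn => ? /= ?; rewrite ltn_addr.
    have uN : level N (u i) by apply: depends_on_sub un' => ? /= ?; rewrite ltn_addl.
    have wN : level N (fun x => u i x + t * v x) by move=> x y xy; rewrite (vN x y xy) (uN x y xy).
    have := m_le wN; rewrite ExD ?ExZ ?u0 ?v0 ?mulr0 ?addr0; try exact: L2_L1; last first.
      by apply: L1Z; exact: L2_L1.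
    move=> /(_ erefl) mJ.
    have JuN : J N (u i) <= m + eps i by rewrite (J_mono un') ?leq_addl.
    have EJ : J N (fun x => u i x + t * v x) = J N (u i) + t *
       (\sum_(k < n) Ex (fun x => Dh k v x * Dh k (u i) x) + Ex (fun x => f x * v x)) + t ^+ 2 * b.
      rewrite /J (_ : enD (fun x => u i x + t * v x) N = enD (u i) N + 2 * t *
        (\sum_(k < N) Ex (fun x => Dh k v x * Dh k (u i) x)) + t ^+ 2 * enD v N); last first.
        rewrite /enD !mulr_sumr -!big_split/=; apply: eq_bigr => k _.
        rewrite DhD DhZ (N2D (L2_Dh k (hu i)) (L2Z t (L2_Dh k hv))) (N2Z t (L2_Dh k hv)).
        congr (_ + _ + _); rewrite -mulrA; congr (2 * _).
        rewrite -ExZ; last by apply: L2_mul; exact: L2_Dh.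
        by apply: eq_Ex => x; ring.
      rewrite (_ : \sum_(k < N) Ex (fun x => Dh k v x * Dh k (u i) x) =
         \sum_(k < n) Ex (fun x => Dh k v x * Dh k (u i) x)); last first.
        rewrite -(big_mkord xpredT (fun k => Ex (fun x => Dh k v x * Dh k (u i) x))).
        rewrite (@big_cat_nat _ _ _ n)//= ?leq_addr// big_mkord [X in _ + X]big_nat_cond.
        rewrite [X in _ + X]big1 ?addr0// => k /andP[/andP[nk _] _].
        rewrite (level_Dh0 vn nk) -[RHS](Ex_cst mu 0); apply: eq_Ex => x; by rewrite mul0r.
      rewrite (enD_level vn (leq_addr n' n)).
      rewrite (_ : Ex (fun x => f x * (u i x + t * v x)) = Ex (fun x => f x * u i x) + t * Ex (fun x => f x * v x)).
        by rewrite /b; field.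
      rewrite -ExZ; last exact: L2_mul.
      rewrite -ExD; [|exact: L2_mul|by apply: L1Z; exact: L2_mul].
      by apply: eq_Ex => x; ring.
    have dif : `|\sum_(k < n) Ex (fun x => Dh k v x * Dh k (u i) x) -
                \sum_(k < n) Ex (fun x => Dh k v x * Dh k h x)| <= c * e i.
      rewrite -sumrB /c mulrAC -mulrA -[n%:R]/(n%:R) (le_trans (ler_norm_sum _ _ _))//.
      rewrite mulr_natl -[X in _ *+ X]card_ord -sumr_const; apply: ler_sum => k _.
      rewrite -ExB; [|by apply: L2_mul; exact: L2_Dh..].
      rewrite (@eq_Ex _ _ _ _ _ (fun x => Dh k v x * Dh k (fun y => u i y - h y) x)); last first.
        by move=> x; rewrite DhB mulrBr.
      have hd := L2_Dh k (L2B (hu i) hh).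
      have := Ex_mul_weighted (e_gt0 i) (L2_Dh k hv) hd; move/le_trans; apply.
      have h1 : N2 (Dh k (fun y => u i y - h y)) / e i <= e i.
        rewrite ler_pdivrMr// -expr2 (le_trans (N2_Dh_le k (L2B (hu i) hh)))//.
      have h2 : e i * N2 (Dh k v) <= e i * N2 v by rewrite ler_pM2l// N2_Dh_le.
      have := e_gt0 i; have := mulr_ge0 (ltW (e_gt0 i)) (N2_ge0 mu v); lra.
    have ei : eps i <= e i.
      have e4 : e i <= 4.
        have := e_noninc (leq0n i); rewrite {2}/e expr0 mulr1; exact.
      by rewrite /eps ler_pdivrMr// expr2 ler_pM2l// (le_trans e4)// ler_nat.
    move: mJ; rewrite EJ /a.
    set A := \sum_(k < n) Ex (fun x => Dh k v x * Dh k (u i) x) in dif *.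
    set B := \sum_(k < n) Ex (fun x => Dh k v x * Dh k h x) in dif *.
    have tAB : t * A <= t * B + `|t| * (c * e i).
      rewrite -lerBlDl -mulrBr (le_trans (ler_norm _))// normrM ler_wpM2l//.
    have EE : (1 + `|t| * c) * e i = e i + `|t| * (c * e i) by ring.
    rewrite EE; lra.
  have [//|a0] := eqVneq a 0.
  have D0 : 0 < 2 * (b + 1) by rewrite mulr_gt0// ltr_wpDl.
  (* Nearly the minimizer -a/(2b) of t a + t^2 b, with b + 1 for b to exclude a zero denominator;
     the value there is negative unless a = 0. *)
  have := key (- a / (2 * (b + 1))).
  rewrite (_ : _ + _ = - (a ^+ 2 * (b + 2)) / (2 * (b + 1)) ^+ 2); last by field; lra.
  have : 0 < a ^+ 2 * (b + 2) / (2 * (b + 1)) ^+ 2.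
    by rewrite divr_gt0 ?exprn_gt0// mulr_gt0 ?exprn_even_gt0//; lra.
  rewrite mulNr; lra.
(* Subtracting the mean changes neither the gradients nor, as f is centered, the expectation of the
   product with f. *)
have var' v n : level n v -> \sum_(k < n) Ex (fun x => Dh k v x * Dh k h x) = - Ex (fun x => v x * f x).
  move=> vn; have hv := level_L2 vn.
  have vn' : level n (fun x => v x - Ex v) by move=> x y xy; rewrite (vn x y xy).
  have := var _ _ vn'.
  rewrite ExB ?(Ex_cst mu) ?subrr; try exact: L2_L1; try exact: L1_cst.
  move=> /(_ erefl).
  rewrite (_ : Ex (fun x => f x * (v x - Ex v)) = Ex (fun x => v x * f x)); last first.
    rewrite (@eq_Ex _ _ _ _ _ (fun x => v x * f x - Ex v * f x)); last by move=> x; ring.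
    by rewrite ExB ?ExZ ?f0 ?mulr0 ?subr0//; [exact: L2_L1|exact: L2_mul|apply: L1Z; exact: L2_L1].
  move=> /eqP; rewrite addr_eq0 => /eqP <-; apply: eq_bigr => k _; apply: eq_Ex => x.
  by rewrite DhB (@Dh_free0 k (fun=> Ex v))// subr0.
exists h; split=> // phi dphi; have hphi := proj1 dphi.
have [C hC] := domD_energy dh.
have C0 : 0 <= C by have := hC 0%N; apply: le_trans; exact: enD_ge0.
apply/cvgrPdist_le => /= t t0.
(* Weight for Young's inequality: the bounded quantities C and [N2 f] get divided by s and
   contribute at most t/2, the approximation errors t/(2s) get multiplied by s and contribute the
   other t/2. *)
pose s := (C + N2 f + 1) / t.
have s0 : 0 < s by rewrite divr_gt0// ltr_wpDl// addr_ge0// N2_ge0.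
have [v [n [vn vphi vphiD]]] := (proj2 dphi) (t / (2 * s)) (divr_gt0 t0 (mulr_gt0 (ltr0Sn _ 1) s0)).
have hv := level_L2 vn.
exists n => // K /= nK.
rewrite series_sumE.
have vK : \sum_(k < K) Ex (fun x => Dh k v x * Dh k h x) = - Ex (fun x => v x * f x).
  by apply: var'; apply: depends_on_sub vn => j /= /leq_trans; exact.
rewrite (_ : _ - _ = Ex (fun x => (v x - phi x) * f x) +
   \sum_(k < K) Ex (fun x => Dh k (fun y => v y - phi y) x * Dh k h x)); last first.
  rewrite (@eq_Ex _ _ _ _ (fun x => (v x - phi x) * f x) (fun x => v x * f x - phi x * f x)); last by move=> x; ring.
  rewrite ExB; [|exact: L2_mul|exact: L2_mul].
  have -> : \sum_(k < K) Ex (fun x => Dh k (fun y => v y - phi y) x * Dh k h x) =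
      \sum_(k < K) Ex (fun x => Dh k v x * Dh k h x) - \sum_(k < K) Ex (fun x => Dh k phi x * Dh k h x).
    rewrite -sumrB; apply: eq_bigr => k _; rewrite -ExB; [|by apply: L2_mul; exact: L2_Dh..].
    by apply: eq_Ex => x; rewrite DhB mulrBl.
  by rewrite vK; ring.
rewrite (le_trans (ler_normD _ _))//.
have hvp := L2B hv hphi.
have h1 := Ex_mul_weighted s0 hvp hf.
have h2 : `|\sum_(k < K) Ex (fun x => Dh k (fun y => v y - phi y) x * Dh k h x)|
   <= (s * (t / (2 * s)) + C / s) / 2.
  apply: (@le_trans _ _ ((s * enD (fun y => v y - phi y) K + enD h K / s) / 2)).
    rewrite (le_trans (ler_norm_sum _ _ _))// /enD mulr_sumr [X in _ + X]mulr_suml -big_split mulr_suml.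
    by apply: ler_sum => k _; apply: Ex_mul_weighted => //; exact: L2_Dh.
  rewrite ler_pM2r ?invr_gt0// lerD//; first by rewrite ler_pM2l.
  by rewrite ler_pM2r ?invr_gt0.
have h3 : s * N2 (fun x => v x - phi x) <= s * (t / (2 * s)) by rewrite ler_pM2l.
have E1 : s * (t / (2 * s)) = t / 2 by field; exact: lt0r_neq0.
have E2 : (C + N2 f) / s <= t.
  rewrite ler_pdivrMr// /s mulrC divfK ?lt0r_neq0//; lra.
rewrite mulrDl in E2.
move: h1 h2 h3; rewrite E1; lra.
Qed.

End inverse.

(** * Malliavin-Stein bounds for functions of bits *)

Section malliavin_stein.
Variables (f : bits -> R) (v : nat -> bits -> R) (Cv : R).
Hypotheses (df : domD f) (vfree : forall k, free_of k (v k)) (vL2 : forall k, L2 (v k)).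
Hypothesis venergy : forall K, \sum_(k < K) N2 (v k) <= Cv.
Hypothesis ibp : forall phi, domD phi ->
  series (fun k => Ex (fun x => v k x * Dh k phi x)) n @[n --> \oo] -->
    Ex (fun x => f x * phi x).

Let hf : L2 f := proj1 df.
Let mf : measurable_fun setT f := L2_meas hf.

Let vD_L1 k : L1 (fun x => v k x * Dh k f x).
Proof. by apply: L2_mul => //; exact: L2_Dh. Qed.

Let vD_free k : free_of k (fun x => v k x * Dh k f x).
Proof. by move=> b x; rewrite vfree Dh_free. Qed.

(** Follows from the finiteness of both energies; this absolute summability underlies the
    convergence of the series with Y_k^2 and with Y_k. *)
Let vD_sum : exists C, forall n, \sum_(k < n) Ex (fun x => `|v k x * Dh k f x|) <= C.
Proof.
have [C hC] := domD_energy df; exists ((Cv + C) / 2) => n.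
apply: (@le_trans _ _ (\sum_(k < n) (N2 (v k) + N2 (Dh k f)) / 2)).
  by apply: ler_sum => k _; apply: Ex_norm_mul_le => //; exact: L2_Dh.
by rewrite -mulr_suml ler_pM2r ?invr_gt0// big_split/= lerD//; [exact: venergy|exact: hC].
Qed.

Let u k x := v k x * Dh k f x * Ym k x ^+ 2.

Let u_L1 k : L1 (u k).
Proof.
rewrite (_ : u k = fun x => Ym k x * (Ym k x * (v k x * Dh k f x))).
  by apply: L1_Ym; apply: L1_Ym.
by apply/funext => x; rewrite /u; ring.
Qed.

(** Y_k^2 has mean one, and the other factors ignore coordinate k. *)
Let Ex_norm_u k : Ex (fun x => `|u k x|) = Ex (fun x => `|v k x * Dh k f x|).
Proof.
rewrite -[RHS](@Ex_Ym2 k); last exact: L1_norm.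
  by apply: eq_Ex => x; rewrite /u normrM mulrC (ger0_norm (sqr_ge0 _)).
by move=> b x; rewrite vfree Dh_free.
Qed.

Let u_series : exists S : bits -> R, [/\ L1 S,
    (\forall x \ae mu, series (u ^~ x) n @[n --> \oo] --> S x) &
    forall (m : bits -> R) (M : R), measurable_fun setT m -> (forall x, `|m x| <= M) ->
     series (fun k => Ex (fun x => m x * u k x)) n @[n --> \oo] --> Ex (fun x => m x * S x)].
Proof.
have [C hC] := vD_sum; apply: (@summable_series _ _ _ mu u C) => // n.
by under eq_bigr do rewrite Ex_norm_u.
Qed.

Section stein_function.
Variables (g g' : R -> R) (C : R).
Hypotheses (glip : forall x y, `|g x - g y| <= C * `|x - y|)
  (g'meas : measurable_fun setT g') (g'bd : forall x, `|g' x| <= C).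

(* The weight of [g' a] is [q k], since Y_k^2 = q/p on {x_k = 1}, of probability p. *)
Definition remainder k x :=
  let a := f (put k true x) in let b := f (put k false x) in
  g a - g b - (a - b) * (q k * g' a + p k * g' b).

Let mg'f b k : measurable_fun setT (fun x => g' (f (put k b x))).
Proof. by apply: (measurableT_comp g'meas); exact: measurable_comp_put. Qed.

Let mg' : measurable_fun setT (fun x => g' (f x)).
Proof. exact: (measurableT_comp g'meas). Qed.

Lemma term_difference k :
  L1 (fun x => v k x * (spq k * remainder k x)) /\
  Ex (fun x => v k x * Dh k (fun y => g (f y)) x) - Ex (fun x => g' (f x) * u k x) =
    Ex (fun x => v k x * (spq k * remainder k x)).
Proof.
have hgf := L2_lip glip hf.
have i1 : L1 (fun x => v k x * Dh k (fun y => g (f y)) x).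
  by apply: L2_mul => //; exact: L2_Dh.
have i2 b : L1 (fun x => g' (f (put k b x)) * (v k x * Dh k f x)).
  exact: L1_bound (vD_L1 k) (mg'f b k) (fun x => g'bd _).
have E : Ex (fun x => g' (f x) * u k x) =
    Ex (fun x => q k * (g' (f (put k true x)) * (v k x * Dh k f x)) +
        p k * (g' (f (put k false x)) * (v k x * Dh k f x))).
  rewrite (Ex_resample k); last exact: L1_bound (u_L1 k) mg' (fun x => g'bd _).
  rewrite ExD; [|exact: L1Z..]; rewrite !ExZ//.
  have F b : Ex ((fun x => g' (f x) * u k x) \o put k b) =
      ((if b then q k else - p k) / spq k) ^+ 2 * Ex (fun x => g' (f (put k b x)) * (v k x * Dh k f x)).
    rewrite -ExZ//; apply: eq_Ex => x /=.
    by rewrite /u Ym_put vfree Dh_free; ring.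
  rewrite !F !expr_div_n spq2 sqrrN; field.
  by rewrite !lt0r_neq0 ?p_gt0 ?q_gt0.
have pt x : v k x * (spq k * remainder k x) = v k x * Dh k (fun y => g (f y)) x -
   (q k * (g' (f (put k true x)) * (v k x * Dh k f x)) + p k * (g' (f (put k false x)) * (v k x * Dh k f x))).
  by rewrite /remainder /Dh; ring.
have i3 : L1 (fun x => q k * (g' (f (put k true x)) * (v k x * Dh k f x)) +
        p k * (g' (f (put k false x)) * (v k x * Dh k f x))).
  by apply: L1D; exact: L1Z.
split; first by rewrite (funext pt); exact: L1B.
by rewrite (eq_Ex mu pt) ExB// E.
Qed.

(** Integration by parts expands E[f g(f)], and the hypothesis on [S] expands E[g'(f) S]. Their
    termwise differences are the remainders, absorbed by [B]; what is left is E[g'(f) (1 - S)]. *)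
Lemma stein_discrepancy S (B : \bar R) : L1 S ->
  (forall (m : bits -> R) (M : R), measurable_fun setT m -> (forall x, `|m x| <= M) ->
     series (fun k => Ex (fun x => m x * u k x)) n @[n --> \oo] --> Ex (fun x => m x * S x)) ->
  (forall K, (\sum_(k < K) Ex (fun x => `|v k x * (spq k * remainder k x)|))%:E <= B)%E ->
  ((`|Ex (fun x => g' (f x)) - Ex (fun x => f x * g (f x))|)%:E
     <= C%:E * 'E_mu[(fun x => `|1 - S x|)%R] + B)%E.
Proof.
move=> iS cS hB.
have C0 : 0 <= C by exact: le_trans (g'bd 0).
have i1 : L1 (fun x => `|1 - S x|) by apply: L1_norm; apply: L1B => //; exact: L1_cst.
rewrite unlock ExE//.
have B0 : (0 <= B)%E by apply: le_trans (hB 0%N); rewrite big_ord0.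
case: B hB B0 => [B| |]// hB _; last by rewrite addey ?leey// -EFinM.
have ig' : L1 (fun x => g' (f x)).
  by apply: (eq_L1 (L1_bound (L1_cst mu 1) mg' (fun x => g'bd _))) => x; rewrite mulr1.
have igS := L1_bound iS mg' (fun x => g'bd _).
have c1 := ibp (domD_lip glip df).
have c2 := cS _ _ mg' (fun x => g'bd _).
have c3 : \sum_(k < n) Ex (fun x => v k x * (spq k * remainder k x)) @[n --> \oo] -->
   Ex (fun x => f x * g (f x)) - Ex (fun x => g' (f x) * S x).
  apply: cvg_trans (cvgB c1 c2); apply: near_eq_cvg; apply: nearW => n.
  rewrite /= !fctE !series_sumE -sumrB; apply: eq_bigr => k _.
  by have [_ ->] := term_difference k.
have h3 : `|Ex (fun x => f x * g (f x)) - Ex (fun x => g' (f x) * S x)| <= B.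
  have c4 : `|\sum_(k < n) Ex (fun x => v k x * (spq k * remainder k x))| @[n --> \oo] -->
     `|Ex (fun x => f x * g (f x)) - Ex (fun x => g' (f x) * S x)| by exact: cvg_norm.
  rewrite -(cvg_lim (@Rhausdorff R) c4); apply: limr_le; first by apply/cvg_ex; eexists; exact: c4.
  apply: nearW => n; rewrite (le_trans (ler_norm_sum _ _ _))// -lee_fin (le_trans _ (hB n))// lee_fin.
  by apply: ler_sum => k _; apply: norm_Ex_le; have [] := term_difference k.
have h4 : `|Ex (fun x => g' (f x)) - Ex (fun x => g' (f x) * S x)| <= C * Ex (fun x => `|1 - S x|).
  rewrite -ExB// -ExZ//; apply: le_trans (norm_Ex_le (L1B ig' igS)) _.
  apply: le_Ex; [exact: L1_norm (L1B ig' igS)|exact: L1Z|].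
  by move=> x; rewrite -[X in X - _]mulr1 -mulrBr normrM ler_wpM2r.
rewrite -EFinM -EFinD lee_fin.
rewrite (_ : _ - _ = (Ex (fun x => g' (f x)) - Ex (fun x => g' (f x) * S x)) -
   (Ex (fun x => f x * g (f x)) - Ex (fun x => g' (f x) * S x))); last by ring.
by rewrite (le_trans (ler_normB _ _))// lerD.
Qed.

End stein_function.

(** [S] is chosen before [h], so that the supremum over test functions can be taken afterwards. The
    coefficient of the squared gradient comes from sqrt(pq) (1 - 2pq) (a - b)^2, since the gradient
    is sqrt(pq) (a - b). *)
Theorem wasserstein_bound : exists S : bits -> R, [/\ L1 S,
  (\forall x \ae mu, series (u ^~ x) n @[n --> \oo] --> S x) &
  forall h, lip1 h ->
  ((`|Ex (fun x => h (f x)) - gtot h|)%:E <=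
     (Num.sqrt (2 / pi))%:E * 'E_mu[(fun x => `|1 - S x|)%R] +
     \sum_(k <oo) ((1 - 2 * p k * q k) / spq k)%:E * 'E_mu[(fun x => `|v k x| * Dh k f x ^+ 2)%R])%E].
Proof.
have [S [iS aS cS]] := u_series; exists S; split=> // h hl.
pose g := stein_sol h; pose g' := stein_der h.
have glip := stein_sol_lip hl; have g'bd := stein_der_bound hl.
have g'meas : measurable_fun setT g'.
  apply: continuous_measurable_fun; exact: lipschitz_continuous (stein_der_lip hl).
have hh : L2 (fun x => h (f x)) by apply: (@L2_lip h 1) => // x y; rewrite mul1r; exact: hl.
have hg : L2 (fun x => g (f x)) by exact: (@L2_lip g _ glip f hf).
have -> : Ex (fun x => h (f x)) - gtot h = Ex (fun x => g' (f x)) - Ex (fun x => f x * g (f x)).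
  have ifg := L2_mul hf hg.
  rewrite (@eq_Ex _ _ _ _ (fun x => g' (f x)) (fun x => f x * g (f x) + (h (f x) - gtot h)))//.
  rewrite ExD ?ExB ?(Ex_cst mu)//; [ring|exact: L2_L1|exact: L1_cst|].
  by apply: L1B; [exact: L2_L1|exact: L1_cst].
apply: (stein_discrepancy glip g'meas g'bd iS cS) => K.
have pos k : (0 <= ((1 - 2 * p k * q k) / spq k)%:E * 'E_mu[(fun x => `|v k x| * Dh k f x ^+ 2)%R])%E.
  have p0 := p_gt0 k; have q0 := q_gt0 k; have pq := pDq k.
  apply: mule_ge0; last by apply: expectation_ge0 => x; rewrite mulr_ge0// sqr_ge0.
  rewrite lee_fin divr_ge0 ?(ltW (spq_gt0 k))//.
  by rewrite onem2pq addr_ge0 ?sqr_ge0.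
apply: le_trans (nneseries_lim_ge K (fun k _ _ => pos k)).
rewrite -sumEFin big_mkord; apply: lee_sum => k _.
have p0 := p_gt0 k; have q0 := q_gt0 k; have pq := pDq k; have s0 := spq_gt0 k.
have [i1 _] := term_difference glip g'meas g'bd k.
have mvD : measurable_fun setT (fun x => `|v k x| * Dh k f x ^+ 2).
  apply: measurable_funM; first by apply: measurableT_comp => //; exact: L2_meas.
  by apply: measurable_funX; apply: L2_meas; exact: L2_Dh.
have c0 : 0 <= (1 - 2 * p k * q k) / spq k.
  rewrite divr_ge0 ?(ltW s0)//.
  by rewrite onem2pq addr_ge0 ?sqr_ge0.
rewrite -ExE; last exact: L1_norm.
rewrite unlock -ge0_integralZl//; last 2 first.
- by apply/measurable_EFinP.
- by move=> x _; rewrite lee_fin mulr_ge0// sqr_ge0.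
apply: ge0_le_integral => //.
- by apply/measurable_EFinP; apply: measurableT_comp => //; exact: L1_meas i1.
- by apply: emeasurable_funM => //; apply/measurable_EFinP.
move=> x _; rewrite -EFinM lee_fin normrM mulrCA ler_wpM2l// normrM (ger0_norm (ltW s0)).
have := stein_remainder hl (f (put k true x)) (f (put k false x)) p0 q0 pq.
rewrite -(ler_pM2l s0) => /le_trans; apply.
rewrite /Dh exprMn le_eqVlt; apply/orP; left; apply/eqP; field; exact: spq_neq0.
Qed.

Let w k x := spq k * (`|v k x| * Dh k f x) * Ym k x.

Let av_free k : free_of k (fun x => `|v k x|).
Proof. by move=> b x; rewrite vfree. Qed.

Let avD_L1 k : L1 (fun x => `|v k x| * Dh k f x).
Proof. by apply: L2_mul; [exact: L2_norm|exact: L2_Dh]. Qed.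

Let w_L1 k : L1 (w k).
Proof.
rewrite (_ : w k = fun x => Ym k x * (spq k * (`|v k x| * Dh k f x))).
  by apply: L1_Ym; apply: L1Z.
by apply/funext => x; rewrite /w; ring.
Qed.

(** E|Y_k| = 2 sqrt(pq), so together with the weight sqrt(pq) it gives the factor 2pq <= 1. *)
Let Ex_norm_w k : Ex (fun x => `|w k x|) <= Ex (fun x => `|v k x * Dh k f x|).
Proof.
have s0 := spq_gt0 k.
have fr : free_of k (fun x => `|v k x * Dh k f x|) by move=> b x; rewrite vfree Dh_free.
have i1 := L1_norm (vD_L1 k).
have mY : measurable_fun setT (fun x => `|Ym k x|).
  by apply: measurableT_comp => //; exact: measurable_Ym.
have Yb x : `| `|Ym k x| | <= Ybd k by rewrite normr_id Ym_bound.
have i2 : L1 (fun x => `|Ym k x| * `|v k x * Dh k f x|) := L1_bound i1 mY Yb.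
have -> : Ex (fun x => `|w k x|) = spq k * Ex (fun x => `|Ym k x| * `|v k x * Dh k f x|).
  rewrite -ExZ//; apply: eq_Ex => x; rewrite /w !normrM (ger0_norm (ltW s0)) normr_id; ring.
rewrite (Ex_resample k i2).
have F b : Ex ((fun x => `|Ym k x| * `|v k x * Dh k f x|) \o put k b) =
    ((if b then q k else p k) / spq k) * Ex (fun x => `|v k x * Dh k f x|).
  rewrite -ExZ//; apply: eq_Ex => x /=; rewrite fr Ym_put normrM; congr (_ * _).
  rewrite (ger0_norm (_ : 0 <= (spq k)^-1)) ?invr_ge0 ?(ltW s0)//; congr (_ / _).
  by case: b; rewrite ?normrN ger0_norm// ltW ?p_gt0 ?q_gt0.
rewrite !F; set E := Ex _.
have E0 : 0 <= E by apply: Ex_ge0.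
rewrite (_ : spq k * (_ + _) = 2 * (p k * q k) * E); last by field; exact: spq_neq0.
rewrite ler_piMl//; have p0 := p_gt0 k; have q0 := q_gt0 k; have := qE k; nra.
Qed.

Let w_series : exists S : bits -> R, [/\ L1 S,
    (\forall x \ae mu, series (w ^~ x) n @[n --> \oo] --> S x) &
    forall (m : bits -> R) (M : R), measurable_fun setT m -> (forall x, `|m x| <= M) ->
     series (fun k => Ex (fun x => m x * w k x)) n @[n --> \oo] --> Ex (fun x => m x * S x)].
Proof.
have [C hC] := vD_sum; apply: (@summable_series _ _ _ mu w C) => // n.
by apply: le_trans (hC n); apply: ler_sum => k _; exact: Ex_norm_w.
Qed.

(** Each remainder term is at most t_k / sqrt(pq), where t_k = E[|v_k| D_k f D_k m(f)] is
    nonnegative by monotonicity of [kmon]. Integration by parts in coordinate k, in the reverse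
    direction, turns sqrt(pq) t_k into E[m(f) w_k], which can be summed over k without taking
    absolute values. *)
Theorem kolmogorov_bound : exists S S' : bits -> R, [/\ L1 S, L1 S',
  (\forall x \ae mu, series (u ^~ x) n @[n --> \oo] --> S x),
  (\forall x \ae mu, series (w ^~ x) n @[n --> \oo] --> S' x) &
  forall z,
  ((`|Ex (fun x => kind z (f x)) - gPhi z|)%:E <=
     'E_mu[(fun x => `|1 - S x|)%R] +
     2%:E * \sum_(k <oo) `|p k - q k|%:E * 'E_mu[(fun x => `|v k x| * `|Dh k f x|)%R] +
     4%:E * 'E_mu[(fun x => `|S' x|)%R])%E].
Proof.
have [S [iS aS cS]] := u_series; have [S' [iS' aS' cS']] := w_series.
exists S, S'; split=> // z.
(* Subtracting the constant [gPhi z] leaves the increments of [kmon] unchanged and makes [m] bounded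
   by 1. *)
pose g := ksol z; pose g' := kder z; pose m x := kmon z x - gPhi z.
have glip x y : `|g x - g y| <= 1 * `|x - y| by rewrite mul1r; exact: ksol_lip.
have g'bd := kder_bound z.
have mg : measurable_fun setT g.
  apply: continuous_measurable_fun; exact: lipschitz_continuous glip.
have mk : measurable_fun setT (kind z).
  rewrite (_ : kind z = \1_`]-oo, z]); first exact: measurable_indic.
  by apply/funext => x; rewrite /kind indicE mem_setE in_itv/=; case: ifP.
have mxg : measurable_fun setT (fun x : R => x * g x) by apply: measurable_funM.
have g'meas : measurable_fun setT g'.
  by apply: measurable_funB => //; apply: measurable_funD.
have mm : measurable_fun setT m.
  by apply: measurable_funB => //; apply: measurable_funD => //; apply: measurable_funB.
have mbd x : `|m x| <= 1 := kmon_bound z x.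
have hg : L2 (fun x => g (f x)) by exact: (@L2_lip g _ glip f hf).
have ik : L1 (fun x => kind z (f x)).
  apply: (L1_le _ (L1_cst mu 1)); first exact: (measurableT_comp mk).
  by move=> x; have /andP[k0 k1] := kind01 z (f x); rewrite ger0_norm.
have -> : Ex (fun x => kind z (f x)) - gPhi z = Ex (fun x => g' (f x)) - Ex (fun x => f x * g (f x)).
  have ifg := L2_mul hf hg.
  rewrite (@eq_Ex _ _ _ _ (fun x => g' (f x)) (fun x => f x * g (f x) + (kind z (f x) - gPhi z))).
    rewrite ExD ?ExB ?(Ex_cst mu)//; [ring|exact: L1_cst|].
    by apply: L1B => //; exact: L1_cst.
  by move=> x; rewrite /g' /kder addrA.
rewrite -[X in (_ <= X + _ + _)%E]mul1e -addeA.
apply: (stein_discrepancy glip g'meas g'bd iS cS) => K.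
have mmf : measurable_fun setT (fun x => m (f x)) := measurableT_comp mm mf.
have mbd' x : `|m (f x)| <= 1 by exact: mbd.
pose t k := Ex (fun x => `|v k x| * Dh k f x * Dh k (fun y => m (f y)) x).
have Dm k : L1 (fun x => `|v k x| * Dh k f x * Dh k (fun y => m (f y)) x) /\
    forall x, `|Dh k (fun y => m (f y)) x| <= spq k * 2.
  have bd x : `|Dh k (fun y => m (f y)) x| <= spq k * 2.
    rewrite /Dh normrM (ger0_norm (ltW (spq_gt0 k))) ler_pM2l ?spq_gt0//.
    by rewrite (le_trans (ler_normB _ _))// -[2]/(1 + 1) lerD.
  split=> //.
  have mD : measurable_fun setT (Dh k (fun y => m (f y))).
    by apply: measurable_funM => //; apply: measurable_funB; exact: (@measurable_comp_put k _ (fun y => m (f y))).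
  have := L1_bound (avD_L1 k) mD bd.
  rewrite (_ : (fun x => Dh k (fun y => m (f y)) x * (`|v k x| * Dh k f x)) =
    fun x => `|v k x| * Dh k f x * Dh k (fun y => m (f y)) x); last by apply/funext => x; rewrite mulrC.
  exact.
have DfDm k x : 0 <= Dh k f x * Dh k (fun y => m (f y)) x.
  rewrite /Dh mulrACA; apply: mulr_ge0; first by rewrite mulr_ge0 ?(ltW (spq_gt0 k)).
  set a := f (put k true x); set b := f (put k false x).
  rewrite (_ : m a - m b = kmon z a - kmon z b); last by rewrite /m; ring.
  have [ab|/ltW ba] := leP a b.
    by rewrite mulr_le0 ?subr_le0// kmon_nondec.
  by rewrite mulr_ge0 ?subr_ge0// kmon_nondec.
have tE k : spq k * t k = Ex (fun x => m (f x) * w k x).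
  rewrite /t -ExZ; last by have [] := Dm k.
  have fr : free_of k (fun x => spq k * (`|v k x| * Dh k f x)).
    by move=> b x; rewrite vfree Dh_free.
  rewrite (@eq_Ex _ _ _ _ (fun x => m (f x) * w k x)
    (fun x => Ym k x * (spq k * (`|v k x| * Dh k f x) * m (f x)))); last first.
    by move=> x; rewrite /w; ring.
  rewrite (@Ex_Ym_mul k _ _ fr).
    by apply: eq_Ex => x; ring.
  by apply: (eq_L1 (L1_bound (L1Z (spq k) (avD_L1 k)) mmf mbd')) => x; rewrite mulrC.
have t0 k : 0 <= t k by apply: Ex_ge0 => x; rewrite -mulrA mulr_ge0.
have key k : Ex (fun x => `|v k x * (spq k * remainder g g' k x)|) <=
    4 * (spq k * t k) + 2 * (`|p k - q k| * Ex (fun x => `|v k x| * `|Dh k f x|)).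
  have p0 := p_gt0 k; have q0 := q_gt0 k; have pq := pDq k; have s0 := spq_gt0 k.
  have [i1 _] := term_difference glip g'meas g'bd k.
  have [i2 bd] := Dm k.
  have i3 : L1 (fun x => `|v k x| * `|Dh k f x|).
    by apply: (eq_L1 (L1_norm (vD_L1 k))) => x; rewrite normrM.
  have h1 : Ex (fun x => `|v k x * (spq k * remainder g g' k x)|) <= t k / spq k.
    rewrite mulrC /t -ExZ//; apply: le_Ex; [exact: L1_norm|exact: L1Z|].
    move=> x; rewrite !normrM (ger0_norm (ltW s0)).
    have rem := ksol_remainder z (f (put k true x)) (f (put k false x)) p0 q0 pq.
    apply: (@le_trans _ _ (`|v k x| * (spq k * ((f (put k true x) - f (put k false x)) *
        (kmon z (f (put k true x)) - kmon z (f (put k false x))))))).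
      by rewrite ler_wpM2l// ler_pM2l.
    rewrite /Dh /m le_eqVlt; apply/orP; left; apply/eqP; field; exact: spq_neq0.
  have h2 : t k <= 2 * spq k * Ex (fun x => `|v k x| * `|Dh k f x|).
    rewrite /t -ExZ//; apply: le_Ex => //; first exact: L1Z.
    move=> x; apply: le_trans (ler_norm _) _.
    have -> : `| `|v k x| * Dh k f x * Dh k (fun y => m (f y)) x| =
        `|v k x| * `|Dh k f x| * `|Dh k (fun y => m (f y)) x|.
      by rewrite (normrM (_ * _)) (normrM `|v k x|) normr_id.
    by rewrite [leRHS]mulrC ler_wpM2l ?mulr_ge0// (le_trans (bd x))// mulrC.
  rewrite (le_trans h1)//.
  have -> : t k / spq k = 4 * (spq k * t k) + (p k - q k) ^+ 2 * (t k / spq k).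
    have e1 : 1 = 4 * (p k * q k) + (p k - q k) ^+ 2 by rewrite (pq1 k); ring.
    rewrite -[LHS]mul1r {1}e1 mulrDl; congr (_ + _).
    by rewrite -spq2; field; exact: spq_neq0.
  rewrite lerD2l.
  (* The crude bound |D_k m(f)| <= 2 sqrt(pq) cancels the factor 1/sqrt(pq), and (p - q)^2 <= |p -
     q|. *)
  apply: (@le_trans _ _ ((p k - q k) ^+ 2 * (2 * Ex (fun x => `|v k x| * `|Dh k f x|)))).
    rewrite ler_wpM2l ?sqr_ge0// ler_pdivrMr// mulrAC; exact: h2.
  rewrite mulrCA ler_pM2l// ler_wpM2r//; first by apply: Ex_ge0 => x; rewrite mulr_ge0.
  rewrite -(real_normK (num_real _)) expr2 ler_piMl//.
  by rewrite ler_norml; apply/andP; split; lra.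
(* The terms are nonnegative, so each partial sum is below the limit E[m(f) S'], and |m| <= 1. *)
have h4 : \sum_(k < K) spq k * t k <= Ex (fun x => `|S' x|).
  have c := cS' _ _ mmf mbd'.
  have hS : Ex (fun x => m (f x) * S' x) <= Ex (fun x => `|S' x|).
    apply: le_Ex; [exact: L1_bound mmf mbd'|exact: L1_norm|].
    by move=> x; rewrite (le_trans (ler_norm _))// normrM ler_piMl.
  rewrite (le_trans _ hS)// -(cvg_lim (@Rhausdorff R) c).
  under eq_bigr do rewrite tE.
  rewrite -(series_sumE (fun k => Ex (fun x => m (f x) * w k x))).
  apply: nondecreasing_cvgn_le; last by apply/cvg_ex; eexists; exact: c.
  by apply: nondecreasing_series => k _ _; rewrite -tE mulr_ge0// ltW ?spq_gt0.
have h5 : ((\sum_(k < K) `|p k - q k| * Ex (fun x => `|v k x| * `|Dh k f x|))%:E <=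
   \sum_(k <oo) `|p k - q k|%:E * 'E_mu[(fun x => `|v k x| * `|Dh k f x|)%R])%E.
  have i3 k : L1 (fun x => `|v k x| * `|Dh k f x|).
    by apply: (eq_L1 (L1_norm (vD_L1 k))) => x; rewrite normrM.
  have pos k : (0 <= `|p k - q k|%:E * 'E_mu[(fun x => `|v k x| * `|Dh k f x|)%R])%E.
    by apply: mule_ge0; rewrite ?lee_fin//; apply: expectation_ge0 => x; rewrite mulr_ge0.
  apply: le_trans (nneseries_lim_ge K (fun k _ _ => pos k)).
  rewrite -sumEFin big_mkord; apply: lee_sum => k _.
  by rewrite unlock ExE// -EFinM.
apply: (@le_trans _ _ ((2 * \sum_(k < K) `|p k - q k| * Ex (fun x => `|v k x| * `|Dh k f x|))%:E
    + (4 * Ex (fun x => `|S' x|))%:E)%E).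
  rewrite -EFinD lee_fin (le_trans (ler_sum _ (fun (k : 'I_K) _ => key k)))// big_split/=.
  rewrite -!mulr_sumr addrC lerD2l ler_pM2l//.
have -> : ('E_mu[(fun x => `|S' x|)%R] = (Ex (fun x => `|S' x|))%:E)%E.
  by rewrite unlock ExE//; exact: L1_norm.
by rewrite -EFinM leeD2r// EFinM lee_pmul2l.
Qed.

End malliavin_stein.

End canonical.

(** * Transfer to a Rademacher sequence *)

Section transfer.
Context {d d'} {T : measurableType d} {T' : measurableType d'} {R : realType}
  (P : probability T R) (B : {mfun T >-> T'}).
Local Notation mu := (distribution P B).
Implicit Types f g : T' -> R.

Lemma mfun_measurable : measurable_fun setT B.
Proof. exact: measurable_funP. Qed.

Lemma measurable_transfer f : measurable_fun setT f -> measurable_fun setT (fun w => f (B w)).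
Proof. by move=> mf; apply: measurableT_comp => //; exact: mfun_measurable. Qed.

Lemma transfer_expectation f : measurable_fun setT f -> (forall x, 0 <= f x) ->
  ('E_mu[f] = 'E_P[fun w => f (B w)])%E.
Proof.
move=> mf f0; rewrite unlock (ge0_integral_distribution B (f := EFin \o f))//.
exact/measurable_EFinP.
Qed.

Lemma transfer_L1 f : measurable_fun setT f -> (L1 mu f <-> L1 P (fun w => f (B w))).
Proof.
move=> mf; have mfB := measurable_transfer mf.
have E : (\int[mu]_x `|(f x)%:E| = \int[P]_w `|(f (B w))%:E|)%E.
  rewrite (ge0_integral_distribution B (f := fun x => `|(f x)%:E|%E))//.
  by apply: measurableT_comp => //; exact/measurable_EFinP.
split=> /integrableP[_ H]; apply/integrableP; split=> //=.
- exact/measurable_EFinP.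
- by rewrite -E.
- exact/measurable_EFinP.
- by rewrite E.
Qed.

Lemma transfer_Ex f : L1 mu f -> Ex mu f = Ex P (fun w => f (B w)).
Proof.
move=> hf; have mf := L1_meas hf; rewrite /Ex /Rintegral.
rewrite (integral_distribution (f := EFin \o f))//; first exact/measurable_EFinP.
exact/(transfer_L1 mf).
Qed.

Lemma transfer_L2 f : measurable_fun setT f -> (L2 mu f <-> L2 P (fun w => f (B w))).
Proof.
move=> mf; have m2 : measurable_fun setT (fun x => f x ^+ 2) by exact: measurable_funX.
split=> [[_ H]|[_ H]]; split => //.
- exact: measurable_transfer.
- exact/(transfer_L1 m2).
- exact/(transfer_L1 m2).
Qed.

Lemma transfer_ae (Q : T' -> Prop) : (\forall x \ae mu, Q x) -> \forall w \ae P, Q (B w).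
Proof.
move=> [N [mN N0 QN]]; exists (B @^-1` N); split => //.
- by rewrite -[X in measurable X]setTI; exact: mfun_measurable.
- by move=> w /= QB; exact: QN.
Qed.

(** The exceptional null set on the original space need not be a preimage. The set where f and g
    differ is measurable, and its preimage lies in that null set. *)
Lemma transfer_ae_eq f g : measurable_fun setT f -> measurable_fun setT g ->
  (\forall w \ae P, f (B w) = g (B w)) -> \forall x \ae mu, f x = g x.
Proof.
move=> mf mg [N [mN N0 fgN]].
pose A := ~` [set x | f x = g x].
have mA : measurable A.
  apply: measurableC; rewrite (_ : [set x | _] = [set x | 0 <= f x - g x] `&` [set x | 0 <= g x - f x]).
    have mfg : measurable_fun setT (fun x => f x - g x) by exact: measurable_funB.
    have mgf : measurable_fun setT (fun x => g x - f x) by exact: measurable_funB.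
    by apply: measurableI; rewrite -[X in measurable X]setTI;
      [have := mfg measurableT `[0, +oo[%classic (measurable_itv _)
      |have := mgf measurableT `[0, +oo[%classic (measurable_itv _)];
      congr measurable; congr (_ `&` _); apply/seteqP; split => x /=; rewrite in_itv/= andbT.
  apply/seteqP; split=> x /=; first by move=> ->; rewrite subrr.
  by rewrite !subr_ge0 => -[h1 h2]; apply/eqP; rewrite eq_le h1 h2.
exists A; split=> //; apply/eqP; rewrite eq_le measure_ge0 andbT -N0.
apply: (@le_measure _ _ _ P (B @^-1` A) N); rewrite ?inE//.
by rewrite -[X in measurable X]setTI; exact: mfun_measurable.
Qed.

End transfer.

(** * The bits of a Rademacher sequence and their law *)

Definition emb {R : realType} (x : bits) : nat -> R := fun k => if x k then 1 else -1.

Section bit_sequence.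
Context {R : realType} {d : measure_display} {T : measurableType d} (P : probability T R)
  (X : nat -> {RV P >-> R}) (p q : nat -> R).
Hypothesis hX : rademacher_seq X p q.

Definition bits_of (w : T) : bits := fun k => X k w == 1.

Let m1_neq1 : (-1 == 1 :> R) = false.
Proof. by apply/negbTE; rewrite -subr_eq0; apply/negP => /eqP; lra. Qed.

Lemma emb_bits_of w : X ^~ w = emb (bits_of w).
Proof.
apply/funext => k; rewrite /emb /bits_of.
by case: (rad_val hX k w) => ->; rewrite ?eqxx ?m1_neq1.
Qed.

Lemma measurable_eq1 : measurable_fun setT (fun y : R => y == 1).
Proof.
apply: (@measurable_fun_bool _ _ _ _ true); rewrite setTI.
by rewrite (_ : _ @^-1` _ = [set 1])//; apply/seteqP; split => y /= /eqP.
Qed.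

Lemma measurable_bits_of : measurable_fun setT bits_of.
Proof. by apply: (@measurable_bits _ T bits_of) => k; apply: (measurableT_comp measurable_eq1). Qed.

HB.instance Definition _ := isMeasurableFun.Build _ _ T bits bits_of measurable_bits_of.

Definition law : probability bits R := distribution P (bits_of : {mfun T >-> bits}).

Definition box (C : nat -> set bool) : set bits := [set x | forall j, C j (x j)].

Let slab (C : nat -> set bool) j : set R := [set y | C j (y == 1)].

Let measurable_slab C j : measurable (slab C j).
Proof.
by rewrite -[X in measurable X]setTI; exact: (measurable_eq1 measurableT (_ : measurable (C j))).
Qed.

Lemma law_box n C : (forall j, (n <= j)%N -> C j = setT) ->
  law (box C) = (\prod_(j <- [fset i in iota 0 n]%fset) P (X j @^-1` slab C j))%E.
Proof.
move=> hC; rewrite -(rad_indep hX)//; congr (P _); apply/seteqP; split=> w /= H.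
  by move=> j _; exact: H.
move=> j; have [jn|nj] := ltnP j n; last by rewrite hC.
by apply: H => /=; rewrite inE mem_iota.
Qed.

Lemma coord_prob C k : P (X k @^-1` slab C k) =
  ((if `[< C k true >] then p k else 0) + (if `[< C k false >] then q k else 0))%:E.
Proof.
have Xp w : X k w = 1 -> (X k w == 1) = true by move=> ->; rewrite eqxx.
have Xm w : X k w = -1 -> (X k w == 1) = false by move=> ->; rewrite m1_neq1.
case: asboolP => ht; case: asboolP => hf.
- rewrite (_ : _ @^-1` _ = setT); last first.
    by apply/seteqP; split=> w //= _; rewrite /slab /=; case: (_ == _).
  by rewrite probability_setT (rad_compl hX) subrK.
- rewrite addr0 -(rad_pos hX); congr (P _); apply/seteqP; split=> w /=; rewrite /slab /=.
    by case: (rad_val hX k w) => // /Xm ->.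
  by move=> /Xp ->.
- rewrite add0r -(rad_neg hX); congr (P _); apply/seteqP; split=> w /=; rewrite /slab /=.
    by case: (rad_val hX k w) => // /Xp ->.
  by move=> /Xm ->.
- rewrite addr0 (_ : _ @^-1` _ = set0) ?measure0//.
  by apply/seteqP; split=> w //=; rewrite /slab /=; case: (_ == _).
Qed.

Let widen (C : nat -> set bool) k : nat -> set bool := fun j => if j == k then setT else C j.

Let put_box C k b : put k b @^-1` box C = if `[< C k b >] then box (widen C k) else set0.
Proof.
case: asboolP => Cb; apply/seteqP; split=> x //=.
- by move=> H j; rewrite /widen; have [//|jk] := eqVneq j k; have := H j; rewrite put_other.
- move=> H j; have := H j; rewrite /widen /put; have [->//|//] := eqVneq j k.
- by move=> /(_ k); rewrite put_same.
Qed.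

Let law_box_widen n C k : (forall j, (n <= j)%N -> C j = setT) ->
  law (box C) = (P (X k @^-1` slab C k) * law (box (widen C k)))%E.
Proof.
(* The list of coordinates must contain k even when k >= n. *)
move=> hC; pose N := maxn n k.+1.
have hN j : (N <= j)%N -> C j = setT by rewrite geq_max => /andP[nj _]; exact: hC.
have hW j : (N <= j)%N -> widen C k j = setT by rewrite /widen; case: eqP => // _; exact: hN.
rewrite (law_box hN) (law_box hW).
have kN : k \in [fset i in iota 0 N]%fset by rewrite inE mem_iota /= leq_max ltnSn orbT.
rewrite (big_fsetD1 k)//= [in RHS](big_fsetD1 k)//=.
have -> : P (X k @^-1` slab (widen C k) k) = 1%E.
  rewrite (_ : _ @^-1` _ = setT) ?probability_setT//.
  by apply/seteqP; split=> w //= _; rewrite /slab /= /widen eqxx.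
rewrite mul1e; congr (_ * _)%E; apply: eq_big_seq => j; rewrite !inE => /andP[jk _].
by rewrite /slab /widen (negbTE jk).
Qed.

Lemma p_ge0 k : 0 <= p k. Proof. by have /andP[/ltW] := rad_param hX k. Qed.
Lemma q_ge0 k : 0 <= q k.
Proof. by have /andP[_] := rad_param hX k; rewrite (rad_compl hX); lra. Qed.

(** The right-hand side is the integral against the mixture [m2] of the images of the law under the
    two maps [put k]. By uniqueness of measures it suffices to compare on boxes with finitely many
    constraints, where independence splits off coordinate k. *)
Lemma law_resample k (f : bits -> \bar R) : measurable_fun setT f ->
  (forall x, 0 <= f x)%E ->
  (\int[law]_x f x = (p k)%:E * (\int[law]_x f (put k true x)) +
     (q k)%:E * (\int[law]_x f (put k false x)))%E.
Proof.
move=> mf f0.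
have mput b := @measurable_put k b.
pose pt : {mfun bits >-> bits} := HB.pack (put k true) (isMeasurableFun.Build _ _ _ _ _ (mput true)).
pose pf : {mfun bits >-> bits} := HB.pack (put k false) (isMeasurableFun.Build _ _ _ _ _ (mput false)).
pose m2 := measure_add (mscale (NngNum (p_ge0 k)) (distribution law pt))
  (mscale (NngNum (q_ge0 k)) (distribution law pf)).
have mE A : measurable A -> law A = m2 A.
  apply: (@measure_unique _ _ _ [set A | exists n C, (forall j, (n <= j)%N -> C j = setT) /\ A = box C]
    (fun=> setT)).
  - apply/seteqP; split.
      apply: sub_sigma_algebra2 => _ [j ->].
      exists j.+1, (fun i => if i == j then [set true] else setT); split.
        by move=> i; have [->|//] := eqVneq i j; rewrite ltnn.
      apply/seteqP; split=> x /=; first by move=> xj i; case: eqP => // ->.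
      by move=> /(_ j); rewrite eqxx.
    apply: smallest_sub; first exact: sigma_algebra_measurable.
    move=> _ [n [C [hC ->]]]; rewrite (_ : box C = \bigcap_j [set x | C j (x j)]); last first.
      by apply/seteqP; split=> x H j; [move=> _; exact: (H j)|exact: (H j I)].
    apply: bigcap_measurable => // j _; rewrite -[X in measurable X]setTI.
    exact: (measurable_coord j measurableT (_ : measurable (C j))).
  - move=> _ _ [n [C [hC ->]]] [n' [C' [hC' ->]]].
    exists (maxn n n'), (fun j => C j `&` C' j); split.
      by move=> j; rewrite geq_max => /andP[nj n'j]; rewrite hC// hC'// setTI.
    apply/seteqP; split=> x /=; first by move=> [h h'] j; split.
    by move=> h; split=> j; case: (h j).
  - by move=> i; exists 0%N, (fun=> setT); split=> //; apply/seteqP; split.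
  - by apply/seteqP; split=> x // _; exists 0%N.
  - move=> _ [n [C [hC ->]]].
    transitivity ((p k)%:E * law (put k true @^-1` box C) + (q k)%:E * law (put k false @^-1` box C))%E;
      last by transitivity (m2 (box C)) => //; rewrite /m2 measure_addE.
    transitivity (P (X k @^-1` slab C k) * law (box (widen C k)))%E; first exact: law_box_widen hC.
    rewrite coord_prob.
    have E b : law (put k b @^-1` box C) =
       ((if `[< C k b >] then 1 else 0)%:E * law (box (widen C k)))%E.
      by rewrite put_box; case: ifP; rewrite ?mul1e ?mul0e ?measure0.
    rewrite !E !muleA -ge0_muleDl ?mule_ge0 ?lee_fin ?p_ge0 ?q_ge0//; try by case: ifP.
    by congr (_ * _)%E; rewrite -!EFinM -EFinD; do 2 case: ifP; rewrite ?mulr1 ?mulr0.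
  - by move=> i; apply: (le_lt_trans _ (ltry 1)); exact: (@probability_le1 _ _ _ law).
have mfp b : measurable_fun setT (fun x => f (put k b x)) by apply: measurableT_comp.
rewrite (@eq_measure_integral _ _ _ _ m2); last by move=> A mA _; exact: mE.
rewrite ge0_integral_measure_add// !ge0_integral_mscale//.
by rewrite (ge0_integral_distribution pt)// (ge0_integral_distribution pf).
Qed.

End bit_sequence.

(** * Sigma-algebras generated by coordinates, and factorization through the bits *)

Definition saturated (M : set nat) (C : set bits) :=
  forall x y : bits, (forall j, M j -> x j = y j) -> C x -> C y.

Lemma saturated_depends {R : realType} (M : set nat) (g : bits -> R) (Y : set R) :
  depends_on M g -> saturated M (g @^-1` Y).
Proof. by move=> gM x y xy /=; rewrite (gM x y xy). Qed.

Lemma depends_saturated {R : realType} (M : set nat) (C : set bits) :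
  saturated M C -> depends_on M (\1_C : bits -> R).
Proof.
move=> sC x y xy; rewrite !indicE; congr (nat_of_bool _)%:R.
by apply/idP/idP; rewrite !inE; apply: sC => // j Mj; rewrite xy.
Qed.

Section generated_sigma_algebras.
Context {R : realType} {T : Type} (X : nat -> T -> R) (b : T -> bits).
Hypothesis bX : forall w k, b w k = (X k w == 1).

(** Resetting all bits outside M to [false] does not affect membership in a saturated set, and after
    this reset the preimage of every measurable set lies in the sigma-algebra generated by the
    coordinates in M. *)
Lemma sigma_gen_preimage (M : set nat) (C : set bits) :
  measurable C -> saturated M C -> sigma_gen X M (b @^-1` C).
Proof.
have [s0 sC sU] := smallest_sigma_algebra setT (\bigcup_(j in M) preimage_set_system setT (X j) measurable).
move=> mC stC.
pose t (x : bits) : bits := fun k => if `[< M k >] then x k else false.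
have -> : b @^-1` C = (t \o b) @^-1` C.
  apply/seteqP; split=> w /=; apply: stC => j Mj; rewrite /t asboolT//.
suff H : measurable `<=` [set C' : set bits | sigma_gen X M ((t \o b) @^-1` C')] by exact: H.
apply: smallest_sub.
  split=> [|A hA|A hA] /=; first by rewrite preimage_set0.
    by rewrite setTD preimage_setC -setTD; exact: sC.
  by rewrite preimage_bigcup; exact: sU.
move=> _ [k ->] /=; have [Mk|nMk] := pselect (M k).
  apply: sub_sigma_algebra; exists k => //; exists [set 1]; first exact: measurable_set1.
  by rewrite setTI; apply/seteqP; split=> w /=; rewrite /t asboolT// bX => /eqP.
rewrite (_ : _ @^-1` _ = set0)//.
by apply/seteqP; split=> w //=; rewrite /t asboolF.
Qed.

Lemma measurable_wrt_comp (M : set nat) (g : bits -> R) :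
  measurable_fun setT g -> depends_on M g -> measurable_wrt (sigma_gen X M) (fun w => g (b w)).
Proof.
move=> mg gM _ [Y mY <-]; rewrite setTI.
have := @sigma_gen_preimage M (g @^-1` Y) _ (saturated_depends gM); apply.
by rewrite -[X in measurable X]setTI; exact: mg.
Qed.

Hypothesis Xb : forall w k, X k w = if b w k then 1 else -1.

(** The preimages of saturated measurable sets form a sigma-algebra that contains the generators. *)
Lemma sigma_gen_factor (M : set nat) (A : set T) : sigma_gen X M A ->
  exists C, [/\ measurable C, saturated M C & A = b @^-1` C].
Proof.
apply: (@smallest_sub _ _ _ [set A : set T | exists C, [/\ measurable C, saturated M C & A = b @^-1` C]]).
  split=> [|_ [C [mC sC ->]]|A' hA'] /=.
  - by exists set0; split; [exact: measurable0|move=> ? ? _|rewrite preimage_set0].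
  - exists (~` C); split; [exact: measurableC| |by rewrite setTD preimage_setC].
    by move=> x y xy nCx Cy; apply: nCx; apply: sC Cy => j Mj; rewrite xy.
  - have [C hC] := choice hA'; exists (\bigcup_n C n); split.
    + by apply: bigcup_measurable => n _; have [] := hC n.
    + by move=> x y xy [n _ Cx]; exists n => //; have [_ s _] := hC n; exact: s Cx.
    + by rewrite preimage_bigcup; apply: eq_bigcupr => n _; have [] := hC n.
move=> _ [j Mj [Y mY <-]]; exists [set x : bits | Y (if x j then 1 else -1)]; split.
- rewrite -[X in measurable X]setTI.
  have : measurable_fun setT (fun x : bits => if x j then 1 else -1 : R).
    by apply: measurable_fun_ifT => //; exact: measurable_coord.
  by apply.
- by move=> x y xy /=; rewrite (xy j).
- by rewrite setTI; apply/seteqP; split=> w /=; rewrite Xb.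
Qed.

(* Doob-Dynkin: [g] is the supremum of the rationals [r] such that [x] lies in the
   set whose preimage under [b] is [F > r]. *)
Lemma measurable_wrt_factor (M : set nat) (F : T -> R) : measurable_wrt (sigma_gen X M) F ->
  exists g : bits -> R, [/\ measurable_fun setT g, depends_on M g & F = (fun w => g (b w))].
Proof.
move=> mF.
have hC (r : rat) : exists C, [/\ measurable C, saturated M C & F @^-1` `]ratr r, +oo[%classic = b @^-1` C].
  by apply: sigma_gen_factor; apply: mF; exists `]ratr r, +oo[%classic => //; rewrite setTI.
have [C {}hC] := choice hC.
(* Indices that code no rational, and rationals r with x outside [C r], contribute -oo, which is
   neutral for the supremum. *)
pose u n (x : bits) : \bar R := if (choice.unpickle n : option rat) is Some r
  then (if `[< C r x >] then (ratr r)%:E else -oo)%E else -oo%E.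
have mu_ n : measurable_fun setT (u n).
  rewrite /u; case: choice.unpickle => [r|]; last exact: measurable_cst.
  apply: measurable_fun_ifT; [|exact: measurable_cst|exact: measurable_cst].
  apply: (@measurable_fun_bool _ _ _ _ true); rewrite setTI.
  rewrite (_ : _ @^-1` _ = C r); first by have [] := hC r.
  by apply/seteqP; split=> x /= /asboolP.
exists (fun x => fine (esups (u ^~ x) 0)); split.
- exact/measurableT_comp/measurable_fun_esups.
- move=> x y xy; congr (fine (esups _ 0)); apply/funext => n; rewrite /u.
  case: choice.unpickle => // r; have [_ s _] := hC r.
  suff -> : C r x = C r y by [].
  by apply/propext; split; apply: s => // j Mj; rewrite xy.
- apply/funext => w; apply/EFin_inj.
  have CE r : C r (b w) = (ratr r < F w).
    have [_ _ /(congr1 (fun S : set T => S w)) /= <-] := hC r.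
    by apply/propext; rewrite in_itv/= andbT.
  suff -> : esups (u ^~ (b w)) 0 = (F w)%:E by [].
  rewrite /esups /=; apply/eqP; rewrite eq_le; apply/andP; split.
    apply: ge_ereal_sup => _ [n _ <-]; rewrite /u; case: choice.unpickle => [r|]; last exact: leNye.
    by case: asboolP; rewrite ?leNye// CE lee_fin => /ltW.
  apply/lee_addgt0Pr => _/posnumP[e].
  have /rat_in_itvoo[r] : F w - e%:num < F w by rewrite ltrBlDr ltrDl.
  rewrite in_itv/= => /andP[r1 r2].
  have : (u (choice.pickle r) (b w) <= ereal_sup [set (u ^~ (b w)) k | k in [set k | (0 <= k)%N]])%E.
    by apply: ereal_sup_ubound; exists (choice.pickle r).
  rewrite /u choice.pickleK asboolT; last by rewrite CE.
  by move=> H; rewrite -leeBlDr// (le_trans _ H)// -EFinB lee_fin ltW.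
Qed.

End generated_sigma_algebras.

Lemma measurable_emb {R : realType} (f : (nat -> R) -> R) :
  measurable_wrt (sigma_gen (fun k (x : nat -> R) => x k) setT) f ->
  measurable_fun setT (fun x => f (emb x)).
Proof.
move=> mf _ Y mY; rewrite setTI.
suff H : sigma_gen (fun k (x : nat -> R) => x k) setT `<=` [set A | measurable (emb @^-1` A : set bits)].
  by apply: (H (f @^-1` Y)); apply: mf; exists Y => //; rewrite setTI.
apply: smallest_sub.
  split=> [|A hA|A hA] /=; first by rewrite preimage_set0; exact: measurable0.
    by rewrite setTD preimage_setC; exact: measurableC.
  by rewrite preimage_bigcup; apply: bigcup_measurable => k _; exact: hA.
move=> _ [j _ [Y' mY' <-]] /=; rewrite setTI -[X in measurable X]setTI.
have : measurable_fun setT (fun x : bits => emb x j : R).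
  by apply: measurable_fun_ifT => //; exact: measurable_coord.
by apply.
Qed.

Section expectations.
Context {d} {T : measurableType d} {R : realType} (P : probability T R).
Implicit Types f g : T -> R.

Lemma expectationE f : L1 P f -> ('E_P[f] = (Ex P f)%:E)%E.
Proof. by move=> hf; rewrite unlock; exact: ExE. Qed.

Lemma L1_expectation f : measurable_fun setT f -> (forall x, 0 <= f x) ->
  ('E_P[f] < +oo)%E -> L1 P f.
Proof.
move=> mf f0; rewrite unlock => fE; apply/integrableP; split; first exact/measurable_EFinP.
by under eq_integral do rewrite /= ger0_norm//.
Qed.

Lemma eq_expectation_ae f g : measurable_fun setT f -> measurable_fun setT g ->
  (\forall w \ae P, f w = g w) -> ('E_P[f] = 'E_P[g])%E.
Proof.
move=> mf mg fg; rewrite unlock; apply: ae_eq_integral => //;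
  [exact/measurable_EFinP|exact/measurable_EFinP|].
by apply: filterS fg => w /= -> _.
Qed.

Lemma Lfun2P f : f \in Lfun P 2%:E <-> L2 P f.
Proof.
split=> [hf|[mf f2]].
  split; last exact: Lfun2_integrable_sqr.
  by move: hf; rewrite inE => /andP[]; rewrite inE.
rewrite inE; apply/andP; split; rewrite inE//=.
rewrite /finite_norm (@lty_poweRy _ _ 2)// poweR_Lnorm//.
have /integrableP[_] := f2; congr (_ < _)%E; apply: eq_integral => w _ /=.
by rewrite powR_mulrn// normrX.
Qed.

End expectations.

(** * Gradient, conditional expectation and generator in terms of bits *)

Section operators.
Context {R : realType} {d : measure_display} {T : measurableType d} (P : probability T R)
  (X : nat -> {RV P >-> R}) (p q : nat -> R).
Hypothesis hX : rademacher_seq X p q.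
Local Notation B := (bits_of X).
Local Notation mu := (law X).
Implicit Types (f g h u phi : bits -> R) (M : set nat) (C : set bits) (k n : nat).

Let p01 := rad_param hX.
Let pq1 := rad_compl hX.
Let rsp := law_resample hX.

Let bX w k : B w k = (X k w == 1). Proof. by []. Qed.
Let Xb w k : X k w = if B w k then 1 else -1.
Proof. exact: (congr1 (fun x : nat -> R => x k) (emb_bits_of hX w)). Qed.

Lemma factor M (F : T -> R) : measurable_wrt (sigma_gen (fun k => X k : T -> R) M) F ->
  exists g, [/\ measurable_fun setT g, depends_on M g & F = (fun w => g (B w))].
Proof. by move=> mF; exact: (measurable_wrt_factor Xb mF). Qed.

Lemma measurable_wrt_bits M g : measurable_fun setT g -> depends_on M g ->
  measurable_wrt (sigma_gen (fun k => X k : T -> R) M) (fun w => g (B w)).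
Proof. exact: measurable_wrt_comp bX _ _. Qed.

Lemma depends_setT g : depends_on setT g.
Proof. by move=> x y xy; congr g; apply/funext => j; exact: xy. Qed.

Lemma L2X_bits g : measurable_fun setT g -> L2X P X (fun w => g (B w)) <-> L2 mu g.
Proof.
move=> mg; split=> [[_ /Lfun2P gB]|hg].
  exact/(transfer_L2 P _ mg).
split; first exact: measurable_wrt_bits (depends_setT g).
by apply/Lfun2P; exact/(transfer_L2 P _ mg).
Qed.

Lemma L2X_factor (F : T -> R) : L2X P X F -> exists2 f, L2 mu f & F = (fun w => f (B w)).
Proof.
move=> hF; have [f [mf _ FE]] := factor (proj1 hF).
by exists f => //; apply/(L2X_bits mf); rewrite -FE.
Qed.

Lemma E_bits f : L1 mu f -> ('E_P[fun w => f (B w)] = (Ex mu f)%:E)%E.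
Proof.
move=> hf; rewrite (transfer_Ex hf) expectationE//.
exact/(transfer_L1 P _ (L1_meas hf)).
Qed.

Lemma E_sqr_bits f : L2 mu f -> ('E_P[fun w => (f (B w) ^+ 2)%R] = (N2 mu f)%:E)%E.
Proof. by move=> [_ hf]; exact: E_bits hf. Qed.

Lemma integral_bits g C : L1 mu g -> measurable C ->
  (\int[P]_(w in B @^-1` C) (g (B w))%:E = (Ex mu (fun x => \1_C x * g x))%:E)%E.
Proof.
move=> hg mC.
have h1 : L1 mu (fun x => \1_C x * g x).
  by apply: (@L1_bound _ _ _ _ _ _ 1) => // x; rewrite indicE ger0_norm// lern1 leq_b1.
rewrite -E_bits// unlock integral_mkcond; apply: eq_integral => w _.
rewrite patchE indicE /=; case: ifPn => wC.
  by rewrite mem_set ?mul1r//; move: wC; rewrite inE.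
by rewrite memNset ?mul0r//; move: wC; rewrite notin_setE.
Qed.

(** The version picked by [xget] factors as a function g of the bits in M, as h does. Hence the set
    where g >= h and its complement are both admissible test sets, and together they give E|g - h| =
    0. *)
Lemma condexp_bits M u h : L1 mu u -> L1 mu h -> depends_on M h ->
  (forall C, measurable C -> saturated M C ->
     Ex mu (fun x => \1_C x * h x) = Ex mu (fun x => \1_C x * u x)) ->
  measurable_fun setT (condexp P (sigma_gen X M) (fun w => u (B w))) /\
  \forall w \ae P, condexp P (sigma_gen X M) (fun w => u (B w)) w = h (B w).
Proof.
move=> hu hh hM huE.
have hC : is_condexp P (sigma_gen X M) (fun w => u (B w)) (fun w => h (B w)).
  split; first exact: measurable_wrt_bits (L1_meas hh) hM.
    exact/(transfer_L1 P _ (L1_meas hh)).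
  move=> A /(sigma_gen_factor Xb)[C [mC sC ->]].
  by rewrite !integral_bits// huE.
have := @xgetPex _ (fun=> 0) (is_condexp P (sigma_gen X M) (fun w => u (B w))) (ex_intro _ _ hC).
rewrite -/(condexp _ _ _); case=> mc ic cE.
have [g [mg gM gE]] := factor mc; rewrite gE in ic cE *.
have ig := (transfer_L1 P (B : {mfun T >-> bits}) mg).2 ic.
split; first exact: (measurable_transfer (B : {mfun T >-> bits}) mg).
have ghE C : measurable C -> saturated M C ->
    Ex mu (fun x => \1_C x * (g x - h x)) = 0.
  move=> mC sC; have [_ _ /(_ _ (sigma_gen_preimage bX mC sC))] := hC.
  have b1 x : `|\1_C x : R| <= 1 by rewrite indicE ger0_norm// lern1 leq_b1.
  rewrite -(cE _ (sigma_gen_preimage bX mC sC)) !integral_bits// => -[E].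
  rewrite -(subrr (Ex mu (fun x => \1_C x * g x))) -{2}E -ExB.
  - by apply: eq_Ex => x; rewrite mulrBr.
  - exact: (L1_bound ig _ b1).
  - exact: (L1_bound hh _ b1).
have mgh : measurable_fun setT (fun x => g x - h x) by apply: measurable_funB => //; exact: (L1_meas hh).
pose C1 := [set x | 0 <= g x - h x].
have mC1 : measurable C1.
  rewrite -[X in measurable X]setTI; have := mgh measurableT `[0, +oo[%classic (measurable_itv _).
  by congr measurable; congr (_ `&` _); apply/seteqP; split => x /=; rewrite in_itv/= andbT.
have sC1 : saturated M C1 by move=> x y xy; rewrite /C1 /= (gM x y xy) (hM x y xy).
have sC2 : saturated M (~` C1).
  by move=> x y xy; rewrite /C1 /= (gM x y xy) (hM x y xy).
have igh := L1B ig hh.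
have N0 : Ex mu (fun x => `|g x - h x|) = 0.
  have := ghE _ (measurableC mC1) sC2; have := ghE _ mC1 sC1.
  have b1 (D : set bits) x : `|\1_D x : R| <= 1 by rewrite indicE ger0_norm// lern1 leq_b1.
  have i1 D : measurable D -> L1 mu (fun x => \1_D x * (g x - h x)) by move=> mD; exact: (L1_bound igh _ (b1 D)).
  move=> E1 E2; rewrite -[RHS](subrr 0) -{1}E1 -E2 -ExB; [|exact: i1|by apply: i1; exact: measurableC].
  apply: eq_Ex => x; rewrite !indicE; have [x0|x0] := lerP 0 (g x - h x).
    have nC : ~ (~` C1) x by move=> /(_ x0).
    by rewrite (mem_set (x0 : C1 x)) (memNset nC) mul0r subr0 mul1r ger0_norm.
  have nC : ~ C1 x by rewrite /C1 /= leNgt x0.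
  by rewrite (memNset nC) (mem_set (nC : (~` C1) x)) mul0r sub0r mul1r ltr0_norm.
have : \forall x \ae mu, `|g x - h x| = 0.
  by apply: Ex_eq0_ae => //; exact: L1_norm.
by move=> /transfer_ae; apply: filterS => w /normr0_eq0 /eqP; rewrite subr_eq0 => /eqP.
Qed.

Lemma condexp_Eint k u : L1 mu u ->
  measurable_fun setT (condexp P (sigma_gen X [set j | j != k]) (fun w => u (B w))) /\
  \forall w \ae P, condexp P (sigma_gen X [set j | j != k]) (fun w => u (B w)) w = Eint p q k u (B w).
Proof.
move=> hu; apply: condexp_bits => //; first exact: L1_Eint.
  by move=> x y xy; rewrite /Eint; congr (_ * u _ + _ * u _); apply/funext => j;
    rewrite /put; case: eqP => // /eqP jk; exact: xy.
move=> C mC sC.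
have fC := depends_on_free (@depends_saturated R _ _ sC) (_ : ~ [set j | j != k] k).
rewrite -[RHS](Ex_Eint p01 pq1 rsp k).
  by apply: eq_Ex => x; rewrite /Eint !fC//= ?eqxx//; ring.
by apply: (@L1_bound _ _ _ _ _ _ 1) => // x; rewrite indicE ger0_norm// lern1 leq_b1.
Qed.

Lemma condexp_Ege n u : L2 mu u ->
  \forall w \ae P, condexp P (sigma_gen X [set j | (j < n)%N]) (fun w => u (B w)) w = Ege mu n u (B w).
Proof.
move=> hu; suff [] : measurable_fun setT (condexp P (sigma_gen X [set j | (j < n)%N]) (fun w => u (B w))) /\
  \forall w \ae P, condexp P (sigma_gen X [set j | (j < n)%N]) (fun w => u (B w)) w = Ege mu n u (B w) by [].
apply: condexp_bits; [exact: L2_L1|exact: L2_L1 (L2_Ege mu n u)|exact: Ege_level|].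
move=> C mC sC.
exact: (Ex_Ege_mul p01 pq1 rsp (depends_saturated sC) (L2_L1 hu)).
Qed.

Lemma normalized_bits k w : normalized X p q k w = Ym p q k (B w).
Proof.
have s0 := spq_neq0 p01 pq1 k.
rewrite /normalized -/(spq p q k) /Ym (sqrt_qp p01 pq1) (sqrt_pq p01 pq1) Xb.
by case: (B w k); rewrite pq1; field.
Qed.

Lemma Dgrad_bits k g : L1 mu g -> measurable_fun setT (Dgrad P X k (fun w => g (B w))) /\
  \forall w \ae P, Dgrad P X k (fun w => g (B w)) w = Ym p q k (B w) * Dh p q k g (B w).
Proof.
move=> hg; have [mc cE] := condexp_Eint k hg; split.
  by apply: measurable_funB => //; exact: (measurable_transfer (B : {mfun T >-> bits}) (L1_meas hg)).
by apply: filterS cE => w; rewrite /Dgrad => ->; exact: DhE p01 pq1 _ _ _.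
Qed.

(** [f] is built from the very representative that [xget] picks, so that the gradient is [Dh] of f
    at every point; for another factorization of F this would hold only almost surely. *)
Lemma Dhat_bits (F : T -> R) : measurable_wrt (sigma_gen X setT) F ->
  exists f, [/\ measurable_fun setT f, F = (fun w => f (B w)) &
    forall k, Dhat X p q k F = (fun w => Dh p q k f (B w))].
Proof.
move=> /factor[g [mg _ FE]].
have rep : represents X F (fun y => g (fun k => y k == 1)).
  split=> [|w]; last by rewrite FE.
  exact: (@measurable_wrt_comp R (nat -> R) (fun k y => y k) (fun y k => y k == 1) (fun _ _ => erefl)
    setT g mg (depends_setT g)).
have := @xgetPex _ (fun=> 0) (represents X F) (ex_intro _ _ rep).
set f0 := xget _ _ => -[mf0 f0E].
have XE w : X ^~ w = emb (B w) by exact: emb_bits_of hX w.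
exists (fun x => f0 (emb x)); split.
- exact: measurable_emb.
- by apply/funext => w; rewrite f0E XE.
- move=> k; apply/funext => w; rewrite /Dhat -/f0 /Dh -/(spq p q k) XE; congr (_ * (f0 _ - f0 _));
  by apply/funext => j; rewrite /upd /emb /put; case: eqP.
Qed.

(** [Dh k] is linear and an L^2 contraction, hence insensitive to null sets. *)
Lemma Dh_ae f g : L2 mu f -> L2 mu g -> (\forall x \ae mu, f x = g x) ->
  forall k, \forall x \ae mu, Dh p q k f x = Dh p q k g x.
Proof.
move=> hf hg fg k.
have hB := L2B hf hg.
have N0 : N2 mu (fun x => f x - g x) = 0.
  rewrite -[RHS](_ : N2 mu (fun=> 0) = 0).
    by apply: (ae_eq_N2 hB _ _).2 => //; apply: filterS fg => x ->; rewrite subrr.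
  by rewrite /N2 expr0n /= Ex_cst.
have : N2 mu (Dh p q k (fun x => f x - g x)) = 0.
  apply/eqP; rewrite eq_le N2_ge0 andbT -N0; exact: N2_Dh_le p01 pq1 rsp k _ hB.
move=> /(N2_eq0_ae (L2_Dh p01 pq1 rsp k hB)); apply: filterS => x.
by rewrite DhB => /eqP; rewrite subr_eq0 => /eqP.
Qed.

Lemma nneseries_fin_le (a : nat -> R) (K : R) : (forall k, 0 <= a k) ->
  (\sum_(k <oo) (a k)%:E <= K%:E)%E <-> (forall n, \sum_(k < n) a k <= K).
Proof.
move=> a0; split=> [H n|H].
  rewrite -lee_fin -sumEFin (le_trans _ H)//.
  rewrite -(big_mkord xpredT (fun k => (a k)%:E)); apply: nneseries_lim_ge => k _ _.
  by rewrite lee_fin.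
apply: lime_le; first by apply: is_cvg_nneseries => k _ _; rewrite lee_fin.
by apply: nearW => n; rewrite big_mkord sumEFin lee_fin.
Qed.

Lemma ereal_cvg0_le (a : nat -> \bar R) (e : R) : a n @[n --> \oo] --> 0%E -> 0 < e ->
  \forall n \near \oo, (a n <= e%:E)%E.
Proof.
move=> /fine_cvgP[afin /cvgr_lt a0] e0; near=> n.
rewrite -(fineK (_ : a n \is a fin_num)) ?lee_fin; last by near: n.
by apply: ltW; near: n; exact: a0.
Unshelve. all: by end_near.
Qed.

Lemma E_diff_bits (U V : T -> R) u v : L2 mu u -> L2 mu v ->
  measurable_fun setT U -> measurable_fun setT V ->
  (\forall w \ae P, U w = u (B w)) -> (\forall w \ae P, V w = v (B w)) ->
  ('E_P[fun w => ((U w - V w) ^+ 2)%R] = (N2 mu (fun x => u x - v x))%:E)%E.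
Proof.
move=> hu hv mU mV Uu Vv; rewrite -E_sqr_bits; last exact: L2B.
apply: eq_expectation_ae.
- by apply: measurable_funX; exact: measurable_funB.
- apply: (measurable_transfer (B : {mfun T >-> bits}) (f := fun x => (u x - v x) ^+ 2)).
  by apply: measurable_funX; exact: L2_meas (L2B hu hv).
- by apply: filterS2 Uu Vv => w -> ->.
Qed.

Lemma measurable_wrt_fun M (F : T -> R) : measurable_wrt (sigma_gen X M) F -> measurable_fun setT F.
Proof. by move=> /factor[g [mg _ ->]]; exact: measurable_transfer. Qed.

(** For each k the map f -> Y_k D_k f is continuous in L^2, which identifies the limit U_k of the
    gradients of the approximants. As Y_k^2 integrates to one against functions free of coordinate
    k, the distances to U are the energies that [domD] asks to be small. *)
Lemma is_D_domD f (U : nat -> T -> R) : measurable_fun setT f -> is_D P X (fun w => f (B w)) U ->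
  domD mu p q f /\ forall k, \forall w \ae P, U k w = Ym p q k (B w) * Dh p q k f (B w).
Proof.
move=> mf [/(L2X_bits mf) hf [mU sU] [Fn [hFn cF cU]]].
have mFU k := measurable_wrt_fun (mU k).
have hUk k : exists u, L2 mu u /\ U k = fun w => u (B w).
  have [u [mu_ _ UE]] := factor (mU k); exists u; split=> //.
  apply/(transfer_L2 P (B : {mfun T >-> bits}) mu_); split; first by rewrite -UE.
  rewrite (_ : (fun w => _) = fun w => U k w ^+ 2); last by rewrite UE.
  apply: L1_expectation; [exact: measurable_funX|by move=> w; exact: sqr_ge0|].
  apply: le_lt_trans sU.
  have := @nneseries_lim_ge R (fun k => 'E_P[fun w => (U k w ^+ 2)%R])%E xpredT 0 k.+1.
  rewrite big_mkord big_ord_recr/= => H; apply: le_trans (H _).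
    rewrite leeDr// sume_ge0// => i _.
    by apply: expectation_ge0 => w; exact: sqr_ge0.
  by move=> i _ _; apply: expectation_ge0 => w; exact: sqr_ge0.
have [u hu] := choice hUk.
have hg n : exists g, [/\ L2 mu g, exists m, level m g & Fn n = fun w => g (B w)].
  have [h1 [m /factor[g [mg gm gE]]]] := hFn n.
  by exists g; split=> //; [apply/(L2X_bits mg); rewrite -gE|exists m].
have [g {}hg] := choice hg.
have DB n k : ('E_P[fun w => ((Dgrad P X k (Fn n) w - U k w) ^+ 2)%R] =
    (N2 mu (fun x => Ym p q k x * Dh p q k (g n) x - u k x))%:E)%E.
  have [hgn _ ->] := hg n; have [huk UE] := hu k.
  have [mD Dae] := Dgrad_bits k (L2_L1 hgn).
  apply: E_diff_bits => //; first by apply: L2_Ym => //; exact: L2_Dh.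
  by apply: filterE => w; rewrite UE.
have FB n : ('E_P[fun w => ((Fn n w - f (B w)) ^+ 2)%R] = (N2 mu (fun x => g n x - f x))%:E)%E.
  by have [hgn _ ->] := hg n; rewrite -E_sqr_bits//; exact: L2B.
have small (eps : R) : 0 < eps -> exists n, N2 mu (fun x => g n x - f x) <= eps /\
    forall K, \sum_(k < K) N2 mu (fun x => Ym p q k x * Dh p q k (g n) x - u k x) <= eps.
  move=> e0.
  have [n [h1 h2]] := filter_ex (filterI (ereal_cvg0_le cF e0) (ereal_cvg0_le cU e0)).
  exists n; split; first by rewrite -lee_fin -FB.
  apply: (proj1 (@nneseries_fin_le (fun k => N2 mu (fun x => Ym p q k x * Dh p q k (g n) x - u k x)) eps (fun k => N2_ge0 _ _))).
  by apply: le_trans h2; under eq_eseriesr do rewrite -DB.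
have L2D k h : L2 mu h -> L2 mu (fun x => Ym p q k x * Dh p q k h x).
  by move=> hh; apply: L2_Ym => //; exact: L2_Dh.
have N2B n k : N2 mu (fun x => Ym p q k x * Dh p q k (g n) x - Ym p q k x * Dh p q k f x) =
    N2 mu (Dh p q k (fun x => g n x - f x)).
  have [hgn _ _] := hg n.
  rewrite -(N2_Ym p01 pq1 rsp (@Dh_free _ p q k _) (L2_Dh p01 pq1 rsp k (L2B hgn hf))).
  by apply: eq_Ex => x; rewrite DhB mulrBr.
have uE k : \forall x \ae mu, u k x = Ym p q k x * Dh p q k f x.
  have [huk _] := hu k.
  have N0 : N2 mu (fun x => u k x - Ym p q k x * Dh p q k f x) = 0.
    apply/eqP; rewrite eq_le N2_ge0 andbT; apply/ler_addgt0Pr => eps e0; rewrite add0r.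
    have [|n [h1 h2]] := small (eps / 4); first by rewrite divr_gt0.
    have [hgn _ _] := hg n.
    apply: le_trans (N2B_le huk (L2D k _ hgn) (L2D k _ hf)) _.
    rewrite N2_sub N2B.
    have a1 : N2 mu (Dh p q k (fun x => g n x - f x)) <= eps / 4.
      by apply: le_trans h1; apply: N2_Dh_le => //; exact: L2B.
    have a2 : N2 mu (fun x => Ym p q k x * Dh p q k (g n) x - u k x) <= eps / 4.
      apply: le_trans (h2 k.+1); rewrite big_ord_recr/= lerDr.
      by apply: sumr_ge0 => i _; exact: N2_ge0.
    by move: a1 a2; lra.
  have := N2_eq0_ae (L2B huk (L2D k _ hf)) N0.
  by apply: filterS => x /eqP; rewrite subr_eq0 => /eqP.
split; last first.
  move=> k; have [_ ->] := hu k.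
  exact: (transfer_ae (P := P) (B := (B : {mfun T >-> bits})) (uE k)).
split=> // eps e0; have [n [h1 h2]] := small eps e0.
have [hgn [m gm] _] := hg n.
exists (g n), m; split=> // K; apply: le_trans (h2 K).
rewrite le_eqVlt; apply/orP; left; apply/eqP; apply: eq_bigr => k _.
have [huk _] := hu k.
rewrite -N2B; apply: (ae_eq_N2 _ _ _).2.
- exact: L2B (L2D _ _ hgn) (L2D _ _ hf).
- exact: L2_meas (L2B (L2D _ _ hgn) huk).
- by apply: filterS (uE k) => x ->.
Qed.

(** Approximants with errors at most 1/(n+1) form the sequence that witnesses the closure. *)
Lemma domD_is_D f : domD mu p q f ->
  is_D P X (fun w => f (B w)) (fun k w => Ym p q k (B w) * Dh p q k f (B w)).
Proof.
move=> df; have hf := proj1 df; have mf := L2_meas hf.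
have L2D k h : L2 mu h -> L2 mu (fun x => Ym p q k x * Dh p q k h x).
  by move=> hh; apply: L2_Ym => //; exact: L2_Dh.
have N2D k h : L2 mu h -> N2 mu (fun x => Ym p q k x * Dh p q k h x) = N2 mu (Dh p q k h).
  by move=> hh; rewrite (N2_Ym p01 pq1 rsp (@Dh_free _ p q k _))//; exact: L2_Dh.
split; first exact/(L2X_bits mf).
  split=> [k|]; first exact: measurable_wrt_bits (L2_meas (L2D k _ hf)) (depends_setT _).
  have [C hC] := domD_energy p01 pq1 rsp df.
  apply: le_lt_trans (ltry C).
  under eq_eseriesr => k _ do rewrite (E_sqr_bits (L2D k _ hf)) N2D//.
  by apply/nneseries_fin_le => // k; exact: N2_ge0.
have ap n : exists g, (exists m, level m g) /\ (N2 mu (fun x => g x - f x) <= n.+1%:R^-1 /\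
    forall K, enD mu p q (fun x => g x - f x) K <= n.+1%:R^-1).
  have [|g [m [gm h1 h2]]] := (proj2 df) (n.+1%:R^-1); first by rewrite invr_gt0.
  by exists g; split; [exists m|split].
have [g hg] := choice ap.
have hgn n : L2 mu (g n) by have [[m gm] _] := hg n; exact: level_L2 gm.
have inv0 (a : nat -> \bar R) : (forall n, 0 <= a n <= (n.+1%:R^-1)%:E)%E -> a n @[n --> \oo] --> 0%E.
  move=> ha; apply: (@squeeze_cvge _ _ _ _ (fun=> 0%E) _ (fun n => (n.+1%:R^-1)%:E)).
  - exact: nearW.
  - exact: cvg_cst.
  - by apply: cvg_EFin; [exact: nearW|exact: cvg_harmonic].
exists (fun n w => g n (B w)); split.
- move=> n; split; first exact/(L2X_bits (L2_meas (hgn n))).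
  have [[m gm] _] := hg n; exists m.
  exact: measurable_wrt_bits (L2_meas (hgn n)) gm.
- apply: inv0 => n; have [_ [h1 _]] := hg n.
  by rewrite (E_sqr_bits (L2B (hgn n) hf)) !lee_fin N2_ge0.
- apply: inv0 => n; have [_ [_ h2]] := hg n.
  have E k : ('E_P[fun w => ((Dgrad P X k (fun w => g n (B w)) w - Ym p q k (B w) * Dh p q k f (B w)) ^+ 2)%R] =
      (N2 mu (Dh p q k (fun x => g n x - f x)))%:E)%E.
    have [mD Dae] := Dgrad_bits k (L2_L1 (hgn n)).
    rewrite (E_diff_bits (L2D k _ (hgn n)) (L2D k _ hf) mD _ Dae); last 2 first.
      exact: (measurable_transfer (B : {mfun T >-> bits}) (L2_meas (L2D k _ hf))).
      exact: filterE.
    rewrite -N2D; last exact: L2B.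
    by congr EFin; apply: eq_Ex => x; rewrite DhB mulrBr.
  under eq_eseriesr do rewrite E.
  rewrite nneseries_ge0/=; last by move=> k _ _; rewrite lee_fin N2_ge0.
  by apply/nneseries_fin_le => // k; exact: N2_ge0.
Qed.

Lemma series_Dh_cvg phi h : domD mu p q phi -> domD mu p q h ->
  cvgn (series (fun k => Ex mu (fun x => Dh p q k phi x * Dh p q k h x))).
Proof.
move=> dphi dh; have [C1 hC1] := domD_energy p01 pq1 rsp dphi.
have [C2 hC2] := domD_energy p01 pq1 rsp dh.
have hp k : L2 mu (Dh p q k phi) by apply: L2_Dh => //; case: dphi.
have hh k : L2 mu (Dh p q k h) by apply: L2_Dh => //; case: dh.
apply: normed_cvg; apply: (@nondec_bounded_cvg _ _ ((C1 + C2) / 2)) => [k|n]; first exact: normr_ge0.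
apply: (@le_trans _ _ ((enD mu p q phi n + enD mu p q h n) / 2)).
  rewrite /enD -big_split/= mulr_suml; apply: ler_sum => k _.
  apply: le_trans (norm_Ex_le (L2_mul (hp k) (hh k))) _.
  exact: Ex_norm_mul_le.
by rewrite ler_pM2r ?invr_gt0// lerD.
Qed.

Lemma cvg_EFin_series (a : nat -> R) (l : R) : series a n @[n --> \oo] --> l ->
  (\sum_(k <oo) (a k)%:E)%E = l%:E.
Proof.
move=> al; apply/cvg_lim => //.
rewrite (_ : (fun n => _) = (fun n => (series a n)%:E)); last first.
  by apply/funext => n; rewrite sumEFin.
by apply: cvg_EFin => //; exact: nearW.
Qed.

(** The two factors Y_k combine to Y_k^2, which integrates out because the gradients ignore
    coordinate k. *)
Lemma E_mul_Dh phi h (U V : T -> R) k : domD mu p q phi -> domD mu p q h ->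
  measurable_fun setT U -> measurable_fun setT V ->
  (\forall w \ae P, V w = Ym p q k (B w) * Dh p q k phi (B w)) ->
  (\forall w \ae P, U w = Ym p q k (B w) * Dh p q k h (B w)) ->
  ('E_P[V \* U] = (Ex mu (fun x => Dh p q k phi x * Dh p q k h x))%:E)%E.
Proof.
move=> [hphi _] [hh _] mU mV Vk Uk.
have hp : L2 mu (Dh p q k phi) by exact: L2_Dh.
have hq : L2 mu (Dh p q k h) by exact: L2_Dh.
have i1 := L2_mul hp hq.
rewrite -(Ex_Ym2 p01 pq1 rsp (k := k) _ i1); last by move=> b x; rewrite !Dh_free.
have i2 : L1 mu (fun x => Ym p q k x ^+ 2 * (Dh p q k phi x * Dh p q k h x)).
  rewrite (_ : (fun x => _) = fun x => Ym p q k x * (Ym p q k x * (Dh p q k phi x * Dh p q k h x))).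
    by apply: (L1_Ym p01 pq1); exact: (L1_Ym p01 pq1).
  by apply/funext => x; rewrite expr2 !mulrA.
rewrite -(E_bits i2); apply: eq_expectation_ae.
- exact: measurable_funM.
- exact: (measurable_transfer (B : {mfun T >-> bits}) (L1_meas i2)).
- by apply: filterS2 Vk Uk => w /= -> ->; ring.
Qed.

Lemma E_mulN_bits phi f : L2 mu phi -> L2 mu f ->
  ('E_P[((fun w => phi (B w)) \* (\- (fun w => f (B w))))%R] = (- Ex mu (fun x => phi x * f x))%:E)%E.
Proof.
move=> hphi hf; rewrite -ExN; last exact: L2_mul.
rewrite -E_bits; last by apply: L1N; exact: L2_mul.
by congr expectation; apply/funext => w /=; rewrite mulrN.
Qed.

Lemma is_L_bits h f : measurable_fun setT h -> measurable_fun setT f ->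
  is_L P X (fun w => h (B w)) (fun w => f (B w)) ->
  [/\ domD mu p q h, L2 mu f & forall phi, domD mu p q phi ->
    series (fun k => Ex mu (fun x => Dh p q k phi x * Dh p q k h x)) n @[n --> \oo] -->
      - Ex mu (fun x => phi x * f x)].
Proof.
move=> mh mf [U [hU [[mU _] hL Uadj]]].
have [dh UE] := is_D_domD mh hU.
have hf : L2 mu f.
  have : L2 mu (fun x => - f x) by apply/L2X_bits => //; exact: measurableT_comp.
  by move=> /L2N; congr L2; apply/funext => x; rewrite opprK.
split=> // phi dphi; have hphi := proj1 dphi.
have := Uadj _ _ (domD_is_D dphi).
rewrite E_mulN_bits//.
have c := series_Dh_cvg dphi dh.
under eq_eseriesr => k _.
  rewrite (@E_mul_Dh phi h (U k) _ k dphi dh (measurable_wrt_fun (mU k)) _ _ (UE k)); last 2 first.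
  - have hY : L2 mu (fun x => Ym p q k x * Dh p q k phi x) by apply: L2_Ym => //; exact: L2_Dh.
    exact: (measurable_transfer (B : {mfun T >-> bits}) (L2_meas hY)).
  - exact: filterE.
  over.
by rewrite (cvg_EFin_series c) => -[->].
Qed.

(** The minimizer provides a centered solution, and existence is what makes [xget] return a solution
    rather than its default value 0. *)
Lemma Linv_spec f : domD mu p q f -> Ex mu f = 0 ->
  ('E_P[Linv P X (fun w => f (B w))] = 0)%E /\ is_L P X (Linv P X (fun w => f (B w))) (fun w => f (B w)).
Proof.
move=> df f0; have hf := proj1 df.
have [h [dh h0 hser]] := pregenerator_inverse p01 pq1 rsp df f0.
have hh := proj1 dh.
suff H : exists H, ('E_P[H] = 0)%E /\ is_L P X H (fun w => f (B w)).
  exact: (@xgetPex _ (fun=> 0) [set H | ('E_P[H] = 0)%E /\ is_L P X H (fun w => f (B w))] H).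
exists (fun w => h (B w)); split; first by rewrite (E_bits (L2_L1 hh)) h0.
exists (fun k w => Ym p q k (B w) * Dh p q k h (B w)).
have hD := domD_is_D dh; split=> //; split; first by case: hD.
  exact: (L2X_bits (L2_meas (L2N hf))).2 (L2N hf).
move=> F V hFV.
have [phi hphi FE] := L2X_factor (let: And3 a _ _ := hFV in a).
rewrite FE in hFV *.
have [dphi VE] := is_D_domD (L2_meas hphi) hFV.
have [_ [mV _] _] := hFV.
rewrite E_mulN_bits//.
rewrite -(cvg_EFin_series (hser _ dphi)); apply: eq_eseriesr => k _.
rewrite (@E_mul_Dh phi h _ (V k) k dphi dh _ (measurable_wrt_fun (mV k)) (VE k))//.
- have hY : L2 mu (fun x => Ym p q k x * Dh p q k h x) by apply: L2_Ym => //; exact: L2_Dh.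
  exact: (measurable_transfer (B : {mfun T >-> bits}) (L2_meas hY)).
- exact: filterE.
Qed.

End operators.

(** * Comparison with the normal distribution *)

Section gaussian_target.
Context {R : realType} {d : measure_display} {T : measurableType d} (P : probability T R)
  (Z : {RV P >-> R}).
Hypothesis hZ : forall A : set R, measurable A -> distribution P Z A = normal_prob 0 1 A.
Local Notation leb := (@lebesgue_measure R).

Lemma ge0_integral_normal (f : R -> \bar R) : measurable_fun setT f -> (forall x, 0 <= f x)%E ->
  (\int[P]_w f (Z w) = \int[leb]_x (f x * (gphi x)%:E))%E.
Proof.
move=> mf f0.
have ND : normal_prob 0 1 `<< leb := normal_prob_dominates 0 1.
have mg : measurable_fun setT (fun x => (gphi x)%:E : \bar R) := measurable_int _ integrable_gphi.
(* [R] and [measurableTypeR R] have the same measurable sets but are distinct as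
   measurable types; [normal_prob] is a measure on the latter only. *)
have mZ : measurable_fun setT (Z : T -> measurableTypeR R) by move=> _ Y mY; exact: (measurable_funP Z measurableT Y mY).
pose Z' : {mfun T >-> measurableTypeR R} := HB.pack (Z : T -> measurableTypeR R) (isMeasurableFun.Build _ _ _ _ _ mZ).
have mf' : measurable_fun (setT : set (measurableTypeR R)) f by exact: mf.
transitivity (\int[distribution P Z']_x f x)%E; first by rewrite (ge0_integral_distribution Z' mf' f0).
rewrite (@eq_measure_integral _ (measurableTypeR R) R setT (normal_prob 0 1) (distribution P Z') f); last first.
  by move=> A mA _; exact: hZ.
(* The Radon-Nikodym density is identified almost everywhere with phi, because both have the same
   integrals over measurable sets. *)
rewrite -(Radon_Nikodym_SigmaFinite.change_of_variables ND f0 measurableT mf).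
have mD : measurable_fun setT (Radon_Nikodym_SigmaFinite.f (normal_prob 0 1) leb).
  exact: measurable_int (Radon_Nikodym_SigmaFinite.f_integrable ND).
apply: ae_eq_integral => //; [exact: emeasurable_funM|exact: emeasurable_funM|].
apply: ae_eqe_mul2l; apply: integral_ae_eq => //.
  exact: (Radon_Nikodym_SigmaFinite.f_integrable ND).
by move=> E _ mE; rewrite -Radon_Nikodym_SigmaFinite.f_integral.
Qed.

Lemma expectation_normal h : lip1 h -> ('E_P[h \o Z] = (gtot h)%:E)%E.
Proof.
move=> hl.
have mh : measurable_fun setT (EFin \o h).
  by apply/measurable_EFinP; apply: continuous_measurable_fun; exact: lip1_continuous.
have ih := gint_lip1 hl.
rewrite /gtot /Rintegral fineK; last exact: integrable_fin_num ih.
rewrite unlock (integralE _ _ (EFin \o (h \o Z))) (integralE leb).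
have M (a b : R) : 0 <= b -> (maxe (a * b)%:E 0 = maxe a%:E 0 * b%:E)%E.
  by move=> b0; rewrite maxe_pMl ?lee_fin// mul0e.
congr (_ - _)%E.
- transitivity (\int[P]_w ((EFin \o h)^\+ (Z w)))%E.
    by apply: eq_integral => w _; rewrite !funeposE.
  rewrite (ge0_integral_normal (measurable_funepos mh) (funepos_ge0 _)).
  by apply: eq_integral => x _; rewrite !funeposE M// ltW// gphi_gt0.
- transitivity (\int[P]_w ((EFin \o h)^\- (Z w)))%E.
    by apply: eq_integral => w _; rewrite !funenegE.
  rewrite (ge0_integral_normal (measurable_funeneg mh) (funeneg_ge0 _)).
  by apply: eq_integral => x _; rewrite !funenegE -!EFinN -mulNr M// ltW// gphi_gt0.
Qed.

Lemma probability_normal z : P [set w | Z w <= z] = (gPhi z)%:E.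
Proof.
transitivity (distribution P Z `]-oo, z]%classic).
  by congr (P _); apply/seteqP; split=> w /=; rewrite in_itv.
rewrite hZ// /normal_prob /gPhi /gleft /Rintegral.
rewrite fineK; first by apply: eq_integral => x _; rewrite mul1r.
apply: integrable_fin_num => //.
apply: (integrableS measurableT) => //.
by apply: (@gint_lip1 _ (fun=> 1)) => x y; rewrite subrr normr0.
Qed.

End gaussian_target.

(** * From the law of the bits to the distances *)

Section transfer_bounds.
Context {R : realType} {d : measure_display} {T : measurableType d} (P : probability T R)
  (X : nat -> {RV P >-> R}) (p q : nat -> R) (hX : rademacher_seq X p q)
  {d' : measure_display} {T' : measurableType d'} (P' : probability T' R) (Z : {RV P' >-> R}).
Hypothesis hZ : forall A : set R, measurable A -> distribution P' Z A = normal_prob 0 1 A.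
Local Notation B := (bits_of X).
Local Notation mu := (law X).
Variables (f : bits -> R) (v : nat -> bits -> R) (Cv : R) (V V' : nat -> T -> R).
Hypotheses (df : domD mu p q f) (vfree : forall k, free_of k (v k)) (vL2 : forall k, L2 mu (v k))
  (venergy : forall K, \sum_(k < K) N2 mu (v k) <= Cv)
  (ibp : forall phi, domD mu p q phi ->
     series (fun k => Ex mu (fun x => v k x * Dh p q k phi x)) n @[n --> \oo] -->
       Ex mu (fun x => f x * phi x))
  (VE : forall k, \forall w \ae P, V k w = v k (B w))
  (V'E : forall k, \forall w \ae P, `|V' k w| = `|v k (B w)|).
Let DF k w := Dh p q k f (B w).
Let Y k w := Ym p q k (B w).
Let p01 := rad_param hX.
Let pq1 := rad_compl hX.
Let rsp := law_resample hX.

Let E_le (g : bits -> R) (G : T -> R) : measurable_fun setT g -> (forall x, 0 <= g x) ->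
  (forall w, 0 <= G w) -> (\forall w \ae P, g (B w) = G w) -> ('E_mu[g] <= 'E_P[G])%E.
Proof.
move=> mg g0 G0 gG; rewrite (transfer_expectation P _ mg g0).
by apply: le_expectation_nonmeas => //; exact: (measurable_transfer (B : {mfun T >-> bits}) mg).
Qed.

(** The union of countably many null sets is null, so almost surely all terms of the two series
    coincide at once. *)
Let rsum_ae (W : nat -> bits -> R) (U : nat -> T -> R) (S : bits -> R) :
  (\forall x \ae mu, series (W ^~ x) n @[n --> \oo] --> S x) ->
  (forall k, \forall w \ae P, U k w = W k (B w)) -> \forall w \ae P, S (B w) = rsum U w.
Proof.
move=> /(transfer_ae (P := P) (B := (B : {mfun T >-> bits}))) WS /ae_foralln UW.
apply: filterS2 WS UW => w WS UW; apply/esym/cvg_lim => //.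
by rewrite (_ : U ^~ w = W ^~ (B w))//; apply/funext.
Qed.

Let mDF k : measurable_fun setT (Dh p q k f).
Proof. by apply: L2_meas; apply: (L2_Dh p01 pq1 rsp); case: df. Qed.

Let mv k : measurable_fun setT (v k). Proof. exact: L2_meas (vL2 k). Qed.

Let disc_le S : L1 mu S ->
  (\forall x \ae mu, series (fun k => v k x * Dh p q k f x * Ym p q k x ^+ 2) n @[n --> \oo] --> S x) ->
  ('E_mu[(fun x => `|1 - S x|)%R] <=
    'E_P[(fun w => `|1 - rsum (fun k w => V k w * DF k w * Y k w ^+ 2) w|)%R])%E.
Proof.
move=> iS cS; apply: E_le => //.
  by apply: measurableT_comp => //; apply: measurable_funB => //; exact: L1_meas iS.
apply: (filterS _ (@rsum_ae (fun k x => v k x * Dh p q k f x * Ym p q k x ^+ 2)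
  (fun k w => V k w * DF k w * Y k w ^+ 2) S cS _)) => [w -> //|k].
by apply: filterS (VE k) => w ->.
Qed.

Lemma dW_transfer : (dW P P' (fun w => f (B w)) Z <=
  (Num.sqrt (2 / pi))%:E *
    'E_P[(fun w => `|1 - rsum (fun k w => V k w * DF k w * Y k w ^+ 2) w|)%R]
  + \sum_(k <oo) ((1 - 2 * p k * q k) / Num.sqrt (p k * q k))%:E *
      'E_P[(fun w => `|V k w| * DF k w ^+ 2)%R])%E.
Proof.
have [S [iS cS bound]] := wasserstein_bound p01 pq1 rsp df vfree vL2 venergy ibp.
apply: ge_ereal_sup => _ [h hlip <-].
have hl : lip1 h.
  by move=> x y; have := hlip (x, y); rewrite /= mul1r; apply.
have lh : L2 mu (fun x => h (f x)).
  by apply: (@L2_lip _ mu h 1) => [x y|]; [rewrite mul1r; exact: hl|case: df].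
rewrite (expectation_normal hZ hl).
have -> : ('E_P[h \o (fun w => f (B w))] = (Ex mu (fun x => h (f x)))%:E)%E.
  by rewrite -(E_bits (L2_L1 lh)).
rewrite -EFinB; apply: le_trans (bound h hl) _.
apply: leeD.
  by apply: lee_wpmul2l; [rewrite lee_fin sqrtr_ge0|exact: disc_le].
have c0 k : 0 <= (1 - 2 * p k * q k) / spq p q k.
  by rewrite onem2pq// divr_ge0 ?addr_ge0 ?sqr_ge0// ltW// spq_gt0.
apply: lee_nneseries => [k _ _|k _].
  by rewrite mule_ge0 ?lee_fin// expectation_ge0// => x; rewrite mulr_ge0 ?sqr_ge0.
apply: lee_wpmul2l; first by rewrite lee_fin.
apply: E_le => [|x|w|].
- by apply: measurable_funM; [exact: measurableT_comp|exact: measurable_funX].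
- by rewrite mulr_ge0 ?sqr_ge0.
- by rewrite mulr_ge0 ?sqr_ge0.
- by apply: filterS (VE k) => w ->.
Qed.

(** [V] carries the sign of the weight and [V'] only its modulus: in the Malliavin-Stein bound they
    are the gradients of -L^-1 F and of L^-1 F respectively. *)
Lemma dK_transfer : (dK P P' (fun w => f (B w)) Z <=
  'E_P[(fun w => `|1 - rsum (fun k w => V k w * DF k w * Y k w ^+ 2) w|)%R]
  + 2%:E * \sum_(k <oo) `|p k - q k|%:E * 'E_P[(fun w => `|V' k w| * `|DF k w|)%R]
  + 4%:E * 'E_P[(fun w => `|rsum (fun k w =>
      Num.sqrt (p k * q k) * (`|V' k w| * DF k w) * Y k w) w|)%R])%E.
Proof.
have [S [S' [iS iS' cS cS' bound]]] := kolmogorov_bound p01 pq1 rsp df vfree vL2 venergy ibp.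
apply: ge_ereal_sup => _ [z _ <-].
rewrite (probability_normal hZ).
have mf : measurable_fun setT f := L2_meas (proj1 df).
have mA : measurable [set x | f x <= z].
  rewrite -[X in measurable X]setTI; have := mf measurableT `]-oo, z]%classic (measurable_itv _).
  by congr measurable; congr (_ `&` _); apply/seteqP; split => x /=; rewrite in_itv.
have kE : (fun x => kind z (f x)) = \1_[set x | f x <= z].
  apply/funext => x; rewrite /kind indicE; case: ifPn => xz; first by rewrite mem_set.
  by rewrite memNset//=; exact/negP.
have -> : P [set w | f (B w) <= z] = (Ex mu (fun x => kind z (f x)))%:E.
  rewrite -ExE; last first.
    rewrite kE; apply: (@L1_le _ _ _ _ _ (fun=> 1)) => //; first exact: L1_cst.
    by move=> x; rewrite indicE ger0_norm// lern1 leq_b1.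
  transitivity (\int[mu]_x (\1_[set x | f x <= z] x)%:E)%E; first by rewrite integral_indic// setIT.
  by apply: eq_integral => x _; rewrite -kE.
rewrite -EFinB; apply: le_trans (bound z) _.
apply: leeD; [apply: leeD; first exact: disc_le|]; apply: lee_wpmul2l; rewrite ?lee_fin//.
  apply: lee_nneseries => [k _ _|k _].
    by rewrite mule_ge0 ?lee_fin// expectation_ge0// => x; rewrite mulr_ge0.
  apply: lee_wpmul2l; first by rewrite lee_fin.
  apply: E_le => [|x|w|].
  - by apply: measurable_funM; exact: measurableT_comp.
  - by rewrite mulr_ge0.
  - by rewrite mulr_ge0.
  - by apply: filterS (V'E k) => w ->.
apply: E_le => //; first by apply: measurableT_comp => //; exact: L1_meas iS'.
apply: (filterS _ (@rsum_ae (fun k x => spq p q k * (`|v k x| * Dh p q k f x) * Ym p q k x)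
  (fun k w => Num.sqrt (p k * q k) * (`|V' k w| * DF k w) * Y k w) S' cS' _)) => [w -> //|k].
by apply: filterS (V'E k) => w ->.
Qed.

End transfer_bounds.

Unset Implicit Arguments.

Theorem corollary3p12 (R : realType)
  (d : measure_display) (T : measurableType d) (P : probability T R)
  (X : nat -> {RV P >-> R}) (p q : nat -> R)
  (hX : rademacher_seq X p q)
  (F : T -> R) (domF : dom_D P X F) (centF : ('E_P[F] = 0)%E)
  (d' : measure_display) (T' : measurableType d') (P' : probability T' R)
  (Z : {RV P' >-> R})
  (hZ : forall A : set R, measurable A ->
     distribution P' Z A = normal_prob 0 1 A) :
  let Y := normalized X p q in
  let DF := fun k => Dhat X p q k F in
  let DNLF := fun k => Dhat X p q k (\- Linv P X F) in
  let DLF := fun k => Dhat X p q k (Linv P X F) in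
  let EDF := fun k => condexp P (sigma_gen X [set j | (j < k)%N]) (DF k) in
  [/\ (dW P P' F Z <=
        (Num.sqrt (2 / pi))%:E *
          'E_P[(fun w => `|1 - rsum (fun k w => DNLF k w * DF k w * Y k w ^+ 2) w|)%R]
        + \sum_(k <oo) ((1 - 2 * p k * q k) / Num.sqrt (p k * q k))%:E *
            'E_P[(fun w => `|DNLF k w| * DF k w ^+ 2)%R])%E,
      (dK P P' F Z <=
        'E_P[(fun w => `|1 - rsum (fun k w => DNLF k w * DF k w * Y k w ^+ 2) w|)%R]
        + 2%:E * \sum_(k <oo) `|p k - q k|%:E *
            'E_P[(fun w => `|DLF k w| * `|DF k w|)%R]
        + 4%:E * 'E_P[(fun w => `|rsum (fun k w =>
            Num.sqrt (p k * q k) * (`|DLF k w| * DF k w) * Y k w) w|)%R])%E,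
      (dW P P' F Z <=
        (Num.sqrt (2 / pi))%:E *
          'E_P[(fun w => `|1 - rsum (fun k w => (EDF k w * DF k w) * Y k w ^+ 2) w|)%R]
        + \sum_(k <oo) ((1 - 2 * p k * q k) / Num.sqrt (p k * q k))%:E *
            'E_P[(fun w => `|EDF k w| * DF k w ^+ 2)%R])%E &
      (dK P P' F Z <=
        'E_P[(fun w => `|1 - rsum (fun k w => (EDF k w * DF k w) * Y k w ^+ 2) w|)%R]
        + 2%:E * \sum_(k <oo) `|p k - q k|%:E *
            'E_P[(fun w => `|EDF k w| * `|DF k w|)%R]
        + 4%:E * 'E_P[(fun w => `|rsum (fun k w =>
            Num.sqrt (p k * q k) * (`|EDF k w| * DF k w) * Y k w) w|)%R])%E].
Proof.
move=> Y DF DNLF DLF EDF.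
have p01 := rad_param hX; have pq1 := rad_compl hX; have rsp := law_resample hX.
have [U hU] := domF; have [hF _ _] := hU.
have [f [mf FE DfE]] := Dhat_bits hX (proj1 hF); subst F.
have [df _] := is_D_domD hX mf hU.
have hf := proj1 df.
have f0 : Ex (law X) f = 0 by move: centF; rewrite (E_bits (L2_L1 hf)) => -[].
have [C hC] := domD_energy p01 pq1 rsp df.
have hDf k : L2 (law X) (Dh p q k f) by exact: L2_Dh.
have YE : Y = fun k w => Ym p q k (bits_of X w).
  by apply/funext => k; apply/funext => w; exact: normalized_bits hX k w.
have DFE : DF = fun k w => Dh p q k f (bits_of X w) by apply/funext.
have [_ hL] := Linv_spec hX df f0.
move: hL @DNLF @DLF; set Lf := Linv _ _ _ => hL DNLF DLF.
have [U' [hU' _]] := hL; have [hLf _ _] := hU'.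
have [l [ml LE DLE]] := Dhat_bits hX (proj1 hLf).
have [dl _ ser] : [/\ domD (law X) p q l, L2 (law X) f & forall phi, domD (law X) p q phi ->
    series (fun k => Ex (law X) (fun x => Dh p q k phi x * Dh p q k l x)) n @[n --> \oo] -->
      - Ex (law X) (fun x => phi x * f x)].
  by apply: (is_L_bits hX ml mf); rewrite -LE.
have hl := proj1 dl.
have mNLf : measurable_wrt (sigma_gen X setT) (\- Lf).
  rewrite LE; exact: (measurable_wrt_bits (g := fun x => - l x) (L2_meas (L2N hl)) (depends_setT _)).
(* The representatives of L^-1 F and of its negative are picked separately, so m = -l is available
   only almost everywhere, and the gradients are compared through [Dh_ae]. *)
have [m [mm ME DME]] := Dhat_bits hX mNLf.
have ml_ae : \forall x \ae law X, m x = - l x.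
  apply: (transfer_ae_eq (P := P) (B := bits_of X) mm (L2_meas (L2N hl))).
  by apply: filterE => w; have := congr1 (fun G => G w) ME; rewrite /= LE.
have hm : L2 (law X) m.
  by apply: (ae_eq_N2 (L2N hl) mm _).1; apply: filterS ml_ae => x ->.
pose v k x := - Dh p q k l x.
have hv k : L2 (law X) (v k) by apply: L2N; exact: L2_Dh.
have [Cl hCl] := domD_energy p01 pq1 rsp dl.
have vE K : \sum_(k < K) N2 (law X) (v k) <= Cl.
  by apply: le_trans (hCl K); apply: ler_sum => k _; rewrite N2N.
have vfree k : free_of k (v k) by move=> b x; rewrite /v Dh_free.
have vibp phi : domD (law X) p q phi ->
    series (fun k => Ex (law X) (fun x => v k x * Dh p q k phi x)) n @[n --> \oo] -->
      Ex (law X) (fun x => f x * phi x).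
  move=> dphi; have hphi := proj1 dphi.
  have := cvgN (ser _ dphi); rewrite opprK.
  rewrite (_ : - _ = fun n => series (fun k => Ex (law X) (fun x => v k x * Dh p q k phi x)) n).
    rewrite (@eq_Ex _ _ _ _ (fun x => f x * phi x) (fun x => phi x * f x)); first exact.
    by move=> x; rewrite mulrC.
  apply/funext => n; rewrite fctE !series_sumE -sumrN; apply: eq_bigr => k _.
  rewrite -ExN; last by apply: L2_mul; exact: L2_Dh.
  by apply: eq_Ex => x; rewrite /v mulNr mulrC.
have VE k : \forall w \ae P, DNLF k w = v k (bits_of X w).
  have /transfer_ae := Dh_ae hX hm (L2N hl) ml_ae k.
  apply: filterS => w; rewrite /DNLF DME => ->; rewrite /v /Dh; ring.
have V'E k : \forall w \ae P, `|DLF k w| = `|v k (bits_of X w)|.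
  by apply: filterE => w; rewrite /DLF DLE /v normrN.
pose c k := Ege (law X) k (Dh p q k f).
have hc k : L2 (law X) (c k) by exact: L2_Ege.
have cE K : \sum_(k < K) N2 (law X) (c k) <= C.
  by apply: le_trans (hC K); apply: ler_sum => k _; exact: N2_Ege_le.
have cfree k : free_of k (c k) by exact: Ege_free.
have cibp phi : domD (law X) p q phi ->
    series (fun k => Ex (law X) (fun x => c k x * Dh p q k phi x)) n @[n --> \oo] -->
      Ex (law X) (fun x => f x * phi x).
  by move=> [hphi _]; exact: clark_ocone.
have EE k : \forall w \ae P, EDF k w = c k (bits_of X w).
  have -> : EDF k = condexp P (sigma_gen X [set j | (j < k)%N]) (fun w => Dh p q k f (bits_of X w)).
    by rewrite /EDF DFE.
  exact: (condexp_Ege hX k (hDf k)).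
have EE' k : \forall w \ae P, `|EDF k w| = `|c k (bits_of X w)|.
  by apply: filterS (EE k) => w ->.
rewrite YE DFE; split.
- exact (dW_transfer hX hZ df vfree hv vE vibp VE).
- exact (dK_transfer hX hZ df vfree hv vE vibp VE V'E).
- exact (dW_transfer hX hZ df cfree hc cE cibp EE).
- exact (dK_transfer hX hZ df cfree hc cE cibp EE EE').
Qed.
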